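(* Each of the knots $8_5$, $8_{17}$, $8_{18}$, $4_1\#4_1$, $9_{47}$, $9_{49}$ has $9$-crossing number equal to $1$; that is, $c_9(K)=1$ for each such knot $K$.
   Context: For an integer $n\ge 2$, an $n$-crossing is a point of a knot projection at which exactly $n$ strands of the knot intersect, each strand passing straight through the point (so it separates the other $2(n-1)$ strand ends evenly), together with the information of the over/under order of the $n$ strands. An $n$-crossing projection of a knot $K$ is a diagram of $K$ in the plane all of whose crossings are $n$-crossings. The $n$-crossing number $c_n(K)$ is the smallest number of crossings in any $n$-crossing projection of $K$. Knot names refer to the standard (Rolfsen) knot table, and $\#$ denotes connected sum. *)

(* Defs.v *)
From mathcomp Require Import all_boot all_order all_algebra.
From mathcomp Require Import all_classical all_reals all_analysis.

Set Implicit Arguments.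
Unset Strict Implicit.
Unset Printing Implicit Defensive.

Import Order.TTheory GRing.Theory Num.Theory.
Import numFieldNormedType.Exports.

Local Open Scope classical_set_scope.
Local Open Scope card_scope.
Local Open Scope ring_scope.

(* Three-space is the plane times the vertical axis, so that [fst] is the
   projection used for knot diagrams and [snd] is the height. *)
Notation plane R := (R^o * R^o)%type.
Notation space3 R := (R^o * R^o * R^o)%type.

Section AmbientIsotopy.
Variable R : realType.

Definition homeomorphism (f : space3 R -> space3 R) : Prop :=
  continuous f /\
  exists g : space3 R -> space3 R, [/\ continuous g, cancel f g & cancel g f].

Definition ambient_isotopic (K K' : set (space3 R)) : Prop :=
  exists H : R -> space3 R -> space3 R,
    [/\ {within `[0, 1] `*` [set: space3 R],
           continuous (fun q : R * space3 R => H q.1 q.2)},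
        forall t : R, t \in `[0, 1] -> homeomorphism (H t),
        forall x, H 0 x = x
      & H 1 @` K = K'].

End AmbientIsotopy.

Section Polygons.
Variable R : realType.
Implicit Type p : seq (space3 R).

(* A closed polygon is given by the cyclic list [p] of its vertices. The pair
   [(i, t)] with [0 <= t < 1] parametrizes the point at parameter [t] of the
   [i]-th edge; every point of the circle has exactly one parameter. *)
Definition params p : set (nat * R) :=
  [set q | (q.1 < size p)%N /\ 0 <= q.2 < 1].

Definition edge_vector p (i : nat) : space3 R :=
  nth 0 p (i.+1 %% size p)%N - nth 0 p i.

Definition polygon_point p (q : nat * R) : space3 R :=
  nth 0 p q.1 + q.2 *: edge_vector p q.1.

Definition polygon p : set (space3 R) := polygon_point p @` params p.

Definition simple_polygon p : Prop :=
  (2 < size p)%N /\ set_inj (params p) (polygon_point p).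

Definition strands p (x : plane R) : set (nat * R) :=
  [set q | params p q /\ (polygon_point p q).1 = x].

Definition det2 (u v : plane R) : R := u.1 * v.2 - u.2 * v.1.

Definition multiple_points p : set (plane R) :=
  [set x | exists q q', [/\ strands p x q, strands p x q' & q <> q']].

(* Each strand is the interior of a straight edge, hence passes straight
   through [x]; as the strands are pairwise transverse, each of them has
   [n - 1] ends of the other strands on either side. The heights of the [n]
   points above [x], distinct for a simple polygon, are the crossing
   information. *)
Definition n_crossing (n : nat) p (x : plane R) : Prop :=
  [/\ strands p x #= `I_n,
      forall q, strands p x q -> 0 < q.2
    & forall q q', strands p x q -> strands p x q' -> q <> q' ->
        det2 (edge_vector p q.1).1 (edge_vector p q'.1).1 != 0].

Definition n_crossing_projection (n : nat) p : Prop :=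
  simple_polygon p /\ forall x, multiple_points p x -> n_crossing n p x.

Definition has_n_crossing_projection (n : nat) (K : set (space3 R)) (m : nat) :
    Prop :=
  exists p, [/\ n_crossing_projection n p, ambient_isotopic K (polygon p)
              & multiple_points p #= `I_m].

(* [crossing_number n K m] means that c_n(K) exists and equals [m]. *)
Definition crossing_number (n : nat) (K : set (space3 R)) (m : nat) : Prop :=
  has_n_crossing_projection n K m /\
  forall k, has_n_crossing_projection n K k -> (m <= k)%N.

End Polygons.

(* A braid is a number of strands together with a word, in which the letter
   [i > 0] stands for the generator sigma_i, exchanging the positions [i] and
   [i + 1] (counted from 1), and [- i] for its inverse. *)
Definition braid : Type := (nat * seq int)%type.

(* The second braid is shifted so that its first strand is the last strand of
   the first braid: when both closures are knots, the closure is their connected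
   sum. *)
Definition connected_sum (b c : braid) : braid :=
  let shift (g : int) : int := sgz g * (absz g + b.1.-1)%N%:Z in
  ((b.1 + c.1).-1, b.2 ++ [seq shift g | g <- c.2]).

Section ClosedBraid.
Variable R : realType.

Definition lattice_point (x y : nat) (z : int) : space3 R :=
  (x%:R, y%:R, z%:~R).

(* The vertices met by the strand that is in position [j] before the letter
   number [k], and its final position. Position [j] is at [y = 2 j] and the
   letter number [k] occupies [2 k <= x <= 2 k + 2]; the two exchanged strands
   meet in projection at the middle of this slab, at heights [1] and [- 1].
   With sigma_i a positive crossing, the strand going from [i] to [i + 1] is
   the lower one in sigma_i. *)
Fixpoint braid_strand (k j : nat) (w : seq int) : seq (space3 R) * nat :=
  if w is g :: w' then
    let i := absz g in
    let: (j', mid) :=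
      if j == i then (i.+1, [:: lattice_point k.*2.+1 i.*2.+1 (- sgz g)])
      else if j == i.+1 then (i, [:: lattice_point k.*2.+1 i.*2.+1 (sgz g)])
      else (j, [::]) in
    let: (v, e) := braid_strand k.+1 j' w' in
    (lattice_point k.*2 j.*2 0 :: mid ++ v, e)
  else ([:: lattice_point k.*2 j.*2 0], j).

(* A strand ending in position [e] is brought back to the start of position [e]
   behind the braid, through a vertex at height [- 1] in the plane [y = 2 e].
   The [n] strands of a braid on [n] strands are followed one after the other
   from position [1], which exhausts the closure when it is a knot. *)
Fixpoint closed_braid_vertices (n j : nat) (w : seq int) : seq (space3 R) :=
  if n is n'.+1 then
    let: (v, e) := braid_strand 0 j w in
    v ++ lattice_point (size w) e.*2 (-1) :: closed_braid_vertices n' e w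
  else [::].

Definition closed_braid (b : braid) : set (space3 R) :=
  polygon (closed_braid_vertices b.1 1 b.2).

Definition mirror_image (K : set (space3 R)) : set (space3 R) :=
  (fun x : space3 R => (x.1, - x.2)) @` K.

(* As in the knot tables, a name does not distinguish a knot from its mirror
   image. *)
Definition knot_type (b : braid) : set (set (space3 R)) :=
  [set K | ambient_isotopic (closed_braid b) K \/
           ambient_isotopic (mirror_image (closed_braid b)) K].

End ClosedBraid.

(* The words for 4_1, 8_5, 8_17, 8_18 and 9_47 close up to diagrams with the
   minimal number of crossings. The Alexander polynomials are
     4_1  : 1 -3 1                    8_5  : 1 -3 4 -5 4 -3 1
     8_17 : 1 -4 8 -11 8 -4 1         8_18 : 1 -5 10 -13 10 -5 1
     9_47 : 1 -4 6 -5 6 -4 1          9_49 : 3 -6 7 -6 3                  *)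
Definition braid_4_1 : braid := (3%N, [:: 1; -2; 1; -2]%Z).
Definition braid_8_5 : braid := (3%N, [:: 1; 1; 1; -2; 1; 1; 1; -2]%Z).
Definition braid_8_17 : braid := (3%N, [:: 1; 1; -2; 1; -2; 1; -2; -2]%Z).
Definition braid_8_18 : braid := (3%N, [:: 1; -2; 1; -2; 1; -2; 1; -2]%Z).
Definition braid_9_47 : braid := (4%N, [:: 1; 2; -3; 2; 1; 2; -3; 2; -3]%Z).
Definition braid_9_49 : braid :=
  (4%N, [:: 1; 1; 2; 1; 1; -3; 2; -1; 2; 3; 3]%Z).

Definition knot_8_5 (R : realType) := @knot_type R braid_8_5.
Definition knot_8_17 (R : realType) := @knot_type R braid_8_17.
Definition knot_8_18 (R : realType) := @knot_type R braid_8_18.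
Definition knot_4_1_sum_4_1 (R : realType) :=
  @knot_type R (connected_sum braid_4_1 braid_4_1).
Definition knot_9_47 (R : realType) := @knot_type R braid_9_47.
Definition knot_9_49 (R : realType) := @knot_type R braid_9_49.

(* Main.v *)
From Stdlib Require Import ZArith.
Require Import Defs.
From mathcomp Require Import all_boot all_order all_algebra all_fingroup.
From mathcomp Require Import all_classical all_reals all_analysis.
From mathcomp Require Import ssrZ zify ring lra.

(** Upper bound. Nine straight strands through the origin, at pairwise distinct
    heights, whose eighteen ends are joined by plane arcs without crossings into
    one closed curve, form a projection with a single multiple point
    ([star_projection]). The knot depends only on the order of the heights, and
    for one fixed system of arcs suitable orders give all six knots, up to
    mirror images; negating the heights gives the mirror images. The isotopy
    from the closed braid to such a polygon is a list of triangle moves: an edge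
    [ab] is replaced by [ac] and [cb] when the triangle [abc] meets the rest of
    the polygon only in [a] and [b]. Such a move is an ambient isotopy
    ([delta_move]), and on polygons with integral vertices its legality is
    decided by integer arithmetic ([free_triangle_isotopy]), so that the lists
    are validated by computation.

    Lower bound. A projection without crossings is injective, and it has to be
    shown that the knots are not trivial. The invariant is [cyclic_monodromy]: a
    property of the local systems on the complement, with values in a finite
    group, which says in effect that the image of the fundamental group is
    trivial or commutes with some element other than [1]. It is invariant under
    homeomorphisms of the space ([cyclic_monodromy_homeo]).

    It holds when the projection is injective ([cyclic_monodromy_no_crossing]).
    The points above the polygon and the points below it then cover the
    complement; a local system is trivial on either set, because both contract
    vertically towards infinity ([trivial_above]); and two trivializations
    differ by a function of the projection that is locally constant off a simple
    closed plane polygon, which takes at most two values ([two_values]). The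
    quotient of these two values generates the monodromy.

    It fails for the six knots ([grid_not_cyclic]). Each of them is brought by
    triangle moves to a polygon drawn on a grid, with its column edges above its
    row edges, that has a nontrivial colouring modulo an odd [p] (3, 5 or 37).
    The colouring defines a local system with values in the permutations of the
    integers modulo [p] ([grid_local_system]), whose monodromy contains the
    reflections at [0] and at [1]; only the identity commutes with both
    ([reflections_centralizer]). *)

Set Implicit Arguments.
Unset Strict Implicit.
Unset Printing Implicit Defensive.

Import Order.TTheory GRing.Theory Num.Theory.
Import numFieldNormedType.Exports.

Local Open Scope classical_set_scope.
Local Open Scope card_scope.
Local Open Scope ring_scope.

Delimit Scope Z_scope with BZ.

(** * Ambient isotopies *)

Section Isotopy.
Variable R : realType.
Implicit Types (K : set (space3 R)) (P Q : space3 R).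

Lemma homeomorphism_comp (f g : space3 R -> space3 R) :
  homeomorphism f -> homeomorphism g -> homeomorphism (f \o g).
Proof.
move=> [cf [f' [cf' fK f'K]]] [cg [g' [cg' gK g'K]]]; split.
  by move=> x; apply: continuous_comp; [exact: cg|exact: cf].
exists (g' \o f'); split; last 2 first.
- by move=> x /=; rewrite fK gK.
- by move=> x /=; rewrite g'K f'K.
by move=> x; apply: continuous_comp; [exact: cf'|exact: cg'].
Qed.

(** Continuity on the strip, phrased with arbitrary filters so that it composes:
    an isotopy built from others is continuous by applying their convergence
    along the filter at hand. *)
Lemma jointly_continuousP (H : R -> space3 R -> space3 R) :
  {within `[0, 1] `*` [set: space3 R],
     continuous (fun q : R * space3 R => H q.1 q.2)} <->
  forall (T : topologicalType) (F : set_system T) (u : T -> R)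
      (v : T -> space3 R) t x, Filter F -> u @ F --> t -> v @ F --> x ->
    t \in `[0, 1] -> (\forall s \near F, u s \in `[0, 1]) ->
    (fun s => H (u s) (v s)) @ F --> H t x.
Proof.
split=> [/subspace_continuousP cH T F u v t x FF ut vx t01 u01|cH].
  have A : (`[0, 1] `*` [set: space3 R]) (t, x) by split.
  have := cH (t, x) A; rewrite /= => cHt.
  apply: (@cvg_comp _ _ _ (fun s => (u s, v s))
    (fun q : R * space3 R => H q.1 q.2) _ (within (`[0, 1] `*` setT) (nbhs (t, x)))) => //.
  move=> B /= [[B1 B2]] /= [nB1 nB2] sB.
  near=> s; have /= := sB (u s, v s); apply.
    by split => /=; [near: s; exact: ut|near: s; exact: vx].
  by split => //=; near: s.
apply/subspace_continuousP => -[t x] [/= t01 _].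
apply: cH => //.
- exact: cvg_within_filter cvg_fst.
- exact: cvg_within_filter cvg_snd.
- by apply: filterS (@withinT _ _ _ _) => -[s y] [].
Unshelve. all: by end_near. Qed.

(** Composing at every time, instead of concatenating in time, keeps the maps
    continuous without gluing. *)
Lemma ambient_isotopic_trans K1 K2 K3 : ambient_isotopic K1 K2 ->
  ambient_isotopic K2 K3 -> ambient_isotopic K1 K3.
Proof.
move=> [H1 [/jointly_continuousP c1 h1 i1 <-]].
move=> [H2 [/jointly_continuousP c2 h2 i2 <-]].
pose H t x := H2 t (H1 t x).
exists H; split.
- apply/(jointly_continuousP H) => T F u v t x FF ut vx t01 u01.
  by apply: c2 => //; exact: c1.
- by move=> t t01; apply: homeomorphism_comp; [exact: h2|exact: h1].
- by move=> x /=; rewrite /H i1 i2.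
- by rewrite image_comp.
Qed.

Lemma unit1 : (1 : R) \in `[0, 1]. Proof. by rewrite in_itv/= lexx ler01. Qed.

(** Run the isotopy backwards after the inverse of its last map. *)
Lemma ambient_isotopic_sym K1 K2 :
  ambient_isotopic K1 K2 -> ambient_isotopic K2 K1.
Proof.
move=> [H [/jointly_continuousP c h i <-]].
have [cH1 [g [cg Hg gH]]] := h 1 unit1.
have u1 (t : R) : t \in `[0, 1] -> 1 - t \in `[0, 1].
  by rewrite !in_itv/= => /andP[? ?]; apply/andP; split; lra.
pose H' t x := H (1 - t) (g x).
exists H'; split.
- apply/(jointly_continuousP H') => T F u v t x FF ut vx t01 u01.
  apply: c; [|exact: cvg_comp vx (cg x)|exact: u1|].
  + by apply: cvgB => //; exact: cvg_cst.
  + by apply: filterS u01 => s; exact: u1.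
- move=> t t01; apply: homeomorphism_comp; first exact/h/u1.
  by split=> //; exists (H 1); split.
- by move=> x /=; rewrite /H' subr0 gH.
- rewrite image_comp; apply/seteqP; split=> [x [y Ky] /= <-|x Kx].
    by rewrite /H' Hg subrr i.
  by exists x => //=; rewrite /H' Hg subrr i.
Qed.

Lemma ambient_isotopic_refl K : ambient_isotopic K K.
Proof.
pose H (_ : R) (x : space3 R) := x.
exists H; split=> //.
- exact/(jointly_continuousP H).
- by move=> t _; split; [move=> x|exists idfun; split=> // x]; exact: cvg_id.
- by rewrite image_id.
Qed.

Lemma ambient_isotopic_homeo K1 K2 (f : space3 R -> space3 R) :
  homeomorphism f -> ambient_isotopic K1 K2 ->
  ambient_isotopic (f @` K1) (f @` K2).
Proof.
move=> hf [H [/jointly_continuousP c h i <-]].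
have [cf [g [cg fg gf]]] := hf.
pose H' t x := f (H t (g x)).
exists H'; split.
- apply/(jointly_continuousP H') => T F u v t x FF ut vx t01 u01.
  have := c T F u (g \o v) t (g x) FF ut (cvg_comp _ _ vx (cg x)) t01 u01.
  by move/cvg_comp; apply; exact: cf.
- move=> t t01; apply: (@homeomorphism_comp f (H t \o g)) => //.
  by apply: homeomorphism_comp; [exact: h|split=> //; exists f].
- by move=> x /=; rewrite /H' i gf.
- by rewrite !image_comp; apply: eq_imagel => x Kx /=; rewrite /H' fg.
Qed.

(** If [a] grows with slope [p] and [b] decreases with slope [q] along a line,
    the truncated minimum [m] of [a] and [b] at a point can be recovered from
    the values at the point moved by [t * m], because [1 + t * p] and
    [1 - t * q] are positive; this lemma and the next one are the two directions
    of that inversion. *)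
Lemma max0_shear (a b p q t m : R) : 0 < p -> 0 < q < 1 -> 0 <= t <= 1 ->
  m = Num.max 0 (Num.min a b) ->
  Num.max 0 (Num.min ((a + t * m * p) / (1 + t * p))
                     ((b - t * m * q) / (1 - t * q))) = m.
Proof.
move=> p0 /andP[q0 q1] /andP[t0 t1] ->.
have P0 : 0 < 1 + t * p by nra.
have Q0 : 0 < 1 - t * q by nra.
have [ab|ab] := leP a b.
- have [m0|m0] := leP 0 a; last first.
  + rewrite mulr0 !mul0r addr0 subr0; apply: max_l.
    by rewrite ge_min; apply/orP; left; rewrite ler_pdivrMr ?mul0r// ltW.
  + have -> : (a + t * a * p) / (1 + t * p) = a by field; rewrite gt_eqF.
    rewrite min_l; first exact: max_r.
    by rewrite ler_pdivlMr//; nra.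
- have [m0|m0] := leP 0 b; last first.
  + rewrite mulr0 !mul0r addr0 subr0; apply: max_l.
    by rewrite ge_min; apply/orP; right; rewrite ler_pdivrMr ?mul0r// ltW.
  + have -> : (b - t * b * q) / (1 - t * q) = b by field; rewrite gt_eqF.
    rewrite min_r; first exact: max_r.
    by rewrite ler_pdivlMr//; nra.
Qed.

Lemma max0_shearV (a b p q t m : R) : 0 < p -> 0 < q < 1 -> 0 <= t <= 1 ->
  m = Num.max 0 (Num.min (a / (1 + t * p)) (b / (1 - t * q))) ->
  Num.max 0 (Num.min (a - t * m * p) (b + t * m * q)) = m.
Proof.
move=> p0 /andP[q0 q1] /andP[t0 t1].
have P0 : 0 < 1 + t * p by nra.
have Q0 : 0 < 1 - t * q by nra.
set a' := a / _; set b' := b / _ => ->.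
have -> : a = a' * (1 + t * p) by rewrite /a' mulfVK ?gt_eqF.
have -> : b = b' * (1 - t * q) by rewrite /b' mulfVK ?gt_eqF.
have [ab|ab] := leP a' b'.
- have [m0|m0] := leP 0 a'; last first.
  + rewrite mulr0 !mul0r addr0 subr0; apply: max_l.
    by rewrite ge_min; apply/orP; left; rewrite pmulr_lle0// ltW.
  + rewrite min_l; last by nra.
    rewrite [X in Num.max _ X](_ : _ = a'); [exact: max_r|by ring].
- have [m0|m0] := leP 0 b'; last first.
  + rewrite mulr0 !mul0r addr0 subr0; apply: max_l.
    by rewrite ge_min; apply/orP; right; rewrite pmulr_lle0// ltW.
  + rewrite min_r; last by nra.
    rewrite [X in Num.max _ X](_ : _ = b'); [exact: max_r|by ring].
Qed.

Lemma continuous_max0min (al be : space3 R -> R) : continuous al ->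
  continuous be -> continuous (fun P => Num.max 0 (Num.min (al P) (be P)) : R).
Proof.
move=> cal cbe P.
apply: (@continuous_max _ _ (fun=> 0) (fun P => Num.min (al P) (be P))).
  exact: cvg_cst.
by apply: (@continuous_min _ _ al be); [exact: cal|exact: cbe].
Qed.

(** The map moves points along lines parallel to [e], on each of which the
    displacement is a tent function with slopes [p] and [- q]. As [q < 1], the
    map is increasing on every such line, also when the tent is scaled by
    [t <= 1], hence it is a homeomorphism with an explicit inverse. *)
Lemma shear_isotopy (al be : space3 R -> R) (e : space3 R) (p q : R) :
  continuous al -> continuous be ->
  (forall P s, al (P + s *: e) = al P + s * p) ->
  (forall P s, be (P + s *: e) = be P - s * q) ->
  0 < p -> 0 < q < 1 -> forall K,
  ambient_isotopic K
    ((fun P => P + Num.max 0 (Num.min (al P) (be P)) *: e) @` K).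
Proof.
move=> cal cbe ale bee p0 q01 K.
pose H (t : R) P := P + (t * Num.max 0 (Num.min (al P) (be P))) *: e.
have cH (T : topologicalType) (F : set_system T) (u : T -> R) (v : T -> space3 R) t x :
    Filter F -> u @ F --> t -> v @ F --> x -> H (u s) (v s) @[s --> F] --> H t x.
  move=> FF ut vx; apply: cvgD => //; apply: cvgZr_tmp; apply: cvgM => //.
  have := cvg_comp _ _ vx (continuous_max0min cal cbe (x := x)).
  exact.
exists H; split.
- by apply/(jointly_continuousP H) => T F u v t x FF ut vx _ _; exact: cH.
- move=> t; rewrite in_itv/= => t01; split.
    by move=> x; apply: cH; [exact: cvg_cst|exact: cvg_id].
  pose m' Q := Num.max 0 (Num.min (al Q / (1 + t * p)) (be Q / (1 - t * q))).
  exists (fun Q => Q - (t * m' Q) *: e); split.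
  + move=> x; apply: cvgB; first exact: cvg_id.
    apply: cvgZr_tmp; apply: cvgM; first exact: cvg_cst.
    by apply: continuous_max0min => y; apply: cvgM;
      [exact: cal|exact: cvg_cst|exact: cbe|exact: cvg_cst].
  + move=> P; rewrite /H; set m := Num.max 0 (Num.min (al P) (be P)).
    by rewrite /m' ale bee (max0_shear (m := m))// addrK.
  + move=> Q; rewrite /H -scaleNr ale bee mulNr !(mulNr (t * _)) opprK.
    by rewrite (max0_shearV (m := m' Q))// scaleNr subrK.
- by move=> x; rewrite /H mul0r scale0r addr0.
- by apply: eq_imagel => x _; rewrite /H mul1r.
Qed.

End Isotopy.

(** * Triangle moves *)

Section Triangle.
Variable R : realType.
Implicit Types (a b c P u v w : space3 R).

Definition dot u v : R := u.1.1 * v.1.1 + u.1.2 * v.1.2 + u.2 * v.2.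

Definition cross u v : space3 R :=
  (u.1.2 * v.2 - u.2 * v.1.2, u.2 * v.1.1 - u.1.1 * v.2,
   u.1.1 * v.1.2 - u.1.2 * v.1.1).

Definition segment a b : set (space3 R) :=
  [set a + t *: (b - a) | t in `[0, 1]%classic].

Definition segments (es : seq (space3 R * space3 R)) : set (space3 R) :=
  [set P | exists2 e, e \in es & segment e.1 e.2 P].

Lemma segment_sym a b : segment a b = segment b a.
Proof.
suff sub (c d : space3 R) : segment c d `<=` segment d c.
  by apply/seteqP; split; exact: sub.
move=> P [t]; rewrite /= in_itv/= => /andP[t0 t1] <-; exists (1 - t).
  by rewrite /= in_itv/= subr_ge0 t1/= gerBl.
by rewrite scalerBl scale1r -scalerN opprB addrA subrKC.
Qed.

Lemma in_segment a b P (t : R) : t \in `[0, 1] ->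
  P.1.1 = a.1.1 + t * (b.1.1 - a.1.1) -> P.1.2 = a.1.2 + t * (b.1.2 - a.1.2) ->
  P.2 = a.2 + t * (b.2 - a.2) -> segment a b P.
Proof.
case: a b P => [[a1 a2] a3] [[b1 b2] b3] [[x y] z] t01 /= -> -> ->.
by exists t.
Qed.

Lemma segments_eq (es fs : seq (space3 R * space3 R)) :
  es =i fs -> segments es = segments fs.
Proof.
by move=> ef; apply/seteqP; split=> P [e ee eP]; exists e => //; move: ee; rewrite ef.
Qed.

Lemma polygon_segments (p : seq (space3 R)) : (0 < size p)%N ->
  polygon p = segments (zip p (rot 1 p)).
Proof.
move=> p0.
have nE i : (i < size p)%N -> nth 0 (rot 1 p) i = nth 0 p (i.+1 %% size p).
  case: p p0 => [//|a p] _ /= hi; rewrite rot1_cons nth_rcons.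
  by move: hi; rewrite ltnS leq_eqVlt => /predU1P[->|hi];
    rewrite ?ltnn ?eqxx ?modnn// hi modn_small.
have eE i : (i < size p)%N ->
    nth (0, 0) (zip p (rot 1 p)) i = (nth 0 p i, nth 0 p (i.+1 %% size p)).
  by move=> hi; rewrite nth_zip ?size_rot// nE.
have szE : size (zip p (rot 1 p)) = size p by rewrite size_zip size_rot minnn.
apply/seteqP; split=> P.
- move=> [[i t] [/= hi /andP[t0 t1]] <-].
  exists (nth (0, 0) (zip p (rot 1 p)) i); first by rewrite mem_nth ?szE.
  by rewrite eE//; exists t => //=; rewrite in_itv/= t0 ltW.
- move=> [e /(nthP (0, 0))[i]]; rewrite szE => hi <-; rewrite eE// => -[t].
  rewrite /= in_itv/= => /andP[t0]; rewrite le_eqVlt => /predU1P[->|t1] <-.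
    exists ((i.+1 %% size p)%N, 0); first by split; rewrite /= ?ltn_mod// lexx ltr01.
    by rewrite /polygon_point/= scale0r addr0 scale1r addrC subrK.
  by exists (i, t) => //; split=> //=; rewrite t0.
Qed.

Lemma compact_segments (es : seq (space3 R * space3 R)) : compact (segments es).
Proof.
have -> : segments es = \big[setU/set0]_(e <- es) segment e.1 e.2.
  by apply/seteqP; split=> P; rewrite -bigcup_seq => -[e ? ?]; exists e.
apply: bigsetU_compact => e _; apply: continuous_compact; last exact: segment_compact.
apply: continuous_subspaceT => t.
apply: (@cvgD _ (space3 R) _ _ _ (fun=> e.1) (fun t => t *: (e.2 - e.1))).
  exact: cvg_cst.
by apply: (@cvgZr_tmp R (space3 R)); exact: cvg_id.
Qed.

Lemma dotDr u v w : dot u (v + w) = dot u v + dot u w.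
Proof. by rewrite /dot/=; ring. Qed.

Lemma dotBr u v w : dot u (v - w) = dot u v - dot u w.
Proof. by rewrite /dot/=; ring. Qed.

Lemma dotZr u (t : R) v : dot u (t *: v) = t * dot u v.
Proof. by rewrite /dot/= /GRing.scale/=; ring. Qed.

Lemma dotNl u v : dot (- u) v = - dot u v.
Proof. by rewrite /dot/=; ring. Qed.

Lemma dotDl u v w : dot (u + v) w = dot u w + dot v w.
Proof. by rewrite /dot/=; ring. Qed.

Lemma dotZl u (t : R) v : dot (t *: u) v = t * dot u v.
Proof. by rewrite /dot/= /GRing.scale/=; ring. Qed.

Lemma dot_self_gt0 u : u != 0 -> 0 < dot u u.
Proof.
move: u => [[x y] z]; apply: contraNT; rewrite -leNgt /dot/= => h.
have hx := sqr_ge0 x; have hy := sqr_ge0 y; have hz := sqr_ge0 z.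
have [x0 y0 z0] : [/\ x ^+ 2 = 0, y ^+ 2 = 0 & z ^+ 2 = 0].
  by move: hx hy hz; rewrite !expr2 => *; split; lra.
by move/eqP: x0 y0 z0; rewrite sqrf_eq0 => /eqP-> /eqP; rewrite sqrf_eq0 =>
  /eqP-> /eqP; rewrite sqrf_eq0 => /eqP->.
Qed.

Lemma continuous_dot v : continuous (dot v : space3 R -> R).
Proof.
move=> P; rewrite /dot.
have c1 : Q.1 @[Q --> P] --> P.1 by exact: cvg_fst.
apply: cvgD; first apply: cvgD; apply: cvgM; try exact: cvg_cst.
- by apply: cvg_comp c1 _; exact: cvg_fst.
- by apply: cvg_comp c1 _; exact: cvg_snd.
- exact: cvg_snd.
Qed.

Lemma cross_frame u v w P (n := cross u v) :
  dot P w * dot n n = dot (cross v n) w * dot P u +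
    dot (cross n u) w * dot P v + dot n w * dot P n.
Proof.
rewrite {}/n; move: u v w P => [[u1 u2] u3] [[v1 v2] v3] [[w1 w2] w3] [[p1 p2] p3].
by rewrite /dot /cross/=; ring.
Qed.

Lemma dot_crossl u v : dot (cross u v) u = 0.
Proof. by rewrite /dot /cross/=; ring. Qed.

Lemma dot_crossr u v : dot (cross u v) v = 0.
Proof. by rewrite /dot /cross/=; ring. Qed.

Lemma dot_cross_dual u v (n := cross u v) :
  (dot (cross v n) u = dot n n) * (dot (cross n u) v = dot n n).
Proof. by rewrite /n /dot /cross/=; split; ring. Qed.

(** A certificate that the segment [s] stays away from the triangle move: the
    affine function [dot v - k] is nonnegative on [s], negative at the new
    vertex [c], nonpositive at [a] and [b], and not zero at both. Thus [s] may
    touch the triangle at one end of the edge [ab] only, which is the position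
    of the two neighbouring edges. *)
Definition clear a b c (s : space3 R * space3 R) : Prop := exists v k,
  [/\ k <= dot v s.1, k <= dot v s.2 &
  [/\ dot v a <= k, dot v b <= k, dot v a + dot v b < k + k & dot v c < k]].

(** The support of the move in the coordinates where [a = (-1, 0, 0)],
    [b = (1, 0, 0)] and [c = (0, 1, 0)]: a thin neighbourhood of the triangle,
    where the function is positive, which reaches a distance [d] below the edge
    and [e] off the plane, and is pinched at [a] and [b]. *)
Definition lens d e (x y z : R) : R :=
  Num.min (1 - `|x| - `|z| / e + y / d) (1 - `|x| - `|z| / e - y / (1 + d)).

(** An affine function [g0 + gx x + gy y + gz z] that is nonnegative at [a] and
    [b] and positive at [c] and at the middle of [ab] is positive on the lens,
    once this is thin enough; a segment on which the function is nonpositive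
    does not meet it. *)
Lemma lens_small (g0 gx gy gz : R) : 0 < g0 -> `|gx| <= g0 -> 0 < g0 + gy ->
  exists2 eta, 0 < eta & forall d x y z, 0 < d <= eta ->
  g0 + gx * x + gy * y + gz * z <= 0 -> lens d d x y z <= 0.
Proof.
move=> g00 gxg g0y.
have D0 : 0 < `|gy| + `|gz| + 1 by rewrite ltr_wpDl// addr_ge0.
exists (Num.min g0 (g0 + gy) / (`|gy| + `|gz| + 1)).
  by rewrite divr_gt0// lt_min g00.
move=> d x y z /andP[d0]; rewrite ler_pdivlMr// le_min => /andP[dg dgy] gle.
rewrite leNgt /lens lt_min; apply/negP => /andP[].
set w := 1 - `|x| - `|z| / d => A B.
have d1 : 0 < 1 + d by rewrite addr_gt0.
have ny0 := normr_ge0 gy; have nz0 := normr_ge0 gz.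
have nx := normr_ge0 x; have nz := normr_ge0 z.
have A' : - y < d * w.
  have dy : d * (y / d) = y by rewrite mulrC mulfVK// gt_eqF.
  by have : 0 < d * (w + y / d); [exact: mulr_gt0|rewrite mulrDr dy; lra].
have B' : y < (1 + d) * w by move: B; rewrite subr_gt0 ltr_pdivrMr// mulrC.
have w0 : 0 < w by nra.
have dn : d * (`|z| / d) = `|z| by rewrite mulrC mulfVK// gt_eqF.
have z'0 : 0 <= `|z| / d by rewrite divr_ge0// ltW.
have Hx : - (g0 * `|x|) <= gx * x.
  have /ler_normlP[+ _] : `|gx * x| <= g0 * `|x|.
    by rewrite normrM ler_wpM2r.
  by rewrite lerNl.
have Hz : - (`|gz| * `|z|) <= gz * z.
  have /ler_normlP[+ _] : `|gz * z| <= `|gz| * `|z| by rewrite normrM.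
  by rewrite lerNl.
have Hw : g0 = g0 * w + g0 * `|x| + g0 * (`|z| / d) by rewrite /w; ring.
have Hzz : `|gz| * `|z| <= g0 * (`|z| / d).
  rewrite -[X in _ * X <= _]dn mulrA; apply: ler_wpM2r => //.
  by rewrite mulrC; nra.
have : g0 * w + gy * y <= 0 by lra.
apply/negP; rewrite -ltNge.
have [gy0|gy0] := leP 0 gy; have [y0|y0] := leP 0 y.
- by nra.
- rewrite ger0_norm// in dg dgy ny0 *.
  have : gy * (- y) <= gy * (d * w) by apply: ler_wpM2l => //; exact: ltW.
  have : (gy * d) * w < g0 * w by rewrite ltr_pM2r//; nra.
  by lra.
- rewrite ltr0_norm// in dg dgy ny0 *.
  have : (- gy) * y <= (- gy) * ((1 + d) * w) by apply: ler_wpM2l => //; exact: ltW.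
  have : (- gy * (1 + d)) * w < g0 * w by rewrite ltr_pM2r//; nra.
  by lra.
- by nra.
Qed.

Lemma tent_left a b c (t : R) :
  a + t *: (b - a) + (1 + (2 * t - 1)) *: (c - a - 2^-1 *: (b - a)) =
  a + (2 * t) *: (c - a).
Proof.
move: a b c => [[? ?] ?] [[? ?] ?] [[? ?] ?].
by congr (_, _, _); rewrite /= /GRing.scale/=; field.
Qed.

Lemma tent_right a b c (t : R) :
  a + t *: (b - a) + (1 - (2 * t - 1)) *: (c - a - 2^-1 *: (b - a)) =
  c + (2 * t - 1) *: (b - c).
Proof.
move: a b c => [[? ?] ?] [[? ?] ?] [[? ?] ?].
by congr (_, _, _); rewrite /= /GRing.scale/=; field.
Qed.

(** The shear pushes the middle of [ab] onto [c] and the segment [ab] onto the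
    broken line [acb]; its support is a lens so thin that all the other edges
    are fixed. *)
Lemma delta_move a b c es : cross (b - a) (c - a) != 0 ->
  (forall s, s \in es -> clear a b c s) ->
  ambient_isotopic (segments ((a, b) :: es))
                   (segments [:: (a, c), (c, b) & es]).
Proof.
set e1 := b - a; set e2 := c - a; set n := cross e1 e2 => n0 cl.
have N0 := dot_self_gt0 n0; have N0' : dot n n != 0 by rewrite gt_eqF.
pose la P := dot (cross e2 n) (P - a) / dot n n.
pose mu P := dot (cross n e1) (P - a) / dot n n.
pose X P := 2 * la P + mu P - 1.
pose Z P := dot n (P - a) / dot n n.
have [d d0 hd] : exists2 d, 0 < d & forall s P, s \in es ->
    segment s.1 s.2 P -> lens d d (X P) (mu P) (Z P) <= 0.
  have : exists2 eta, 0 < eta & forall d s P, 0 < d <= eta -> s \in es ->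
      segment s.1 s.2 P -> lens d d (X P) (mu P) (Z P) <= 0.
    elim: es cl => [|s es IH] cl; first by exists 1.
    have [|eta eta0 he] := IH; first by move=> t tes; apply: cl; rewrite inE tes orbT.
    have [v [k [k1 k2 [va vb vab vc]]]] := cl s (mem_head _ _).
    have [|||eta' eta'0 he'] := @lens_small (k - (dot v a + dot v b) / 2)
        (- dot v e1 / 2) (- dot v e2 + dot v e1 / 2) (- dot v n).
    - by lra.
    - by rewrite ler_norml /e1 dotBr; apply/andP; split; lra.
    - by rewrite /e1 /e2 !dotBr; lra.
    exists (Num.min eta eta'); first by rewrite lt_min eta0.
    move=> d t P; rewrite le_min => /andP[d0 /andP[d1 d2]].
    rewrite inE => /predU1P[->|tes]; last by apply: he => //; rewrite d0.
    move=> [r]; rewrite /= in_itv/= => /andP[r0 r1] <-.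
    apply: he'; first by rewrite d0.
    set Q := s.1 + _.
    have vQ : k <= dot v Q by rewrite dotDr dotZr dotBr; nra.
    have : dot v (Q - a) = la Q * dot v e1 + mu Q * dot v e2 + Z Q * dot v n.
      apply: (mulIf N0'); rewrite cross_frame -/n /la /mu /Z.
      by field.
    rewrite dotBr /X => vE; move: vQ vE.
    have -> : dot v b = dot v a + dot v e1 by rewrite /e1 dotBr; ring.
    move=> vQ vE.
    rewrite [leLHS](_ : _ = k - dot v Q); first lra.
    rewrite -[dot v Q](subrK (dot v a)) vE; by field.
  by move=> [eta eta0 he]; exists eta => // s P; apply: he; rewrite eta0 lexx.
pose al P := 1 - `|X P| - `|Z P| / d + mu P / d.
pose be P := 1 - `|X P| - `|Z P| / d - mu P / (1 + d).
(* This vector carries the middle of [ab] to [c]. *)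
pose e := c - a - 2^-1 *: e1.
have d1 : 0 < 1 + d by rewrite addr_gt0.
have cdot v : continuous (fun P => dot v (P - a) / dot n n : R).
  move=> P; apply: cvgM; last exact: cvg_cst.
  rewrite dotBr; under eq_fun do rewrite dotBr.
  by apply: cvgB; [exact: continuous_dot|exact: cvg_cst].
have cX : continuous (X : space3 R -> R).
  move=> P; apply: cvgB; last exact: cvg_cst.
  by apply: cvgD; [apply: cvgM; [exact: cvg_cst|exact: cdot]|exact: cdot].
have cW : continuous (fun P => 1 - `|X P| - `|Z P| / d : R).
  move=> P; apply: cvgB; last first.
    by apply: cvgM; [apply: cvg_norm; exact: cdot|exact: cvg_cst].
  by apply: cvgB; [exact: cvg_cst|apply: cvg_norm; exact: cX].
have shift v P s : dot v (P + s *: e - a) = dot v (P - a) + s * dot v e.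
  by rewrite [_ + _ - a]addrAC [LHS]dotDr dotZr.
have mue P s : mu (P + s *: e) = mu P + s.
  rewrite /mu shift mulrDl; congr (_ + _).
  by rewrite /e dotBr dotZr (dot_cross_dual e1 e2).2 dot_crossr; field.
have lae P s : la (P + s *: e) = la P - s / 2.
  rewrite /la shift mulrDl; congr (_ + _).
  by rewrite /e dotBr dotZr (dot_cross_dual e1 e2).1 dot_crossl; field.
have Xe P s : X (P + s *: e) = X P by rewrite /X mue lae; field.
have Ze P s : Z (P + s *: e) = Z P.
  rewrite /Z shift [dot n e](_ : _ = 0) ?mulr0 ?addr0//.
  by rewrite /e dotBr dotZr dot_crossl dot_crossr mulr0 subr0.
have := @shear_isotopy R al be e d^-1 (1 + d)^-1 _ _ _ _ _ _
  (segments ((a, b) :: es)).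
set F := fun P => _.
have Fes P s : s \in es -> segment s.1 s.2 P -> F P = P.
  move=> ses sP; rewrite /F max_l ?scale0r ?addr0//.
  exact: hd ses sP.
have Fab t : 0 <= t <= 1 -> F (a + t *: (b - a)) =
    a + t *: (b - a) + (1 - `|2 * t - 1|) *: e.
  move=> t01; rewrite /F -/e1; congr (_ + _ *: _).
  have la1 : la (a + t *: e1) = t.
    by rewrite /la addrC addKr dotZr (dot_cross_dual e1 e2).1 mulfK.
  have mu1 : mu (a + t *: e1) = 0.
    by rewrite /mu addrC addKr dotZr dot_crossr mulr0 mul0r.
  have Z1 : Z (a + t *: e1) = 0.
    by rewrite /Z addrC addKr dotZr dot_crossl mulr0 mul0r.
  rewrite /al /be /X la1 mu1 Z1 normr0 !mul0r !subr0 !addr0 minxx max_r//.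
  by rewrite subr_ge0 ler_norml; lra.
suff -> : segments [:: (a, c), (c, b) & es] = F @` segments ((a, b) :: es).
  apply.
  - move=> P; apply: cvgD; first exact: cW.
    by apply: cvgM; [exact: cdot|exact: cvg_cst].
  - move=> P; apply: cvgB; first exact: cW.
    by apply: cvgM; [exact: cdot|exact: cvg_cst].
  - by move=> P s; rewrite /al Xe Ze mue; ring.
  - by move=> P s; rewrite /be Xe Ze mue; ring.
  - by rewrite invr_gt0.
  - by rewrite invr_gt0 d1/= invf_lt1// ltrDl.
apply/seteqP; split=> P.
- move=> [s]; rewrite !inE => /or3P[/eqP->|/eqP->|ses] sP; last first.
  + exists P; last exact: Fes ses sP.
    by exists s => //; rewrite inE ses orbT.
  + case: sP => t; rewrite /= in_itv/= => /andP[t0 t1] <-.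
    exists (a + ((1 + t) / 2) *: (b - a)).
      exists (a, b); first exact: mem_head.
      by exists ((1 + t) / 2) => //=; rewrite in_itv/=; apply/andP; split; lra.
    rewrite Fab; last by apply/andP; split; lra.
    rewrite ger0_norm; last by lra.
    by rewrite tent_right; congr (_ + _ *: _); field.
  + case: sP => t; rewrite /= in_itv/= => /andP[t0 t1] <-.
    exists (a + (t / 2) *: (b - a)).
      exists (a, b); first exact: mem_head.
      by exists (t / 2) => //=; rewrite in_itv/=; apply/andP; split; lra.
    rewrite Fab; last by apply/andP; split; lra.
    rewrite ler0_norm; last by lra.
    by rewrite opprK tent_left; congr (_ + _ *: _); field.
- move=> [Q [s]]; rewrite inE => /predU1P[->|ses] sQ <-; last first.
    by rewrite (Fes _ _ ses sQ); exists s => //; rewrite !inE ses !orbT.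
  case: sQ => t; rewrite /= in_itv/= => /andP[t0 t1] <-.
  rewrite Fab ?t0//; have [t2|t2] := leP (2 * t) 1.
  + exists (a, c); first by rewrite !inE eqxx.
    exists (2 * t) => /=; first by rewrite in_itv/=; apply/andP; split; lra.
    rewrite ler0_norm; last by lra.
    by rewrite opprK tent_left.
  + exists (c, b); first by rewrite !inE eqxx orbT.
    exists (2 * t - 1) => /=; first by rewrite in_itv/=; apply/andP; split; lra.
    rewrite ger0_norm; last by lra.
    by rewrite tent_right.
Qed.

End Triangle.

(** * Triangle moves on lattice polygons *)

Definition vec : Type := (Z * Z * Z)%type.

Definition vsub (u v : vec) : vec :=
  (u.1.1 - v.1.1, u.1.2 - v.1.2, u.2 - v.2)%BZ.
Definition vdot (u v : vec) : Z :=
  (u.1.1 * v.1.1 + u.1.2 * v.1.2 + u.2 * v.2)%BZ.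
Definition vcross (u v : vec) : vec :=
  (u.1.2 * v.2 - u.2 * v.1.2, u.2 * v.1.1 - u.1.1 * v.2,
   u.1.1 * v.1.2 - u.1.2 * v.1.1)%BZ.

(** Separation of the values of a linear form at the vertices of the triangle
    from its values at the ends of a segment. The tests are written with [if]
    and not with the Boolean connectives to stop at the first success, whatever
    the evaluation strategy. *)
Definition apart (x y z s t : Z) : bool :=
  if Z.ltb (Z.max x (Z.max y z)) (Z.min s t) then true
  else Z.ltb (Z.max s t) (Z.min x (Z.min y z)).

Definition apart_along (v a b c p q : vec) : bool :=
  apart (vdot v a) (vdot v b) (vdot v c) (vdot v p) (vdot v q).

(** A triangle and a segment that are disjoint are separated by the normal [n] of
    the triangle or by a vector orthogonal to the segment and to one of the
    sides, when they are not coplanar; the three coordinate axes come first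
    because they are cheap and succeed most of the time. *)
Definition apart_seg (a b c n p q : vec) : bool :=
  if apart a.1.1 b.1.1 c.1.1 p.1.1 q.1.1 then true else
  if apart a.1.2 b.1.2 c.1.2 p.1.2 q.1.2 then true else
  if apart a.2 b.2 c.2 p.2 q.2 then true else
  if apart_along n a b c p q then true else
  let d := vsub q p in
  if apart_along (vcross d (vsub b a)) a b c p q then true else
  if apart_along (vcross d (vsub c a)) a b c p q then true else
  apart_along (vcross d (vsub c b)) a b c p q.

(** The edge from [q] to [a] shares the vertex [a] with the triangle. It is
    harmless when it is not in the plane of the triangle; otherwise the sum of
    the vectors dual to the sides [e1] and [e2], a linear form positive on both,
    has to be nonpositive at [q - a]. *)
Definition leaves (n a b c q : vec) : bool :=
  let w := vsub q a in
  if Z.eqb (vdot n w) 0%BZ then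
    let e1 := vsub b a in let e2 := vsub c a in
    Z.leb (vdot (vcross e2 n) w + vdot (vcross n e1) w)%BZ 0%BZ
  else true.

Fixpoint apart_path (a b c n p : vec) (l : seq vec) : bool :=
  if l is q :: l' then
    if apart_seg a b c n p q then apart_path a b c n q l' else false
  else true.

Definition free_triangle (a b c : vec) (l : seq vec) : bool :=
  if l is p :: l' then
    let n := vcross (vsub b a) (vsub c a) in
    if Z.eqb (vdot n n) 0%BZ then false else
    if leaves n a b c (last p l') then
      if leaves (vcross (vsub a b) (vsub c b)) b a c p then apart_path a b c n p l' else false
    else false
  else false.

(** The number is a rotation of the cyclic list of vertices, after which the
    move takes place at its head: insertion of a vertex, removal of a vertex, or
    replacement of a vertex. A replacement is an insertion followed by a
    removal, the new vertex being inserted to the right or to the left of the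
    old one. *)
Inductive move :=
  Ins of nat & vec | Del of nat | MovR of nat & vec | MovL of nat & vec.
Arguments Ins k%_N c%_BZ.
Arguments Del k%_N.
Arguments MovR k%_N c%_BZ.
Arguments MovL k%_N c%_BZ.

Definition step (m : move) (p : seq vec) : option (seq vec) :=
  match m with
  | Ins k c =>
    if rot k p is a :: b :: l then
      if free_triangle a b c l then Some [:: a, c, b & l] else None
    else None
  | Del k =>
    if rot k p is a :: c :: b :: l then
      if free_triangle a b c l then Some [:: a, b & l] else None
    else None
  | MovR k c =>
    if rot k p is a :: v :: b :: l then
      if free_triangle v b c (rcons l a) then
        if free_triangle a c v (b :: l) then Some [:: a, c, b & l] else None
      else None
    else None
  | MovL k c =>
    if rot k p is a :: v :: b :: l then
      if free_triangle a v c (b :: l) then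
        if free_triangle c b v (rcons l a) then Some [:: a, c, b & l] else None
      else None
    else None
  end.

Fixpoint run (ms : seq move) (p : seq vec) : option (seq vec) :=
  if ms is m :: ms' then
    if step m p is Some q then run ms' q else None
  else Some p.

Section Lattice.
Variable R : realType.

Definition real_of_Z (x : Z) : R := (int_of_Z x)%:~R.

Lemma real_of_ZD x y : real_of_Z (x + y)%BZ = real_of_Z x + real_of_Z y.
Proof. by rewrite /real_of_Z -intrD -rmorphD. Qed.

Lemma real_of_ZN x : real_of_Z (- x)%BZ = - real_of_Z x.
Proof. by rewrite /real_of_Z -mulrNz -rmorphN. Qed.

Lemma real_of_ZM x y : real_of_Z (x * y)%BZ = real_of_Z x * real_of_Z y.
Proof. by rewrite /real_of_Z -intrM -rmorphM. Qed.

Lemma real_of_ZB x y : real_of_Z (x - y)%BZ = real_of_Z x - real_of_Z y.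
Proof. by rewrite -real_of_ZN -real_of_ZD. Qed.

Lemma real_of_Z_le x y : (real_of_Z x <= real_of_Z y) = Z.leb x y.
Proof.
rewrite -subr_ge0 -real_of_ZB /real_of_Z ler0z.
have -> : Z.leb x y = Z.leb 0%BZ (y - x)%BZ by apply/idP/idP; lia.
by case: (y - x)%BZ.
Qed.

Lemma real_of_Z_lt x y : (real_of_Z x < real_of_Z y) = Z.ltb x y.
Proof. by rewrite ltNge real_of_Z_le Z.ltb_antisym. Qed.

Lemma real_of_Z_eq0 x : (real_of_Z x == 0) = Z.eqb x 0%BZ.
Proof.
by rewrite eq_le -[0]/(real_of_Z 0%BZ) !real_of_Z_le; apply/idP/idP; lia.
Qed.

Definition real_vec (v : vec) : space3 R :=
  (real_of_Z v.1.1, real_of_Z v.1.2, real_of_Z v.2).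

(** Coordinates are integers in units of a tenth. *)
Definition vertex (v : vec) : space3 R := (10%:R^-1 : R) *: real_vec v.

Lemma real_vecB u v : real_vec (vsub u v) = real_vec u - real_vec v.
Proof. by rewrite /real_vec/= !real_of_ZB. Qed.

Lemma dot_real_vec u v : dot (real_vec u) (real_vec v) = real_of_Z (vdot u v).
Proof. by rewrite /dot/= -!real_of_ZM -!real_of_ZD. Qed.

Lemma cross_real_vec u v : cross (real_vec u) (real_vec v) = real_vec (vcross u v).
Proof. by rewrite /cross/= -!real_of_ZM -!real_of_ZB. Qed.

Lemma dot_vertex u v : dot (real_vec u) (vertex v) = 10%:R^-1 * real_of_Z (vdot u v).
Proof. by rewrite /vertex dotZr dot_real_vec. Qed.

Lemma vertexB u v : vertex u - vertex v = 10%:R^-1 *: real_vec (vsub u v).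
Proof. by rewrite /vertex -scalerBr real_vecB. Qed.

Lemma inv10_gt0 : 0 < (10%:R : R)^-1. Proof. by rewrite invr_gt0 ltr0n. Qed.

Lemma clear_swap (a b c p q : space3 R) : clear a b c (p, q) -> clear b a c (q, p).
Proof.
by move=> [v [k [h1 h2 [h3 h4 h5 h6]]]]; exists v, k; do !split => //; rewrite addrC.
Qed.

Lemma apart_clear v a b c p q : apart_along v a b c p q ->
  clear (vertex a) (vertex b) (vertex c) (vertex p, vertex q).
Proof.
rewrite /apart_along /apart; have e0 := inv10_gt0.
case: ifP => [|_]; rewrite -real_of_Z_lt => hlt.
- exists (real_vec v), (10%:R^-1 * real_of_Z (Z.min (vdot v p) (vdot v q))).
  rewrite /= !dot_vertex -mulrDr -[in X in _ < X]mulrDr !ler_pM2l// !ltr_pM2l// !real_of_Z_le.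
  by rewrite -!real_of_ZD !real_of_Z_lt; move: hlt; rewrite real_of_Z_lt; split; [lia..|split; lia].
- exists (- real_vec v), (- (10%:R^-1 * real_of_Z (Z.max (vdot v p) (vdot v q)))).
  rewrite /= !dotNl !dot_vertex -!opprD -mulrDr -[in X in _ < X]mulrDr.
  rewrite !lerN2 !ltrN2 !ler_pM2l// !ltr_pM2l// !real_of_Z_le.
  by rewrite -!real_of_ZD !real_of_Z_lt; move: hlt; rewrite real_of_Z_lt; split; [lia..|split; lia].
Qed.

Lemma apart_seg_clear a b c n p q : apart_seg a b c n p q ->
  clear (vertex a) (vertex b) (vertex c) (vertex p, vertex q).
Proof.
have ax (v : vec) f : (forall x, vdot v x = f x) ->
    apart (f a) (f b) (f c) (f p) (f q) ->
    clear (vertex a) (vertex b) (vertex c) (vertex p, vertex q).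
  by move=> vE h; apply: (@apart_clear v); rewrite /apart_along !vE.
rewrite /apart_seg.
case: ifP => [/(ax (1, 0, 0)%BZ (fun x => x.1.1)) + _|_].
  by apply=> -[[x y] z]; rewrite /vdot; cbn [fst snd]; lia.
case: ifP => [/(ax (0, 1, 0)%BZ (fun x => x.1.2)) + _|_].
  by apply=> -[[x y] z]; rewrite /vdot; cbn [fst snd]; lia.
case: ifP => [/(ax (0, 0, 1)%BZ (fun x => x.2)) + _|_].
  by apply=> -[[x y] z]; rewrite /vdot; cbn [fst snd]; lia.
case: ifP => [/apart_clear//|_]; case: ifP => [/apart_clear//|_].
by case: ifP => [/apart_clear//|_] /apart_clear.
Qed.

(** The certificate is minus the sum of the dual vectors, which is negative on
    both sides of the triangle at [a], corrected by a multiple of the normal when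
    the edge leaves the plane: the multiple does not change the values on the
    triangle and makes the value on the edge zero. *)
Lemma leaves_clear a b c q (n := vcross (vsub b a) (vsub c a)) :
  Z.eqb (vdot n n) 0%BZ = false -> leaves n a b c q ->
  clear (vertex a) (vertex b) (vertex c) (vertex q, vertex a).
Proof.
move=> n0; rewrite /leaves.
set w := vsub q a; set e1 := vsub b a; set e2 := vsub c a.
have e0 := inv10_gt0.
pose u := - (cross (real_vec e2) (real_vec n) + cross (real_vec n) (real_vec e1)).
have N0 : 0 < dot (real_vec n) (real_vec n).
  apply: dot_self_gt0; apply/eqP => nv0; move: n0.
  have : dot (real_vec n) (real_vec n) = 0 by rewrite nv0 /dot/= !mul0r !addr0.
  by rewrite dot_real_vec => /eqP; rewrite real_of_Z_eq0 => ->.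
have nE : real_vec n = cross (real_vec e1) (real_vec e2) by rewrite cross_real_vec.
have ue1 : dot u (real_vec e1) = - dot (real_vec n) (real_vec n).
  by rewrite /u dotNl dotDl nE (dot_cross_dual _ _).1 dot_crossr addr0.
have ue2 : dot u (real_vec e2) = - dot (real_vec n) (real_vec n).
  by rewrite /u dotNl dotDl nE (dot_cross_dual _ _).2 dot_crossl add0r.
have ne1 : dot (real_vec n) (real_vec e1) = 0 by rewrite nE dot_crossl.
have ne2 : dot (real_vec n) (real_vec e2) = 0 by rewrite nE dot_crossr.
move=> h.
have [l hl] : exists l : R, 0 <= dot (u + l *: real_vec n) (real_vec w).
  move: h; case: ifP => [_ h|nw _].
    exists 0; rewrite scale0r addr0 /u dotNl dotDl !cross_real_vec !dot_real_vec.
    by rewrite -real_of_ZD oppr_ge0 -[X in _ <= X]/(real_of_Z 0%BZ) real_of_Z_le.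
  exists (- dot u (real_vec w) / dot (real_vec n) (real_vec w)).
  rewrite dotDl dotZl mulfVK ?subrr// dot_real_vec real_of_Z_eq0.
  by rewrite nw.
have vd x y : dot (u + l *: real_vec n) (vertex x) =
    dot (u + l *: real_vec n) (vertex y) +
    10%:R^-1 * dot (u + l *: real_vec n) (real_vec (vsub x y)).
  by rewrite -dotZr -vertexB dotBr subrKC.
exists (u + l *: real_vec n), (dot (u + l *: real_vec n) (vertex a)).
rewrite /= (vd q a) (vd b a) (vd c a) -/w -/e1 -/e2.
have v1 : dot (u + l *: real_vec n) (real_vec e1) < 0.
  by rewrite dotDl dotZl ne1 mulr0 addr0 ue1 oppr_lt0.
have v2 : dot (u + l *: real_vec n) (real_vec e2) < 0.
  by rewrite dotDl dotZl ne2 mulr0 addr0 ue2 oppr_lt0.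
have w1 : 10%:R^-1 * dot (u + l *: real_vec n) (real_vec e1) < 0.
  by rewrite pmulr_rlt0.
have w2 : 10%:R^-1 * dot (u + l *: real_vec n) (real_vec e2) < 0.
  by rewrite pmulr_rlt0.
have w3 : 0 <= 10%:R^-1 * dot (u + l *: real_vec n) (real_vec w).
  by rewrite pmulr_rge0.
by move: w1 w2 w3; move: (10%:R^-1 * _) (10%:R^-1 * _) (10%:R^-1 * _) (dot _ (vertex a));
  move=> x y z k *; do !split; lra.
Qed.

Definition loop (p : seq vec) : set (space3 R) :=
  segments (zip (map vertex p) (rot 1 (map vertex p))).

Lemma zip_rot (T : Type) k (s t : seq T) : size s = size t ->
  zip (rot k s) (rot k t) = rot k (zip s t).
Proof.
move=> st; rewrite /rot zip_cat ?size_drop ?st//.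
congr (_ ++ _); first by elim: k s t st => [|k IH] [|x s] [|y t]//= [/IH].
by elim: k s t st => [|k IH] [|x s] [|y t]//= [/IH->].
Qed.

Lemma loop_rot k p : loop (rot k p) = loop p.
Proof.
by rewrite /loop map_rot rot_rot zip_rot ?size_rot//; apply/segments_eq/mem_rot.
Qed.

Lemma loop_rot1 a l : loop (a :: l) = loop (rcons l a).
Proof. by rewrite -(loop_rot 1) rot1_cons. Qed.

Lemma loop_cons a l : loop (a :: l) =
  segments (zip (map vertex (a :: l)) (rcons (map vertex l) (vertex a))).
Proof. by rewrite /loop /rot /= take0 drop0 cats1. Qed.

Lemma apart_path_clear a b c n p l : apart_path a b c n p l ->
  forall s, s \in zip (map vertex (p :: l)) (map vertex l) ->
  clear (vertex a) (vertex b) (vertex c) s.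
Proof.
elim: l p => [//|q l IH] p /=; case: ifP => // h hl s.
rewrite inE => /predU1P[->|]; first exact: apart_seg_clear h.
exact: IH.
Qed.

Lemma zip_rcons_last (T : Type) (x y : T) (l : seq T) :
  zip (x :: l) (rcons l y) = rcons (zip (x :: l) l) (last x l, y).
Proof. by elim: l x => [|z l IH] x//=; rewrite IH. Qed.

Lemma dot_crossZ (k : R) (u v w : space3 R) :
  dot (cross (k *: u) (k *: v)) w = k ^+ 2 * dot (cross u v) w.
Proof. by rewrite /dot /cross/= /GRing.scale/= /GRing.scale/=; ring. Qed.

Lemma vdot_cross_opp (a b c : vec) :
  vdot (vcross (vsub a b) (vsub c b)) (vcross (vsub a b) (vsub c b)) =
  vdot (vcross (vsub b a) (vsub c a)) (vcross (vsub b a) (vsub c a)).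
Proof. by rewrite /vdot /vcross /vsub/=; lia. Qed.

(** The three kinds of remaining edges, the two neighbours of [ab] and the others,
    have certificates by [leaves_clear] and [apart_path_clear]. *)
Lemma free_triangle_isotopy a b c l : free_triangle a b c l ->
  ambient_isotopic (loop [:: a, b & l]) (loop [:: a, c, b & l]).
Proof.
case: l => [//|p l] /=; case: ifP => // n0; case: ifP => // ha.
case: ifP => // hb hl.
rewrite !loop_cons /=; apply: delta_move.
  apply/eqP => h; move: n0.
  rewrite -real_of_Z_eq0 -dot_real_vec -[X in dot X _]cross_real_vec.
  rewrite -(mulrI_eq0 _ (mulfI (lt0r_neq0 (exprn_gt0 2 inv10_gt0)))).
  by rewrite -dot_crossZ -!vertexB h /dot/= !mul0r !addr0 eqxx.
have lE : zip (vertex p :: map vertex l) (rcons (map vertex l) (vertex a)) =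
    rcons (zip (vertex p :: map vertex l) (map vertex l)) (vertex (last p l), vertex a).
  by rewrite zip_rcons_last last_map.
move=> s; rewrite lE inE mem_rcons inE => /or3P[/eqP->|/eqP->|].
- by apply/clear_swap/leaves_clear; last exact: hb; rewrite vdot_cross_opp n0.
- by apply: leaves_clear ha; rewrite n0.
- exact: apart_path_clear hl s.
Qed.

Lemma step_isotopy m p q : step m p = Some q ->
  ambient_isotopic (loop p) (loop q).
Proof.
case: m => [k c|k|k c|k c]; rewrite -(loop_rot k p) /step.
- case: (rot k p) => [//|a [//|b l]]; case: ifP => // h [<-].
  exact: free_triangle_isotopy.
- case: (rot k p) => [//|a [//|c [//|b l]]]; case: ifP => // h [<-].
  exact/ambient_isotopic_sym/free_triangle_isotopy.
- case: (rot k p) => [//|a [//|v [//|b l]]]; case: ifP => // h1.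
  case: ifP => // h2 [<-].
  apply: (ambient_isotopic_trans _
    (ambient_isotopic_sym (free_triangle_isotopy h2))).
  by rewrite loop_rot1 [X in ambient_isotopic _ X]loop_rot1;
    exact: free_triangle_isotopy h1.
- case: (rot k p) => [//|a [//|v [//|b l]]]; case: ifP => // h1.
  case: ifP => // h2 [<-].
  apply: (ambient_isotopic_trans (free_triangle_isotopy h1)).
  apply: ambient_isotopic_sym.
  by rewrite loop_rot1 [X in ambient_isotopic _ X]loop_rot1;
    exact: free_triangle_isotopy h2.
Qed.

Lemma run_isotopy ms p q : run ms p = Some q ->
  ambient_isotopic (loop p) (loop q).
Proof.
elim: ms p => [p [->]|m ms IH p /=]; first exact: ambient_isotopic_refl.
case E: (step m p) => [r|//] /IH; apply: ambient_isotopic_trans.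
exact: step_isotopy E.
Qed.

Lemma polygon_loop p : (0 < size p)%N -> polygon (map vertex p) = loop p.
Proof. by move=> p0; rewrite polygon_segments ?size_map. Qed.

End Lattice.

(** * Local systems and homotopies *)

Section Interval.
Variable R : realType.

(** The points of the interval where [P] holds form a relatively open and
    relatively closed set. *)
Lemma interval_induction (P : R -> Prop) : P 1 ->
  (forall t0 : R, t0 \in `[0, 1] -> \forall t \near t0, t \in `[0, 1] ->
     (P t <-> P t0)) ->
  forall t : R, t \in `[0, 1] -> P t.
Proof.
move=> P1 loc; pose A : set R := `[0, 1]%classic; pose B := [set t | A t /\ P t].
suff BA : B = A by move=> t t01; have : A t by []; rewrite -BA => -[].
apply: (@segment_connected R 0 1).
- by exists 1; split => //; rewrite /A/= in_itv/= ler01 lexx.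
- exists (interior [set t | A t -> P t]); first exact: open_interior.
  apply/seteqP; split=> [t [At Pt]|t [At /interior_subset]]; last first.
    by move=> /(_ At).
  split=> //; rewrite /interior/=.
  by apply: filterS (loc t At) => u h Au; apply/h.
- exists (~` interior [set t | A t -> ~ P t]).
    by apply: open_closedC; exact: open_interior.
  apply/seteqP; split=> [t [At Pt]|t [At nt]].
    by split=> // /interior_subset/= /(_ At).
  split=> //; apply: contrapT => nPt; apply: nt; rewrite /interior/=.
  by apply: filterS (loc t At) => u h Au /(h Au).
Qed.

Lemma locally_constant_interval (S : Type) (f : R -> S) :
  (forall t : R, t \in `[0, 1] -> \forall u \near t, u \in `[0, 1] -> f u = f t) ->
  forall t : R, t \in `[0, 1] -> f t = f 1.
Proof.
move=> loc; apply: interval_induction => // t t01.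
by apply: filterS (loc t t01) => u h u01; rewrite h.
Qed.

End Interval.

Section Pairs.
Variables U V : topologicalType.

Lemma pair_cvg (S : Type) (F : set_system S) (f : S -> U) (g : S -> V) (a : U) (b : V) :
  Filter F -> f @ F --> a -> g @ F --> b ->
  (fun s => (f s, g s)) @ F --> (a, b).
Proof. by move=> FF; apply: cvg_pair. Qed.

Lemma near_fst (P : U -> Prop) (q : U * V) :
  (\forall x \near q.1, P x) -> \forall r \near q, P r.1.
Proof. exact: cvg_fst. Qed.

Lemma near_snd (P : V -> Prop) (q : U * V) :
  (\forall y \near q.2, P y) -> \forall r \near q, P r.2.
Proof. exact: cvg_snd. Qed.

End Pairs.

Section LocalSystem.
Variables (R : realType) (E : topologicalType) (G : finGroupType).

(** A locally trivial family of copies of [G]: the element [T x y] transports the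
    fibre at [y] to the fibre at [x]. It is meaningful only for [y] close to
    [x], and the cocycle identity is required only for [y] close to [x] and [z]
    close to [y]. *)
Definition local_system (X : set E) (T : E -> E -> G) : Prop :=
  forall x, X x ->
  \forall y \near x, \forall z \near y, T x z = (T x y * T y z)%g.

Variables (X : set E) (T : E -> E -> G).
Hypothesis locT : local_system X T.

(** Near [x] the system is trivialized by transporting everything to [x]. *)
Lemma local_frame x : X x ->
  \forall y \near x, \forall z \near y, ((T x y)^-1 = T y z * (T x z)^-1)%g.
Proof.
move=> Xx; apply: filterS (locT Xx) => y; apply: filterS => z ->.
by rewrite invMg mulgA mulgV mul1g.
Qed.

Lemma local_system_refl x : X x -> T x x = 1%g.
Proof.
move=> /locT/nbhs_singleton/nbhs_singleton h.
by apply: (mulgI (T x x)); rewrite mulg1 -h.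
Qed.

Variables (A : set E) (c : E * R -> E) (s1 : E -> G).
Hypothesis cA : forall x t, A x -> t \in `[0, 1] -> X (c (x, t)).
Hypothesis cc : continuous c.
Hypothesis oA : open A.
Hypothesis flat1 : forall x, A x ->
  \forall y \near x, s1 x = (T (c (x, 1%R)) (c (y, 1%R)) * s1 y)%g.

(* A flat section over [N `*` [t, 1]] of the system pulled back along [c]. *)
Let flat_on (N : set E) (t : R) (s : E * R -> G) := forall y u, N y ->
  t <= u <= 1 -> \forall q \near (y, u), t <= q.2 <= 1 ->
  s (y, u) = (T (c (y, u)) (c q) * s q)%g.

Let extends (x : E) (t : R) := exists N s, [/\ nbhs x N, N `<=` A,
  forall y, N y -> s (y, 1) = s1 y & flat_on N t s].

(** Two flat sections differ by a locally constant element along each segment. *)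
Let extends_unique N (t : R) s s' y : 0 <= t <= 1 -> flat_on N t s -> flat_on N t s' ->
  N y -> N `<=` A -> s (y, 1) = s' (y, 1) -> s (y, t) = s' (y, t).
Proof.
move=> /andP[t0 t1] fs fs' Ny NA e1.
pose h (u : R) := t + u * (1 - t).
have h01 u : u \in `[0, 1] -> t <= h u <= 1.
  by rewrite in_itv/= /h => /andP[u0 u1]; apply/andP; split; nra.
have ch u : (fun v => (y, h v)) @ u --> (y, h u).
  apply: pair_cvg; first exact: cvg_cst.
  apply: cvgD; first exact: cvg_cst.
  by apply: cvgM; [exact: cvg_id|exact: cvg_cst].
have := @locally_constant_interval R G (fun u => (s (y, h u))^-1 * s' (y, h u))%g.
have h0 : h 0 = t by rewrite /h mul0r addr0.
have h1 : h 1 = 1 by rewrite /h mul1r addrC subrK.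
move=> /(_ _ 0); rewrite h0 h1 e1 mulVg in_itv/= lexx ler01 => H.
apply: (mulgI (s (y, t))^-1%g); rewrite mulVg H// => u u01.
have su := ch u _ (fs y (h u) Ny (h01 _ u01)).
have su' := ch u _ (fs' y (h u) Ny (h01 _ u01)).
near=> v => v01.
have -> : s (y, h u) = (T (c (y, h u)) (c (y, h v)) * s (y, h v))%g.
  have : t <= (y, h v).2 <= 1 by exact: h01.
  by near: v.
have -> : s' (y, h u) = (T (c (y, h u)) (c (y, h v)) * s' (y, h v))%g.
  have : t <= (y, h v).2 <= 1 by exact: h01.
  by near: v.
by rewrite invMg mulgA mulgKV.
Unshelve. all: by end_near. Qed.

(** Over a neighbourhood of [(x, t0)] the frame at [c (x, t0)] is flat, and it
    continues any section given at one time to nearby times. *)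
Let extends_step x (t0 : R) : A x -> t0 \in `[0, 1] ->
  \forall t \near t0, t \in `[0, 1] -> (extends x t <-> extends x t0).
Proof.
move=> Ax t01.
have Xq : X (c (x, t0)) by exact: cA.
pose phi q := ((T (c (x, t0)) (c q))^-1)%g.
have fr : \forall q \near (x, t0), \forall r \near q,
    phi q = (T (c q) (c r) * phi r)%g.
  have h : \forall q \near (x, t0), \forall z \near c q,
      ((T (c (x, t0)) (c q))^-1 = T (c q) z * (T (c (x, t0)) z)^-1)%g.
    exact: cc (local_frame Xq).
  by apply: filterS h => q hq; exact: (cc hq).
have [[N1 I1] /= [nN1 nI1] sNI] := fr.
suff ext (t u : R) : t \in `[0, 1] -> u \in `[0, 1] -> I1 t -> I1 u ->
    (forall v, Num.min t u <= v <= Num.max t u -> I1 v) ->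
    extends x t -> extends x u.
  have [e /= e0 be] := nI1.
  near=> t => tin.
  have It v : `|v - t0| < e -> I1 v by move=> h; apply: be; rewrite /= distrC.
  have tt : `|t - t0| < e by rewrite distrC; near: t; exists e.
  have Imm v : Num.min t t0 <= v <= Num.max t t0 -> I1 v.
    move=> /andP[v1 v2]; apply: It; move: tt v1 v2; rewrite !ltr_norml.
    by rewrite minEle maxEle; case: ifP => _ /andP[? ?] ? ?; apply/andP; split; lra.
  split; apply: ext => //.
  - exact: It.
  - by apply: It; rewrite subrr normr0.
  - by apply: It; rewrite subrr normr0.
  - exact: It.
  - by move=> v; rewrite minC maxC; exact: Imm.
rewrite !in_itv/= => /andP[t0' t1] /andP[u0 u1] It Iu Itu.
move=> [N [s [nN NA s1E fs]]].
have [tu|ut] := leP t u.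
  exists N, s; split=> // y v Ny /andP[uv v1].
  have tv : t <= v <= 1 by rewrite (le_trans tu uv).
  apply: filterS (fs y v Ny tv) => q h /andP[uq q1]; apply: h.
  by rewrite (le_trans tu uq).
exists (interior (N `&` N1)), (fun q => if t <= q.2 then s q else
   phi q * (phi (q.1, t))^-1 * s (q.1, t))%g; split.
- by apply: open_nbhs_nbhs; split; [exact: open_interior|exact: filterI].
- by move=> y /interior_subset[/NA].
- by move=> y /interior_subset[/s1E]; rewrite /= t1.
have st y : N y -> N1 y -> \forall q \near (y, t), t <= q.2 <= 1 ->
    s (y, t) = (T (c (y, t)) (c q) * s q)%g.
  by move=> Ny _; apply: fs; rewrite // lexx.
have pt y v : N1 y -> I1 v -> \forall q \near (y, v), 
    phi (y, v) = (T (c (y, v)) (c q) * phi q)%g.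
  by move=> N1y Iv; exact: (sNI (y, v)).
(* the constant comparing [s] with the frame is locally constant *)
have gt y : N y -> N1 y -> \forall z \near y,
    ((phi (y, t))^-1 * s (y, t) = (phi (z, t))^-1 * s (z, t))%g.
  move=> Ny N1y.
  have cz : (fun z => (z, t)) @ y --> (y, t).
    by apply: pair_cvg; [exact: cvg_id|exact: cvg_cst].
  have sz := cz _ (st y Ny N1y); have pz := cz _ (pt y t N1y It).
  near=> z.
  have -> : s (y, t) = (T (c (y, t)) (c (z, t)) * s (z, t))%g.
    have : t <= (z, t).2 <= 1 by rewrite /= lexx.
    by near: z.
  have -> : phi (y, t) = (T (c (y, t)) (c (z, t)) * phi (z, t))%g.
    by near: z.
  by rewrite invMg mulgA mulgKV.
move=> y v /[dup] yi /interior_subset[Ny N1y] /andP[uv v1] /=.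
have Nz : \forall q \near (y, v), interior (N `&` N1) q.1.
  by apply: near_fst; apply: open_nbhs_nbhs; split; [exact: open_interior|].
have [|vt] := ltP t v => [tv|].
  rewrite (ltW tv).
  have tv1 : t <= v <= 1 by rewrite ltW.
  have tq : \forall q \near (y, v), t < q.2.
    exact: (near_snd (P := fun w => t < w) (q := (y, v)) (lt_nbhsr tv)).
  have fq := fs y v Ny tv1.
  near=> q => /andP[uq q1].
  have tq2 : t < q.2 by near: q.
  rewrite (ltW tq2).
  have : t <= q.2 <= 1 by rewrite ltW.
  by near: q.
have Iv : I1 v by apply: Itu; rewrite (min_r (ltW ut)) (max_l (ltW ut)) uv.
have pq := pt y v N1y Iv.
have gq : \forall q \near (y, v),
    ((phi (y, t))^-1 * s (y, t) = (phi (q.1, t))^-1 * s (q.1, t))%g.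
  exact: (near_fst (q := (y, v)) (gt y Ny N1y)).
have [vEt|vlt] := eqVneq v t; last first.
  have {vlt}vt : v < t by rewrite lt_neqAle vlt.
  rewrite leNgt vt/=.
  have tq : \forall q \near (y, v), q.2 < t.
    exact: (near_snd (P := fun w => w < t) (q := (y, v)) (lt_nbhsl vt)).
  near=> q => _.
  have -> : (t <= q.2) = false by apply/negbTE; rewrite -ltNge; near: q.
  rewrite -!mulgA (near gq q)// [phi (y, v)](_ : _ = T (c (y, v)) (c q) * phi q)%g.
    by rewrite !mulgA.
  by near: q.
subst v; rewrite lexx; have sq := st y Ny N1y.
near=> q => /andP[uq q1].
case: ifP => [tq|_].
  have : t <= q.2 <= 1 by rewrite tq.
  by near: q.
rewrite -!mulgA -(near gq q)// mulgA -[X in (X * _)%g](_ : phi (y, t) = _).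
  by rewrite mulgA mulgV mul1g.
by near: q.
Unshelve. all: by end_near. Qed.

(** Homotopy invariance: a flat section at the end of a homotopy extends over the
    whole homotopy, hence gives one at its beginning. The extensions exist
    locally by [interval_induction] and agree by uniqueness, so the values at
    time [0] glue. *)
Lemma homotopy_section : exists s0 : E -> G, forall x, A x ->
  \forall y \near x, s0 x = (T (c (x, 0%R)) (c (y, 0%R)) * s0 y)%g.
Proof.
have ext x : A x -> extends x 0.
  move=> Ax; apply: (interval_induction (P := extends x)) => [|t0 t01|].
  - exists A, (fun q => s1 q.1); split => //; first exact: open_nbhs_nbhs.
    move=> y u Ay u1; have -> : u = 1 by apply/eqP; rewrite eq_le andbC.
    near=> q => q1; have q2 : q.2 = 1 by apply/eqP; rewrite eq_le andbC.
    rewrite [q]surjective_pairing q2 /=; near: q.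
    exact: (near_fst (q := (y, 1 : R)) (flat1 Ay)).
  - exact: extends_step.
  - by rewrite in_itv/= lexx ler01.
pose P (x : E) (Ns : set E * (E * R -> G)) := [/\ nbhs x Ns.1, Ns.1 `<=` A,
  forall y, Ns.1 y -> Ns.2 (y, 1) = s1 y & flat_on Ns.1 0 Ns.2].
have /choice[f fP] : forall x, exists Ns, A x -> P x Ns.
  move=> x; have [Ax|nAx] := pselect (A x); last by exists (set0, (fun=> 1%g)).
  by have [N [s h]] := ext x Ax; exists (N, s).
exists (fun x => (f x).2 (x, 0)) => x Ax.
have [nN NA sE fs] := fP x Ax.
have cz : (fun z => (z, 0 : R)) @ x --> (x, 0 : R).
  by apply: pair_cvg; [exact: cvg_id|exact: cvg_cst].
have fz : \forall z \near x, 0 <= (0 : R) <= 1 ->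
    (f x).2 (x, 0) = (T (c (x, 0)) (c (z, 0)) * (f x).2 (z, 0%R))%g.
  have h0 : 0 <= (0 : R) <= 1 by apply/andP; split; [exact: lexx|exact: ler01].
  exact: cz _ (fs x 0 (nbhs_singleton nN) h0).
near=> y.
have Ny : (f x).1 y by near: y.
have Ay := NA _ Ny.
have [nN' NA' sE' fs'] := fP y Ay.
have -> : (f y).2 (y, 0) = (f x).2 (y, 0).
  apply: (@extends_unique ((f x).1 `&` (f y).1)) => //.
  - by rewrite lexx ler01.
  - by move=> z u [_ Nz]; exact: fs'.
  - by move=> z u [Nz _]; exact: fs.
  - by split=> //; exact: nbhs_singleton.
  - by move=> z [/NA].
  - by rewrite sE// sE'//; exact: nbhs_singleton.
have : 0 <= (0 : R) <= 1 by apply/andP; split; [exact: lexx|exact: ler01].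
by near: y.
Unshelve. all: by end_near. Qed.

End LocalSystem.

(** * The complement of a simple closed plane polygon *)

Section Planar.
Variables (R : realType) (n : nat) (v : nat -> plane R).
Hypothesis n1 : (1 < n)%N.

Definition side i : plane R := v (i.+1 %% n)%N - v i.
Definition side_point i (t : R) : plane R := v i + t *: side i.
Definition outline : set (plane R) :=
  [set x | exists i t, [/\ (i < n)%N, t \in `[0, 1] & x = side_point i t]].

Hypothesis simple : forall i j s t, (i < n)%N -> (j < n)%N ->
  0 <= s < 1 -> 0 <= t < 1 -> side_point i s = side_point j t -> i = j /\ s = t.

Variables (S : Type) (f : plane R -> S).
Hypothesis locf : forall x, ~ outline x -> \forall y \near x, f y = f x.

Lemma cvg_line (x y : plane R) (t : R) :
  (fun s : R => x + s *: y) @ t --> x + t *: y.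
Proof.
by apply: (@cvgD _ (plane R) _ _ _ (fun=> x) (fun s => s *: y));
  [exact: cvg_cst|apply: (@cvgZr_tmp R (plane R)); exact: cvg_id].
Qed.

Lemma locally_constant_convex (U : set (plane R)) : U `<=` ~` outline ->
  (forall x y t, U x -> U y -> t \in `[0, 1] -> U (x + t *: (y - x))) ->
  forall x y, U x -> U y -> f x = f y.
Proof.
move=> UL cU x y Ux Uy.
have := @locally_constant_interval R S (fun t => f (x + t *: (y - x))).
move=> /(_ _ 0); rewrite scale0r addr0 scale1r subrKC; apply; last first.
  by rewrite in_itv/= lexx ler01.
move=> t t01; have /UL/locf h := cU _ _ _ Ux Uy t01.
have {}h : \forall u \near t, f (x + u *: (y - x)) = f (x + t *: (y - x)).
  exact: cvg_line h.
by apply: filterS h => u.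
Qed.

Lemma det2Zr (x y : plane R) (t : R) : det2 x (t *: y) = t * det2 x y.
Proof. by rewrite /det2/= /GRing.scale/=; ring. Qed.

Lemma det2xx (x : plane R) : det2 x x = 0.
Proof. by rewrite /det2; ring. Qed.

Lemma det2C (x y : plane R) : det2 x y = - det2 y x.
Proof. by rewrite /det2; ring. Qed.

Lemma det2_frame (x y z : plane R) :
  det2 x y *: z = det2 z y *: x + det2 x z *: y.
Proof.
by move: x y z => [? ?] [? ?] [? ?]; congr (_, _);
  rewrite /det2/= /GRing.scale/=; ring.
Qed.

(** Near [x] the complement of the outline is covered by two pieces on which [f]
    is constant, and both pieces are adherent to every point of the outline
    near [x]. The pieces may overlap: the purpose is to bound the number of
    values of [f] from above. *)
Definition two_sided (x : plane R) : Prop := exists U1 U2 : set (plane R),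
  [/\ \forall y \near x, ~ outline y -> U1 y \/ U2 y,
      forall y z, U1 y -> U1 z -> f y = f z,
      forall y z, U2 y -> U2 z -> f y = f z
    & \forall y \near x, outline y ->
        (forall W, nbhs y W -> exists2 z, W z & U1 z /\ ~ outline z) /\
        (forall W, nbhs y W -> exists2 z, W z & U2 z /\ ~ outline z)].

Section Corner.
Variables (q e1 e2 : plane R).
Hypothesis e12 : det2 e1 e2 != 0.

Definition abscissa y := det2 (y - q) e2 / det2 e1 e2.
Definition ordinate y := det2 e1 (y - q) / det2 e1 e2.

Lemma coordinatesE y : y = q + (abscissa y *: e1 + ordinate y *: e2).
Proof.
apply/eqP; rewrite -subr_eq0 opprD addrA subr_eq0; apply/eqP.
have h := det2_frame e1 e2 (y - q).
by rewrite -[LHS](scalerK e12) h scalerDr !scalerA ![_^-1 * _]mulrC.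
Qed.

Lemma abscissa_affine x y t :
  abscissa (x + t *: (y - x)) = (1 - t) * abscissa x + t * abscissa y.
Proof.
by rewrite /abscissa !mulrA -mulrDl; congr (_ / _);
  rewrite /det2/= /GRing.scale/=; ring.
Qed.

Lemma ordinate_affine x y t :
  ordinate (x + t *: (y - x)) = (1 - t) * ordinate x + t * ordinate y.
Proof.
by rewrite /ordinate !mulrA -mulrDl; congr (_ / _);
  rewrite /det2/= /GRing.scale/=; ring.
Qed.

Lemma abscissaD x s t : abscissa (x + (s *: e1 + t *: e2)) = abscissa x + s.
Proof.
rewrite /abscissa -{2}[s](mulfK e12) -mulrDl; congr (_ / _).
by rewrite /det2/= /GRing.scale/=; ring.
Qed.

Lemma ordinateD x s t : ordinate (x + (s *: e1 + t *: e2)) = ordinate x + t.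
Proof.
rewrite /ordinate -{2}[t](mulfK e12) -mulrDl; congr (_ / _).
by rewrite /det2/= /GRing.scale/=; ring.
Qed.

Lemma convex_gt0 (a b t : R) : t \in `[0, 1] -> 0 < a -> 0 < b ->
  0 < (1 - t) * a + t * b.
Proof. by rewrite in_itv/= => /andP[? ?] ? ?; nra. Qed.

Lemma ball_convex r (x y : plane R) t : ball q r x -> ball q r y ->
  t \in `[0, 1] -> ball q r (x + t *: (y - x)).
Proof.
move=> [x1 x2] [y1 y2] t01.
have H (a b c : R) : ball a r b -> ball a r c -> ball a r (b + t * (c - b)).
  rewrite /ball/= !ltr_norml => /andP[? ?] /andP[? ?].
  have h1 : 0 < (1 - t) * (r - (a - b)) + t * (r - (a - c)).
    by apply: convex_gt0 => //; lra.
  have h2 : 0 < (1 - t) * (r + (a - b)) + t * (r + (a - c)).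
    by apply: convex_gt0 => //; lra.
  by apply/andP; split; lra.
by split; exact: H.
Qed.

Lemma near0_pos (P : R -> Prop) : (\forall t \near 0, P t) ->
  exists2 t, 0 < t & P t.
Proof.
move=> [d /= d0 h]; exists (d / 2); first by rewrite divr_gt0.
by apply: h; rewrite /= sub0r normrN gtr0_norm ?divr_gt0//; lra.
Qed.

Lemma adherent_along r (U : set (plane R)) (y e : plane R) :
  U `<=` ~` outline -> ball q r y ->
  (forall t, 0 < t -> ball q r (y + t *: e) -> U (y + t *: e)) ->
  forall W, nbhs y W -> exists2 z, W z & U z /\ ~ outline z.
Proof.
move=> UL By hU W nW.
have := @cvg_line y e 0; rewrite scale0r addr0 => cl.
have nB : nbhs y (ball q r).
  have r0 : 0 < r by apply: le_lt_trans By.1.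
  by apply: open_nbhs_nbhs; split=> //; exact: ball_open.
have /near0_pos[t t0 [Wt Bt]] : \forall t \near 0,
    W (y + t *: e) /\ ball q r (y + t *: e).
  by apply: filterI; exact: cl.
have Ut := hU t t0 Bt.
by exists (y + t *: e) => //; split=> //; exact: UL.
Qed.

(** The two pieces are half discs, which are convex. *)
Lemma two_sided_line :
  (\forall y \near q, outline y <-> ordinate y = 0) -> two_sided q.
Proof.
move=> /nbhs_ballP[r /= r0 hr].
pose U (s : R) := [set y | ball q r y /\ 0 < s * ordinate y].
have UL s : U s `<=` ~` outline.
  by move=> y [By p] /(hr _ By) h; move: p; rewrite h mulr0 ltxx.
have UC s x y t : U s x -> U s y -> t \in `[0, 1] -> U s (x + t *: (y - x)).
  move=> [Bx px] [By py] t01; split; first exact: ball_convex.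
  have := convex_gt0 t01 px py; rewrite ordinate_affine; lra.
have nB : nbhs q (ball q r) by exact: nbhsx_ballx.
exists (U 1), (U (-1)); split.
- near=> y => Ly; have By : ball q r y by near: y.
  have [h|h|h] := ltgtP (ordinate y) 0.
  + by right; split=> //; rewrite mulN1r oppr_gt0.
  + by left; split=> //; rewrite mul1r.
  + by case: Ly; apply/(hr _ By).
- exact: locally_constant_convex (@UL 1) (@UC 1).
- exact: locally_constant_convex (@UL (-1)) (@UC (-1)).
- near=> y => Ly; have By : ball q r y by near: y.
  have o0 : ordinate y = 0 by exact/(hr _ By).
  split.
  + apply: (adherent_along (e := 0 *: e1 + 1 *: e2) (@UL 1) By) => t t0 Bt.
    by split=> //; rewrite scalerDr !scalerA ordinateD o0 mulr1 mul1r add0r.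
  + apply: (adherent_along (e := 0 *: e1 + (-1) *: e2) (@UL (-1)) By) => t t0 Bt.
    by split=> //; rewrite scalerDr !scalerA ordinateD o0 mulrN1 mulN1r add0r opprK.
Unshelve. all: by end_near. Qed.

(** One piece is the convex sector between the sides. The other one is the union
    of two half discs that overlap, so [f] is constant on it too. *)
Lemma two_sided_corner :
  (\forall y \near q, outline y <->
     (ordinate y = 0 /\ 0 <= abscissa y) \/
     (abscissa y = 0 /\ 0 <= ordinate y)) -> two_sided q.
Proof.
move=> /nbhs_ballP[r /= r0 hr].
pose U1 := [set y | ball q r y /\ 0 < Num.min (abscissa y) (ordinate y)].
pose V (g : plane R -> R) := [set y | ball q r y /\ 0 < - g y].
pose U2 := V abscissa `|` V ordinate.
have nB : nbhs q (ball q r) by exact: nbhsx_ballx.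
have U1L : U1 `<=` ~` outline.
  move=> y [By]; rewrite lt_min => /andP[p1 p2] /(hr _ By) [[h _]|[h _]].
    by rewrite h ltxx in p2.
  by rewrite h ltxx in p1.
have U2L : U2 `<=` ~` outline.
  by move=> y [|] [By p] /(hr _ By) [[h h']|[h h']]; move: p; lra.
exists U1, U2; split.
- near=> y => Ly; have By : ball q r y by near: y.
  have [a0|a0|a0] := ltgtP (abscissa y) 0.
  + by right; left; split=> //; rewrite oppr_gt0.
  + have [b0|b0|b0] := ltgtP (ordinate y) 0.
    * by right; right; split=> //; rewrite oppr_gt0.
    * by left; split=> //; rewrite lt_min a0.
    * by case: Ly; apply/(hr _ By); left; rewrite b0 ltW.
  + have [b0|b0] := ltP (ordinate y) 0.
      by right; right; split=> //; rewrite oppr_gt0.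
    by case: Ly; apply/(hr _ By); right.
- apply: (locally_constant_convex U1L) => x y t [Bx]; rewrite lt_min => /andP[px px'].
  move=> [By]; rewrite lt_min => /andP[py py'] t01.
  split; first exact: ball_convex.
  by rewrite lt_min abscissa_affine ordinate_affine !convex_gt0.
- have VC (g : plane R -> R) : V g `<=` U2 ->
      (forall x y t, g (x + t *: (y - x)) = (1 - t) * g x + t * g y) ->
      forall y z, V g y -> V g z -> f y = f z.
    move=> VU gE; apply: locally_constant_convex => [y /VU/U2L//|x y t [Bx px] [By py] t01].
    split; first exact: ball_convex.
    by have := convex_gt0 t01 px py; rewrite gE; lra.
  have Va := VC abscissa (@subsetUl _ _ _) abscissa_affine.
  have Vo := VC ordinate (@subsetUr _ _ _) ordinate_affine.
  have [z [za zo]] : exists z, V abscissa z /\ V ordinate z.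
    have := @cvg_line q ((-1) *: e1 + (-1) *: e2) 0; rewrite scale0r addr0 => cl.
    have [t t0 Bt] := near0_pos (cl _ nB).
    have q0 g : det2 (q - q) g = 0 /\ det2 g (q - q) = 0.
      by rewrite subrr /det2/= !mul0r !mulr0 subrr.
    exists (q + t *: ((-1) *: e1 + (-1) *: e2)).
    by split; split => //; rewrite scalerDr !scalerA ?abscissaD ?ordinateD mulrN1
      /abscissa /ordinate ?(q0 _).1 ?(q0 _).2 mul0r add0r opprK.
  move=> x y Ux Uy; transitivity (f z).
    by case: Ux => [/Va/(_ za)|/Vo/(_ zo)].
  by case: Uy => [/Va/(_ za)|/Vo/(_ zo)].
- near=> y => Ly; have By : ball q r y by near: y.
  have h : 0 <= abscissa y /\ 0 <= ordinate y /\
      (abscissa y = 0 \/ ordinate y = 0).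
    have /(hr _ By)[[-> a0]|[-> o0]] := Ly.
      by split=> //; split=> //; right.
    by split=> //; split=> //; left.
  have [a0 [b0 ab]] := h.
  split.
  + apply: (adherent_along (e := 1 *: e1 + 1 *: e2) U1L By) => t t0 Bt.
    split=> //; rewrite scalerDr !scalerA abscissaD ordinateD mulr1 lt_min.
    by rewrite !ltr_wpDl.
  + case: ab => [aE|oE].
      apply: (adherent_along (e := (-1) *: e1 + 0 *: e2) U2L By) => t t0 Bt.
      by left; split=> //; rewrite scalerDr !scalerA abscissaD aE mulrN1 add0r opprK.
    apply: (adherent_along (e := 0 *: e1 + (-1) *: e2) U2L By) => t t0 Bt.
    by right; split=> //; rewrite scalerDr !scalerA ordinateD oE mulrN1 add0r opprK.
Unshelve. all: by end_near. Qed.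

End Corner.

Lemma det2_eq0_colinear (x y : plane R) : x != 0 -> det2 x y = 0 ->
  exists t, y = t *: x.
Proof.
move: x y => [x1 x2] [y1 y2] x0; rewrite /det2/= => h.
have [x10|x10] := eqVneq x1 0.
  have x20 : x2 != 0 by apply: contraNneq x0 => ->; rewrite x10.
  exists (y2 / x2); rewrite x10; congr (_, _) => /=; rewrite /GRing.scale/=.
    rewrite mulr0; apply/eqP; move: h; rewrite x10 mul0r sub0r => /eqP.
    by rewrite oppr_eq0 mulf_eq0 (negPf x20).
  by rewrite mulfVK.
exists (y1 / x1); congr (_, _) => /=; rewrite /GRing.scale/= ?mulfVK//.
apply: (mulfI x10); have -> : x1 * (y1 / x1 * x2) = x2 * y1 by field.
by apply/eqP; rewrite -subr_eq0 h.
Qed.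

Lemma exists_independent (x : plane R) : x != 0 -> exists y, det2 x y != 0.
Proof.
move: x => [x1 x2] x0; exists (- x2, x1); rewrite /det2/= mulrN opprK.
apply: contraNneq x0 => h.
have := sqr_ge0 x1; have := sqr_ge0 x2; rewrite !expr2 => h1 h2.
have /eqP : x1 * x1 = 0 by lra.
have /eqP : x2 * x2 = 0 by lra.
by rewrite !mulf_eq0 !orbb => /eqP-> /eqP->.
Qed.

Lemma next_lt i : (i.+1 %% n < n)%N.
Proof. by rewrite ltn_mod (ltn_trans _ n1). Qed.

Lemma side_point1 i : side_point i 1 = side_point (i.+1 %% n)%N 0.
Proof. by rewrite /side_point scale1r scale0r addr0 /side addrC subrK. Qed.

Lemma side_neq0 i : (i < n)%N -> side i != 0.
Proof.
move=> ilt; apply/eqP => s0.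
have h2 : 0 <= (2^-1 : R) < 1 by rewrite invr_ge0 ler0n/= invf_lt1// ltr1n.
have h0 : 0 <= (0 : R) < 1 by rewrite lexx ltr01.
have := simple ilt ilt h2 h0; rewrite /side_point s0 !scaler0 => /(_ erefl)[_].
by apply/eqP; rewrite invr_eq0 pnatr_eq0.
Qed.

(** A side that does not pass through [q] is closed, hence stays away from [q]. *)
Lemma near_sides (q : plane R) : \forall y \near q, forall i, (i < n)%N ->
  (exists2 t, t \in `[0, 1] & y = side_point i t) ->
  exists2 t, t \in `[0, 1] & q = side_point i t.
Proof.
pose P (i : 'I_n) (y : plane R) := (exists2 t, t \in `[0, 1] & y = side_point i t) ->
  exists2 t, t \in `[0, 1] & q = side_point i t.
suff : \forall y \near q, forall i, P i y.
  by apply: filterS => y h i ilt; exact: (h (Ordinal ilt)).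
apply: (@filter_forall _ _ P (nbhs q)) => i; rewrite /P.
have [qi|qi] := pselect (exists2 t, t \in `[0, 1] & q = side_point i t).
  by apply: nearW.
have cl : closed [set side_point i t | t in `[0, 1]%classic].
  apply: compact_closed; first exact: norm_hausdorff.
  apply: continuous_compact; last exact: segment_compact.
  by apply: continuous_subspaceT => t; exact: cvg_line.
have : \forall y \near q, ~ [set side_point i t | t in `[0, 1]%classic] y.
  apply: open_nbhs_nbhs; split; first exact: closed_openC.
  by move=> [t t01 tq]; apply: qi; exists t.
by apply: filterS => y ny [t t01 yt]; exfalso; apply: ny; exists t.
Qed.

Lemma side_pointP i t : (i < n)%N -> t \in `[0, 1] ->
  (t < 1) \/ (side_point i t = side_point (i.+1 %% n)%N 0 /\ t = 1).
Proof.
move=> _; rewrite in_itv/= => /andP[_]; rewrite le_eqVlt => /predU1P[->|]; last by left.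
by right; rewrite side_point1.
Qed.

Lemma near_abscissa (q e1 e2 : plane R) (d : R) : 0 < d ->
  \forall y \near q, `|abscissa q e1 e2 y| < d.
Proof.
move=> d0.
have ca : (abscissa q e1 e2 : plane R -> R) y @[y --> q] --> (0 : R).
  have -> : 0 = abscissa q e1 e2 q.
    by rewrite /abscissa subrr /det2/= !mul0r subrr mul0r.
  apply: cvgM; last exact: cvg_cst.
  by apply: cvgB; apply: cvgM; try exact: cvg_cst;
    apply: cvgB; try exact: cvg_cst; [exact: cvg_fst|exact: cvg_snd].
move/cvgrPdist_lt : ca => /(_ _ d0); apply: filterS => y.
by rewrite sub0r normrN.
Qed.

Lemma near_ordinate (q e1 e2 : plane R) (d : R) : 0 < d ->
  \forall y \near q, `|ordinate q e1 e2 y| < d.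
Proof.
move=> d0.
have ca : (ordinate q e1 e2 : plane R -> R) y @[y --> q] --> (0 : R).
  have -> : 0 = ordinate q e1 e2 q.
    by rewrite /ordinate subrr /det2/= !mulr0 subrr mul0r.
  apply: cvgM; last exact: cvg_cst.
  by apply: cvgB; apply: cvgM; try exact: cvg_cst;
    apply: cvgB; try exact: cvg_cst; [exact: cvg_snd|exact: cvg_fst].
move/cvgrPdist_lt : ca => /(_ _ d0); apply: filterS => y.
by rewrite sub0r normrN.
Qed.

Lemma two_sided_interior i t : (i < n)%N -> 0 < t < 1 ->
  two_sided (side_point i t).
Proof.
move=> ilt /andP[t0 t1]; set q := side_point i t.
have s0 := side_neq0 ilt; have [e' ee'] := exists_independent s0.
have t01 : 0 <= t < 1 by rewrite ltW.
have qE j s : (j < n)%N -> s \in `[0, 1] -> q = side_point j s -> j = i /\ s = t.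
  move=> jlt s01 e.
  case: (side_pointP jlt s01) => [s1|[es s1]].
    have s01' : 0 <= s < 1 by move: s01; rewrite in_itv/= s1 => /andP[->].
    by have [-> ->] := simple ilt jlt t01 s01' e.
  have h0 : 0 <= (0 : R) < 1 by rewrite lexx ltr01.
  rewrite es in e; have [_ t0'] := simple ilt (next_lt j) t01 h0 e.
  by move: t0; rewrite t0' ltxx.
apply: (two_sided_line ee').
have near_t : \forall y \near q, 0 < t + abscissa q (side i) e' y < 1.
  have m0 : 0 < Num.min t (1 - t) by rewrite lt_min t0 subr_gt0.
  have := near_abscissa q (side i) e' m0.
  by apply: filterS => y; rewrite lt_min !ltr_norml => /andP[/andP[? ?] /andP[? ?]];
    apply/andP; split; lra.
have ns := near_sides q.
near=> y; split.
- move=> [j [s [jlt s01 yE]]].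
  have : exists2 t, t \in `[0, 1] & q = side_point j t.
    have : exists2 t, t \in `[0, 1] & y = side_point j t by exists s.
    by move: jlt; move: (j); near: y.
  move=> [s' s'01 /qE]; move=> /(_ jlt s'01)[ji _]; rewrite yE ji.
  rewrite /ordinate /q /side_point opprD addrACA subrr add0r -scalerBl.
  by rewrite det2Zr det2xx mulr0 mul0r.
- move=> o0; exists i, (t + abscissa q (side i) e' y); split=> //.
    have /andP[h1 h2] : 0 < t + abscissa q (side i) e' y < 1 by near: y.
    by rewrite in_itv/= !ltW.
  rewrite {1}(coordinatesE q ee' y) o0 scale0r addr0 /q /side_point -addrA.
  by rewrite -scalerDl.
Unshelve. all: by end_near. Qed.

(** The sides at a vertex form a corner, or else continue each other on a line:
    they cannot overlap, as the polygon is simple. *)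
Lemma two_sided_vertex j : (j < n)%N -> two_sided (side_point j 1).
Proof.
move=> jlt; set i := (j.+1 %% n)%N; have ilt : (i < n)%N := next_lt j.
have ij : i <> j.
  rewrite /i; have [jn|jn] := eqVneq j.+1 n; first by rewrite jn modnn; lia.
  by rewrite modn_small; lia.
have h0 : 0 <= (0 : R) < 1 by rewrite lexx ltr01.
set q := side_point j 1; have qi : q = side_point i 0 by exact: side_point1.
have qE k s : (k < n)%N -> s \in `[0, 1] -> q = side_point k s ->
    (k = i /\ s = 0) \/ k = j.
  move=> klt s01 e; rewrite qi in e.
  case: (side_pointP klt s01) => [s1|[es s1]].
    have s01' : 0 <= s < 1 by move: s01; rewrite in_itv/= s1 => /andP[->].
    by have [-> ->] := simple ilt klt h0 s01' e; left.
  rewrite es in e; have [ik _] := simple ilt (next_lt k) h0 h0 e.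
  right; move: ik; rewrite /i; move: jlt klt.
  rewrite leq_eqVlt => /predU1P[<-|jl]; rewrite leq_eqVlt => /predU1P[e2|kl].
  - by case: e2.
  - by rewrite modnn modn_small// => e3.
  - by rewrite e2 modnn modn_small// => e3.
  - by rewrite !modn_small// => -[].
have si0 := side_neq0 ilt; have sj0 := side_neq0 jlt.
have pj s : side_point j s = q + (1 - s) *: - side j.
  rewrite /q /side_point scalerN -scaleNr -addrA -scalerDl; congr (_ + _ *: _); ring.
have pi s : side_point i s = q + s *: side i.
  by rewrite qi /side_point scale0r addr0.
have ns := near_sides q.
have [ee0|ee0] := eqVneq (det2 (side i) (- side j)) 0; last first.
  apply: (two_sided_corner ee0).
  have na := near_abscissa q (side i) (- side j) ltr01.
  have no := near_ordinate q (side i) (- side j) ltr01.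
  near=> y.
  have ay : `|abscissa q (side i) (- side j) y| < 1 by near: y.
  have oy : `|ordinate q (side i) (- side j) y| < 1 by near: y.
  have yE := coordinatesE q ee0 y.
  split.
  - move=> [k [s [klt s01 yk]]].
    have : exists2 t, t \in `[0, 1] & q = side_point k t.
      have : exists2 t, t \in `[0, 1] & y = side_point k t by exists s.
      by move: klt; move: (k); near: y.
    move=> [s' s'01 /qE]; move=> /(_ klt s'01); move: s01; rewrite in_itv/= => /andP[s0 s1].
    have A0 : abscissa q (side i) (- side j) q = 0.
      by rewrite /abscissa subrr /det2/= !mul0r subrr mul0r.
    have O0 : ordinate q (side i) (- side j) q = 0.
      by rewrite /ordinate subrr /det2/= !mulr0 subrr mul0r.
    case=> [[ki _]|kj]; [left|right]; rewrite yk.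
    + rewrite ki pi -[s *: _]addr0 -[X in _ + (_ + X)](scale0r (- side j)).
      by rewrite (ordinateD q ee0) (abscissaD q ee0) A0 O0 addr0 add0r.
    + rewrite kj pj -[_ *: - _]add0r -[X in _ + (X + _)](scale0r (side i)).
      by rewrite (ordinateD q ee0) (abscissaD q ee0) A0 O0 addr0 add0r subr_ge0.
  - move=> [[b0 a0]|[a0 b0]].
    + exists i, (abscissa q (side i) (- side j) y); split=> //.
        by rewrite in_itv/= a0 ltW//; exact: le_lt_trans (ler_norm _) ay.
      by rewrite pi {1}yE b0 scale0r addr0.
    + exists j, (1 - ordinate q (side i) (- side j) y); split=> //.
        rewrite in_itv/= subr_ge0 lerBlDr lerDl b0 andbT ltW//.
        exact: le_lt_trans (ler_norm _) oy.
      by rewrite pj {1}yE a0 scale0r add0r subKr.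
have [l lE] := det2_eq0_colinear si0 ee0.
have l0 : l != 0.
  apply: contraNneq sj0 => l0; move: lE; rewrite l0 scale0r => /eqP.
  by rewrite oppr_eq0.
have {}l0 : l < 0.
  rewrite lt_neqAle l0 leNgt; apply/negP => lp.
  (* If [l > 0], the two sides leave the vertex in the same direction; this is
     the parameter on one of them of a point that lies on both. *)
  pose s := Num.min (2^-1) (l / 2).
  have s0 : 0 < s by rewrite lt_min invr_gt0 ltr0n divr_gt0.
  have s1 : s <= 2^-1 by rewrite ge_min lexx.
  have s2 : s <= l / 2 by rewrite ge_min lexx orbT.
  have sl : s / l <= 2^-1 by rewrite ler_pdivrMr// mulrC.
  have sl0 : 0 < s / l by exact: divr_gt0.
  have h2 : (2^-1 : R) < 1 by rewrite invf_lt1// ltr1n.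
  have a1 : 0 <= s < 1 by rewrite ltW//=; exact: le_lt_trans h2.
  have a2 : 0 <= 1 - s / l < 1 by apply/andP; split; lra.
  have [] := simple ilt jlt a1 a2.
    by rewrite pi pj lE subKr scalerA mulfVK ?gt_eqF.
  by move=> /ij.
have [e' ee'] := exists_independent si0.
apply: (two_sided_line ee').
have l0' : 0 < - l by rewrite oppr_gt0.
have d0 : 0 < Num.min 1 (- l) by rewrite lt_min ltr01.
have na := near_abscissa q (side i) e' d0.
near=> y.
have ay : `|abscissa q (side i) e' y| < Num.min 1 (- l) by near: y.
split.
- move=> [k [s [klt s01 yk]]].
  have : exists2 t, t \in `[0, 1] & q = side_point k t.
    have : exists2 t, t \in `[0, 1] & y = side_point k t by exists s.
    by move: klt; move: (k); near: y.
  move=> [s' s'01 /qE]; move=> /(_ klt s'01) kij.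
  suff [r yr] : exists r, y = q + r *: side i.
    by rewrite yr /ordinate addrC addrA addNr add0r det2Zr det2xx mulr0 mul0r.
  rewrite yk; case: kij => [[-> _]|->]; first by exists s; rewrite pi.
  by exists ((1 - s) * l); rewrite pj lE scalerA.
- move=> o0; have yE := coordinatesE q ee' y.
  move: yE ay; rewrite o0 scale0r addr0; set a := abscissa _ _ _ _ => yE.
  rewrite lt_min !ltr_norml => /andP[/andP[a1 a2] /andP[a3 a4]].
  have [ap|an] := leP 0 a.
    by exists i, a; split=> //; [rewrite in_itv/= ap ltW|rewrite pi].
  have al0 : 0 <= a / l by rewrite -mulrNN -invrN; apply: divr_ge0; rewrite ?oppr_ge0; exact: ltW.
  have al1 : a / l <= 1.
    by rewrite -mulrNN -invrN ler_pdivrMr// mul1r; lra.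
  exists j, (1 - a / l); split=> //; first by rewrite in_itv/=; apply/andP; split; lra.
  by rewrite pj lE scalerA subKr mulfVK ?lt_eqF.
Unshelve. all: by end_near. Qed.

Lemma near_outlineC q : ~ outline q -> \forall y \near q, ~ outline y.
Proof.
move=> nq; apply: filterS (near_sides q) => y h [i [t [ilt t01 yt]]].
have [|s s01 qs] := h i ilt; first by exists t.
by apply: nq; exists i, s.
Qed.

Lemma side_point_outline i t : (i < n)%N -> t \in `[0, 1] ->
  outline (side_point i t).
Proof. by move=> ilt t01; exists i, t. Qed.

Lemma outline_two_sided i t : (i < n)%N -> t \in `[0, 1] ->
  two_sided (side_point i t).
Proof.
move=> ilt; rewrite in_itv/= => /andP[]; rewrite le_eqVlt => /predU1P[<-|t0].
  move=> _; have jlt : ((i + n.-1) %% n < n)%N by rewrite ltn_mod; lia.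
  suff -> : side_point i 0 = side_point ((i + n.-1) %% n)%N 1.
    exact: two_sided_vertex.
  rewrite side_point1; congr (side_point _ 0); rewrite -addn1 modnDml -addnA addn1.
  by rewrite prednK ?(ltn_trans _ n1)// modnDr modn_small.
rewrite le_eqVlt => /predU1P[->|t1]; first exact: two_sided_vertex.
by apply: two_sided_interior; rewrite // t0.
Qed.

Definition two_valued (a b : S) (x : plane R) : Prop :=
  \forall y \near x, ~ outline y -> f y = a \/ f y = b.

(** Walking along the outline, both pieces found near one point are met again
    near the next one, so the two values propagate. *)
Lemma two_valued_step (a b : S) i (t0 : R) : (i < n)%N -> t0 \in `[0, 1] ->
  \forall t \near t0, t \in `[0, 1] ->
    (two_valued a b (side_point i t) <-> two_valued a b (side_point i t0)).
Proof.
move=> ilt t01; have [U1 [U2 [cov c1 c2 adh]]] := outline_two_sided ilt t01.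
have cl := @cvg_line (v i) (side i) t0.
have h1 : \forall t \near t0, \forall y \near side_point i t,
    ~ outline y -> U1 y \/ U2 y.
  by have /nbhs_interior := cov; exact: cl.
have h2 : \forall t \near t0, outline (side_point i t) ->
    (forall W, nbhs (side_point i t) W -> exists2 z, W z & U1 z /\ ~ outline z) /\
    (forall W, nbhs (side_point i t) W -> exists2 z, W z & U2 z /\ ~ outline z).
  exact: cl adh.
have spread t u : t \in `[0, 1] ->
    (forall W, nbhs (side_point i t) W -> exists2 z, W z & U1 z /\ ~ outline z) /\
    (forall W, nbhs (side_point i t) W -> exists2 z, W z & U2 z /\ ~ outline z) ->
    (\forall y \near side_point i u, ~ outline y -> U1 y \/ U2 y) ->
    two_valued a b (side_point i t) -> two_valued a b (side_point i u).
  move=> tin [a1 a2] cu tv.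
  have [z1 z1W [Uz1 nz1]] := a1 _ tv; have [z2 z2W [Uz2 nz2]] := a2 _ tv.
  apply: filterS cu => y hy ny; case: (hy ny) => Uy.
    by rewrite (c1 _ _ Uy Uz1); exact: z1W.
  by rewrite (c2 _ _ Uy Uz2); exact: z2W.
have h20 := nbhs_singleton adh (side_point_outline ilt t01).
near=> t => tin.
have h1t : \forall y \near side_point i t, ~ outline y -> U1 y \/ U2 y.
  by near: t.
have h2t : outline (side_point i t) ->
    (forall W, nbhs (side_point i t) W -> exists2 z, W z & U1 z /\ ~ outline z) /\
    (forall W, nbhs (side_point i t) W -> exists2 z, W z & U2 z /\ ~ outline z).
  by near: t.
by split; apply: spread => //; apply: h2t; exact: side_point_outline.
Unshelve. all: by end_near. Qed.

(** This is the half of the Jordan curve theorem that bounds the number of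
    components. The values of [f] near one point of the outline are carried all
    the way around the outline; and any point off the outline is joined to it
    by a segment, along which [f] keeps its value until the outline is met. *)
Lemma two_values : exists a b, forall x, ~ outline x -> f x = a \/ f x = b.
Proof.
have n0 : (0 < n)%N by rewrite (ltn_trans _ n1).
have z01 : (0 : R) \in `[0, 1] by rewrite in_itv/= lexx ler01.
have o01 : (1 : R) \in `[0, 1] by rewrite in_itv/= lexx ler01.
have [U1 [U2 [cov c1 c2 adh]]] := outline_two_sided n0 z01.
have h20 := nbhs_singleton adh (side_point_outline n0 z01).
have [z1 _ [Uz1 nz1]] := h20.1 _ filterT.
have [z2 _ [Uz2 nz2]] := h20.2 _ filterT.
exists (f z1), (f z2).
have side_eq i t : (i < n)%N -> t \in `[0, 1] ->
    two_valued (f z1) (f z2) (side_point i t) <->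
    two_valued (f z1) (f z2) (side_point i 1).
  move=> ilt; move: t; apply: interval_induction => // t0 t01.
  by apply: filterS (two_valued_step (f z1) (f z2) ilt t01) => t h tin;
    rewrite h.
have tv0 i : (i < n)%N -> two_valued (f z1) (f z2) (side_point i 0).
  elim: i => [_|i IH ilt].
    apply: filterS cov => y hy ny; case: (hy ny) => Uy.
      by left; exact: c1.
    by right; exact: c2.
  have ilt' := ltnW ilt.
  rewrite -[i.+1](modn_small ilt) -side_point1.
  by apply/(side_eq i 0 ilt' z01)/IH.
have tv i t : (i < n)%N -> t \in `[0, 1] ->
    two_valued (f z1) (f z2) (side_point i t).
  by move=> ilt tin; apply/side_eq => //; apply/(side_eq i 0) => //; exact: tv0.
move=> x nx.
pose h (u : R) := x + u *: (v 0%N - x).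
suff P u : u \in `[0, 1] -> ~ outline (h u) -> f (h u) = f z1 \/ f (h u) = f z2.
  by have := P 0 z01; rewrite /h scale0r addr0; apply.
move: u; apply: interval_induction => [|u0 u01].
  rewrite /h scale1r addrC subrK => nv; exfalso; apply: nv.
  by have := side_point_outline n0 z01; rewrite /side_point scale0r addr0.
have ch := @cvg_line x (v 0%N - x) u0.
have [[i [t [ilt tin ht]]]|nh] := pselect (outline (h u0)).
  have : \forall u \near u0, ~ outline (h u) -> f (h u) = f z1 \/ f (h u) = f z2.
    have tvu := tv i t ilt tin; rewrite -ht in tvu; exact: ch tvu.
  by apply: filterS => u hu uin; split=> // _ []; exists i, t.
have no := near_outlineC nh.
have : \forall u \near u0, f (h u) = f (h u0) /\ ~ outline (h u).
  have h3 : \forall y \near h u0, f y = f (h u0) /\ ~ outline y.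
    by apply: filterI; [exact: locf|exact: no].
  exact: ch h3.
by apply: filterS => u [e nu] _; split=> H _; [have := H nu|have := H nh]; rewrite e.
Qed.

End Planar.

(** * Knots with a projection without crossings *)

Section Unknot.
Variable R : realType.
Implicit Types (K : set (space3 R)).

Definition flat_section (E : topologicalType) (G : finGroupType) (X : set E)
    (T : E -> E -> G) (s : E -> G) : Prop :=
  forall x, X x -> \forall y \near x, s x = (T x y * s y)%g.

Definition flat_conjugate (E : topologicalType) (G : finGroupType) (X : set E)
    (T : E -> E -> G) (s : E -> G) : Prop :=
  forall x, X x -> \forall y \near x, s x = (T x y * s y * (T x y)^-1)%g.

(** In terms of the representation of the fundamental group of the complement
    defined by [T]: it is trivial, or an element other than [1] of [G] commutes
    with its image. A representation of a cyclic group has this property, the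
    element being the image of a generator. *)
Definition cyclic_monodromy K : Prop :=
  forall (G : finGroupType) (T : space3 R -> space3 R -> G),
  local_system (~` K) T ->
  (exists s, flat_section (~` K) T s) \/
  (exists2 s, flat_conjugate (~` K) T s & forall x, ~ K x -> s x <> 1%g).

Lemma cyclic_monodromy_homeo K (f : space3 R -> space3 R) :
  homeomorphism f -> cyclic_monodromy (f @` K) -> cyclic_monodromy K.
Proof.
move=> [cf [g [cg fg gf]]] H G T lT.
have fK x : ~ K x -> ~ (f @` K) (f x).
  by move=> nK [y Ky /(can_inj fg) yx]; apply: nK; rewrite -yx.
have gK x : ~ (f @` K) x -> ~ K (g x).
  by move=> nK Kg; apply: nK; exists (g x).
have lT' : local_system (~` (f @` K)) (fun x y => T (g x) (g y)).
  move=> x nx; have h : \forall y \near x, \forall z \near g y,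
      T (g x) z = (T (g x) (g y) * T (g y) z)%g.
    exact: (cg x) (lT _ (gK _ nx)).
  by apply: filterS h => y hy; exact: (cg y) hy.
have [[s sP]|[s sP s1]] := H G _ lT'; [left|right].
  exists (s \o f) => x nx.
  have h : \forall y \near x, s (f x) = (T (g (f x)) (g (f y)) * s (f y))%g.
    exact: (cf x) (sP _ (fK _ nx)).
  by apply: filterS h => y; rewrite !fg.
exists (s \o f) => [x nx|x nx]; last exact/s1/fK.
have h : \forall y \near x, s (f x) = (T (g (f x)) (g (f y)) * s (f y) *
    (T (g (f x)) (g (f y)))^-1)%g.
  exact: (cf x) (sP _ (fK _ nx)).
by apply: filterS h => y; rewrite !fg.
Qed.

(** Points over the complement of the projection belong to this set. *)
Definition above K : set (space3 R) :=
  [set x | forall y, K y -> y.1 = x.1 -> y.2 < x.2].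

Lemma open_above K : compact K -> open (above K).
Proof.
move=> /compact_near_coveringP cK; rewrite openE => x ax; rewrite /interior/=.
have := cK _ (nbhs x) (fun z y => y.1 = z.1 -> y.2 < z.2) _.
apply=> y Ky; have [yx|yx] := eqVneq y.1 x.1.
  have yx2 := ax y Ky yx; pose m : R := (y.2 + x.2) / 2.
  have ym : (y.2 : R) < m by rewrite /m; lra.
  have mx : m < (x.2 : R) by rewrite /m; lra.
  exists ([set z | z.2 < m], [set z | m < z.2]); last first.
    by move=> [y' z] /= [h1 h2] _; exact: lt_trans h1 h2.
  split=> /=.
    exact: (near_snd (P := fun t => t < m) (q := y) (lt_nbhsl ym)).
  exact: (near_snd (P := fun t => m < t) (q := x) (lt_nbhsr mx)).
have hd : hausdorff_space (plane R) by exact: norm_hausdorff.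
move: hd; rewrite open_hausdorff => /(_ _ _ yx)[[U V] /= [/set_mem Uy /set_mem Vx]].
move=> [oU oV UV0].
exists ([set z | U z.1], [set z | V z.1]); last first.
  move=> [y' z] /= [Uy' Vz] yz; have : (U `&` V) z.1 by split=> //; rewrite -yz.
  by rewrite (eqP UV0).
by split=> /=; apply: near_fst; apply: open_nbhs_nbhs.
Qed.

(** The half space above all of [K] contracts to a point, and the points above
    [K] are moved into it by a vertical homotopy that avoids [K]. *)
Lemma trivial_above K M (G : finGroupType) (T : space3 R -> space3 R -> G) :
  compact K -> (forall y, K y -> `|y.2| <= M) -> local_system (~` K) T ->
  exists s, flat_section (above K) T s.
Proof.
move=> cK KM lT.
pose base : space3 R := (0, M + 1).
pose H : set (space3 R) := [set x | M < x.2].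
have HK x : H x -> ~ K x.
  by move=> Hx /KM; apply/negP; rewrite -ltNge; exact: lt_le_trans (ler_norm _).
have oH : open H.
  rewrite openE => x Hx; rewrite /interior/=.
  exact: (near_snd (P := fun t => M < t) (q := x) (lt_nbhsr Hx)).
have [s0 s0P] : exists s, flat_section H T s.
  pose c (q : space3 R * R) : space3 R := base + (1 - q.2) *: (q.1 - base).
  have c0 x : c (x, 0) = x by rewrite /c/= subr0 scale1r addrC subrK.
  have c1 x : c (x, 1) = base by rewrite /c/= subrr scale0r addr0.
  have [||||s sP] := @homotopy_section R (space3 R) G (~` K) T lT H c (fun=> 1%g).
  - move=> x t Hx; rewrite in_itv/= => /andP[t0 t1]; apply: HK.
    have h : 0 <= (1 - t) * (x.2 - M) by rewrite mulr_ge0// subr_ge0// ltW.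
    suff : M < M + 1 + (1 - t) * (x.2 - (M + 1)) by [].
    have [tE|tn] := eqVneq t 0; first by move: Hx; rewrite tE /H/=; lra.
    have : 0 < t by rewrite lt_neqAle eq_sym tn.
    by move: h; lra.
  - move=> q; apply: (@cvgD _ (space3 R) _ _ _ (fun=> base)
      (fun q => (1 - q.2) *: (q.1 - base))); first exact: cvg_cst.
    apply: (@cvgZ R (space3 R) _ _ _ (fun q => 1 - q.2) (fun q => q.1 - base)).
      by apply: cvgB; [exact: cvg_cst|exact: cvg_snd].
    by apply: (@cvgB _ (space3 R)); [exact: cvg_fst|exact: cvg_cst].
  - exact: oH.
  - move=> x Hx; near=> y; rewrite !c1 mulg1 (local_system_refl lT)//.
    by apply: HK; rewrite /H/= ltrDl ltr01.
  - exists s => x Hx; have h := sP x Hx.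
    near=> y; have : s x = (T (c (x, 0%R)) (c (y, 0%R)) * s y)%g by near: y.
    by rewrite !c0.
(* Large enough to reach the half space [H] from any point. *)
pose lift (x : space3 R) : R := `|x.2| + `|M| + 1.
pose c (q : space3 R * R) : space3 R := (q.1.1, q.1.2 + q.2 * lift q.1).
have lift0 x : 0 < lift x by rewrite ltr_pwDr// addr_ge0.
have cc : continuous c.
  move=> q; rewrite /c; have cq1 : r.1 @[r --> q] --> q.1 by exact: cvg_fst.
  have cq12 : (r.1.2 : R) @[r --> q] --> q.1.2 by exact: cvg_comp cq1 cvg_snd.
  apply: pair_cvg; first exact: cvg_comp cq1 cvg_fst.
  apply: cvgD; first exact: cq12.
  apply: cvgM; first exact: cvg_snd.
  apply: cvgD; last exact: cvg_cst.
  by apply: cvgD; [exact: cvg_norm|exact: cvg_cst].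
have c0 x : c (x, 0) = x by rewrite /c/= mul0r addr0 -surjective_pairing.
have cH x : H (c (x, 1)).
  rewrite /H/c/= mul1r /lift; have := ler_norm M; have := ler_norm (- x.2).
  by rewrite normrN; lra.
have [||||s sP] := @homotopy_section R (space3 R) G (~` K) T lT (above K) c
    (fun x => s0 (c (x, 1))).
- move=> x t ax; rewrite in_itv/= => /andP[t0 t1] Kc.
  have := ax _ Kc erefl; rewrite /c/=; have := lift0 x; nra.
- exact: cc.
- exact: open_above.
- move=> x ax.
  have ci : (fun y => c (y, 1)) @ x --> c (x, 1).
    have p1 : (fun y => (y, 1 : R)) @ x --> (x, 1 : R).
      by apply: pair_cvg; [exact: cvg_id|exact: cvg_cst].
    exact: (cvg_comp _ _ p1 (@cc _)).
  exact: ci (s0P _ (cH x)).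
- exists s => x ax; have h := sP x ax.
  near=> y; have : s x = (T (c (x, 0%R)) (c (y, 0%R)) * s y)%g by near: y.
    by rewrite !c0.
Unshelve. all: by end_near.
Qed.

Definition flip (x : space3 R) : space3 R := (x.1, - x.2).

Lemma flipK : involutive flip.
Proof. by move=> [x y]; rewrite /flip/= opprK. Qed.

Lemma continuous_flip : continuous flip.
Proof.
by move=> x; apply: pair_cvg; [exact: cvg_fst|apply: cvgN; exact: cvg_snd].
Qed.

Lemma homeomorphism_flip : homeomorphism flip.
Proof.
split; first exact: continuous_flip.
by exists flip; split; [exact: continuous_flip|exact: flipK|exact: flipK].
Qed.

Lemma trivial_below K M (G : finGroupType) (T : space3 R -> space3 R -> G) :
  compact K -> (forall y, K y -> `|y.2| <= M) -> local_system (~` K) T ->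
  open (flip @^-1` above (flip @` K)) /\
  exists s, flat_section (flip @^-1` above (flip @` K)) T s.
Proof.
move=> cK KM lT.
have cK' : compact (flip @` K).
  apply: continuous_compact => //; apply: continuous_subspaceT.
  exact: continuous_flip.
have KM' y : (flip @` K) y -> `|y.2| <= M by move=> [x /KM + <-]; rewrite /= normrN.
have lT' : local_system (~` (flip @` K)) (fun x y => T (flip x) (flip y)).
  move=> x nx; have nK : ~ K (flip x) by move=> Kx; apply: nx; exists (flip x); rewrite ?flipK.
  have h : \forall y \near x, \forall z \near flip y,
      T (flip x) z = (T (flip x) (flip y) * T (flip y) z)%g.
    exact: (@continuous_flip x) (lT _ nK).
  by apply: filterS h => y hy; exact: (@continuous_flip y) hy.
split; first by apply: open_comp => [x _|]; [exact: continuous_flip|exact: open_above].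
have [s sP] := trivial_above cK' KM' lT'.
exists (s \o flip) => x ax.
have h : \forall y \near x, s (flip x) =
    (T (flip (flip x)) (flip (flip y)) * s (flip y))%g.
  exact: (@continuous_flip x) (sP _ ax).
by apply: filterS h => y; rewrite !flipK.
Qed.

Section Projection.
Variable p : seq (space3 R).
Hypothesis simple_p : simple_polygon p.
Hypothesis no_multiple : multiple_points p = set0.

Let n := size p.
Let v i : plane R := (nth 0 p i).1.

Let n1 : (1 < n)%N. Proof. by have [n2 _] := simple_p; exact: ltnW. Qed.

Let planar_simple i j s t : (i < n)%N -> (j < n)%N ->
  0 <= s < 1 -> 0 <= t < 1 -> side_point n v i s = side_point n v j t ->
  i = j /\ s = t.
Proof.
move=> ilt jlt s01 t01 e; apply: contrapT => nij.
suff : multiple_points p (side_point n v i s) by rewrite no_multiple.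
exists (i, s), (j, t); split; rewrite /strands/=; [by split|by split|].
by move=> [ij st]; apply: nij.
Qed.

Let planar_inj x y : polygon p x -> polygon p y -> x.1 = y.1 -> x = y.
Proof.
move=> [[i s] [/= ilt s01] <-] [[j t] [/= jlt t01] <-] e.
by have [-> ->] := planar_simple ilt jlt s01 t01 e.
Qed.

Lemma polygon_closed_param x : (0 < size p)%N -> polygon p x <->
  exists i t, [/\ (i < size p)%N, t \in `[0, 1] & x = polygon_point p (i, t)].
Proof.
move=> p0; split=> [[[i t] [/= ilt /andP[t0 t1]] <-]|[i [t [ilt]]]].
  by exists i, t; rewrite in_itv/= t0 ltW.
rewrite in_itv/= => /andP[t0]; rewrite le_eqVlt => /predU1P[->|t1] ->.
  exists ((i.+1 %% size p)%N, 0); first by split; rewrite /= ?ltn_mod// lexx ltr01.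
  by rewrite /polygon_point/= scale0r addr0 scale1r /edge_vector addrC subrK.
by exists (i, t) => //; split=> //=; rewrite t0.
Qed.

Let p0 : (0 < size p)%N. Proof. exact: ltnW. Qed.

Let outlineE x : outline n v x <-> exists2 y, polygon p y & y.1 = x.
Proof.
split=> [[i [t [ilt t01 ->]]]|[y /(polygon_closed_param _ p0)[i [t [ilt t01 ->]]] <-]].
  by exists (polygon_point p (i, t)) => //; apply/polygon_closed_param => //; exists i, t.
by exists i, t.
Qed.

(** Let [sA] and [sB] be flat sections above and below the polygon, and let [g1]
    and [g2] be the two values of [sA^-1 * sB]. After multiplying [sB] by
    [g1^-1], the sections differ by [1] or by [h = g2 * g1^-1]. If [h = 1] they
    glue to a flat section; otherwise their conjugates of [h] glue, since [h]
    commutes with itself. *)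
Lemma cyclic_monodromy_no_crossing : cyclic_monodromy (polygon p).
Proof.
move=> G T lT; set K := polygon p.
have cK : compact K by rewrite /K polygon_segments//; exact: compact_segments.
have [M KM] : exists M : R, forall y, K y -> `|y.2| <= M.
  have cK2 : compact ((fun y : space3 R => y.2) @` K).
    apply: continuous_compact => //; apply: continuous_subspaceT => y.
    exact: cvg_snd.
  have [M [_ hM]] := compact_bounded cK2.
  exists (M + 1) => y Ky; apply: (hM (M + 1)); first by rewrite ltrDl ltr01.
  by exists y.
have oA : open (above K) := open_above cK.
have [oB [sB sBP]] := trivial_below cK KM lT.
have [sA sAP] := trivial_above cK KM lT.
set B := _ @^-1` _ in oB sBP.
have AK x : above K x -> ~ K x by move=> ax /ax/(_ erefl); rewrite ltxx.
have BK x : B x -> ~ K x.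
  move=> bx Kx; have := bx (flip x) _ erefl; rewrite ltxx => /(_ _)/notF; apply.
  by exists x.
have ABK x : ~ K x -> above K x \/ B x.
  move=> nK; have [ax|nax] := pselect (above K x); [by left|right].
  move=> _ [y Ky <-] /= yx; rewrite ltrN2.
  rewrite ltNge; apply/negP => yx2; apply: nax => z Kz zx.
  have zy : z = y by apply: planar_inj => //; rewrite zx yx.
  rewrite lt_neqAle zy yx2 andbT; apply/eqP => e; apply: nK.
  by rewrite [x]surjective_pairing -yx -e -surjective_pairing.
have ABo x h : ~ outline n v x -> above K (x, h) /\ B (x, h).
  move=> nx; split.
    by move=> y Ky yx; exfalso; apply: nx; apply/outlineE; exists y.
  by move=> _ [y Ky <-] yx; exfalso; apply: nx; apply/outlineE; exists y.
have oAB x : above K x -> B x -> ~ outline n v x.1.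
  move=> ax bx /outlineE[y Ky yx]; have h1 := ax y Ky yx.
  have h2 : (flip y).2 < (flip x).2 by apply: bx => //; exists y.
  by move: h2; rewrite /= ltrN2 ltNge ltW.
pose g x := ((sA x)^-1 * sB x)%g.
have gloc x : above K x -> B x -> \forall y \near x, g x = g y.
  move=> ax bx; have ha := sAP x ax; have hb := sBP x bx.
  near=> y; rewrite /g.
  have -> : sA x = (T x y * sA y)%g by near: y.
  have -> : sB x = (T x y * sB y)%g by near: y.
  by rewrite invMg mulgA mulgKV.
pose f (x : plane R) := g (x, 0).
have gf x : above K x -> B x -> g x = f x.1.
  move=> ax bx; have nx := oAB x ax bx.
  have := @locally_constant_interval R G (fun t => g (x.1, t * x.2)).
  move=> /(_ _ 0); rewrite mul0r mul1r -surjective_pairing /f => <- //.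
    move=> t t01; have [a b] := ABo _ (t * x.2) nx.
    have ct : (fun u : R => (x.1, u * x.2)) @ t --> (x.1, t * x.2).
      apply: pair_cvg; first exact: cvg_cst.
      by apply: cvgM; [exact: cvg_id|exact: cvg_cst].
    have h : \forall u \near t, g (x.1, t * x.2) = g (x.1, u * x.2).
      exact: ct (gloc _ a b).
    by apply: filterS h => u ->.
  by rewrite in_itv/= lexx ler01.
have floc x : ~ outline n v x -> \forall y \near x, f y = f x.
  move=> nx; have [a b] := ABo x 0 nx.
  have cx : (fun y : plane R => (y, 0 : R)) @ x --> (x, 0 : R).
    by apply: pair_cvg; [exact: cvg_id|exact: cvg_cst].
  have h : \forall y \near x, g (x, 0) = g (y, 0) by exact: cx (gloc _ a b).
  by apply: filterS h => y e; rewrite /f e.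
have [g1 [g2 g12]] := two_values n1 planar_simple floc.
pose h := (g2 * g1^-1)%g; pose sB' x := (sB x * g1^-1)%g.
have sB'P : flat_section B T sB'.
  by move=> x bx; apply: filterS (sBP x bx) => y e; rewrite /sB' e mulgA.
have sBE x : above K x -> B x -> sB' x = sA x \/ sB' x = (sA x * h)%g.
  move=> ax bx; have := g12 _ (oAB x ax bx); rewrite -gf// /g => -[e|e]; [left|right].
    by rewrite /sB' -e invMg invgK mulgA mulgV mul1g.
  by rewrite /sB' /h -e !mulgA mulgV mul1g.
have nearA x : above K x -> \forall y \near x, above K y.
  by move=> ax; exact: open_nbhs_nbhs.
have nearB x : B x -> \forall y \near x, B y.
  by move=> bx; exact: open_nbhs_nbhs.
have [h1|h1] := eqVneq h 1%g; [left|right].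
  have sBA x : above K x -> B x -> sB' x = sA x.
    by move=> ax bx; case: (sBE x ax bx) => //; rewrite h1 mulg1.
  pose s x := if `[< above K x >] then sA x else sB' x.
  have sA' x : above K x -> s x = sA x by rewrite /s => /asboolP ->.
  have sB'' x : B x -> s x = sB' x.
    by move=> bx; rewrite /s; case: asboolP => // ax; rewrite sBA.
  exists s => x /ABK[ax|bx].
    by apply: filterS2 (sAP x ax) (nearA x ax) => y e ay; rewrite !sA'.
  by apply: filterS2 (sB'P x bx) (nearB x bx) => y e ay; rewrite !sB''.
pose cA x := (sA x * h * (sA x)^-1)%g; pose cB x := (sB' x * h * (sB' x)^-1)%g.
have cBA x : above K x -> B x -> cB x = cA x.
  move=> ax bx; rewrite /cB /cA; case: (sBE x ax bx) => -> //.
  have cjE (a b : G) : (a * b * b * (a * b)^-1 = a * b * a^-1)%g.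
    by rewrite invMg !mulgA mulgK.
  exact: cjE.
pose s x := if `[< above K x >] then cA x else cB x.
have sA' x : above K x -> s x = cA x by rewrite /s => /asboolP ->.
have sB'' x : B x -> s x = cB x.
  by move=> bx; rewrite /s; case: asboolP => // ax; rewrite cBA.
have conj_neq1 (a : G) : (a * h * a^-1)%g <> 1%g.
  move=> e; move/eqP: h1; apply; apply: (mulgI a); rewrite mulg1.
  by apply: (mulIg a^-1%g); rewrite e mulgV.
exists s => [x /ABK[ax|bx]|x /ABK[ax|bx]].
- apply: filterS2 (sAP x ax) (nearA x ax) => y e ay; rewrite !sA'// /cA e.
  by rewrite invMg !mulgA.
- apply: filterS2 (sB'P x bx) (nearB x bx) => y e ay; rewrite !sB''// /cB e.
  by rewrite invMg !mulgA.
- by rewrite sA'//; exact: conj_neq1.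
- by rewrite sB''//; exact: conj_neq1.
Unshelve. all: by end_near. Qed.

End Projection.

End Unknot.

(** * Walls attached to the edges of a grid diagram *)

Section Walls.
Variables (R : realType) (G : finGroupType) (E : topologicalType).
Variables (n : nat) (lo hi : nat -> nat) (rho : nat -> G).
Variables (S Y H : E -> R).
Hypotheses (cS : continuous S) (cY : continuous Y) (cH : continuous H).

(** Seen in a plane with abscissa [S] and ordinate [Y], with depth [H], the wall
    number [i] hangs from an edge of the diagram: it consists of the points
    with abscissa [i] and ordinate between [lo i] and [hi i] that lie behind the
    edge. *)
Definition wall (i : nat) (P : E) : bool :=
  [&& S P == i%:R, (lo i)%:R <= Y P, Y P <= (hi i)%:R & 0 <= H P].

(** The transport from [Q] to [P] when [P] is on a wall: it is [rho i] if [Q] is on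
    the left of the wall. Attaching a wall to the points on its right makes the
    rule unambiguous. *)
Definition cross_walls (P Q : E) : G :=
  if [pick i : 'I_n | wall i P] is Some i then
    if S Q < i%:R then rho i else 1%g
  else 1%g.

Lemma wall_inj i j P : wall i P -> wall j P -> i = j.
Proof.
by move=> /and4P[/eqP + _ _ _] /and4P[/eqP + _ _ _] => -> /eqP; rewrite eqr_nat => /eqP.
Qed.

Lemma cross_wallsE i P Q : (i < n)%N -> wall i P ->
  cross_walls P Q = if S Q < i%:R then rho i else 1%g.
Proof.
move=> ilt wi; rewrite /cross_walls; case: pickP => [j wj|/(_ (Ordinal ilt))].
  by rewrite (wall_inj wj wi).
by rewrite wi.
Qed.

Lemma cross_walls1 P Q : (forall i, (i < n)%N -> ~~ wall i P) ->
  cross_walls P Q = 1%g.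
Proof. by move=> nw; rewrite /cross_walls; case: pickP => // i; rewrite (negPf (nw i _)). Qed.

Lemma near_lt (f g : E -> R) P : continuous f -> continuous g -> f P < g P ->
  \forall Q \near P, f Q < g Q.
Proof.
move=> cf cg fg; pose m := (f P + g P) / 2.
have fm : f P < m by rewrite /m; lra.
have mg : m < g P by rewrite /m; lra.
have h1 : \forall Q \near P, f Q < m by exact: (cf P) (lt_nbhsl fm).
have h2 : \forall Q \near P, m < g Q by exact: (cg P) (lt_nbhsr mg).
by near=> Q; apply: (@lt_trans _ _ m); near: Q.
Unshelve. all: by end_near. Qed.

Lemma near_not_wall i P : ~~ wall i P -> \forall Q \near P, ~~ wall i Q.
Proof.
have cst (r : R) : continuous (fun _ : E => r) by move=> Q; exact: cvg_cst.
rewrite /wall !negb_and -!ltNge => /or4P[|h|h|h].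
- rewrite neq_lt => /orP[h|h]; [have := near_lt cS (cst _) h|have := near_lt (cst _) cS h].
    by apply: filterS => Q hQ; rewrite /wall lt_eqF.
  by apply: filterS => Q hQ; rewrite /wall gt_eqF.
- by apply: filterS (near_lt cY (cst _) h) => Q hQ; rewrite /wall leNgt hQ andbF.
- by apply: filterS (near_lt (cst _) cY h) => Q hQ; rewrite /wall [Y Q <= _]leNgt hQ !andbF.
- by apply: filterS (near_lt cH (cst _) h) => Q hQ; rewrite /wall [_ <= H Q]leNgt hQ !andbF.
Qed.

(** A point on a wall but not on its boundary; the boundary of a wall will be
    part of the knot. *)
Definition regular (P : E) := forall i, (i < n)%N -> wall i P ->
  [/\ (lo i)%:R < Y P, Y P < (hi i)%:R & 0 < H P].

Lemma near_wall P : regular P -> \forall Q \near P, forall k : 'I_n,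
  wall k Q = wall k P && (S Q == k%:R).
Proof.
have cst (r : R) : continuous (fun _ : E => r) by move=> Q; exact: cvg_cst.
move=> rP; apply: (@filter_forall _ _ (fun (k : 'I_n) Q =>
  wall k Q = wall k P && (S Q == k%:R)) (nbhs P)) => k.
have [wk|nwk] := boolP (wall k P); last first.
  by apply: filterS (near_not_wall nwk) => Q /negPf.
have [h1 h2 h3] := rP k (ltn_ord k) wk.
have n1 := near_lt (cst _) cY h1; have n2 := near_lt cY (cst _) h2.
have n3 := near_lt (cst _) cH h3.
near=> Q; rewrite /wall /=.
have -> /= : (lo k)%:R <= Y Q by apply/ltW; near: Q.
have -> /= : Y Q <= (hi k)%:R by apply/ltW; near: Q.
have -> /= : 0 <= H Q by apply/ltW; near: Q.
by rewrite andbT.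
Unshelve. all: by end_near. Qed.

Lemma cross_walls_cocycle P : regular P ->
  \forall Q \near P, \forall Z \near Q,
    cross_walls P Z = (cross_walls P Q * cross_walls Q Z)%g.
Proof.
have cst (r : R) : continuous (fun _ : E => r) by move=> Q; exact: cvg_cst.
move=> rP; have nw := near_wall rP.
have [/existsP[i wi]|/existsPn nwP] := boolP [exists i : 'I_n, wall i P]; last first.
  apply: filterS nw => Q nwQ; near=> Z.
  have n1 i : (i < n)%N -> ~~ wall i P by move=> ilt; exact: (nwP (Ordinal ilt)).
  have n2 i : (i < n)%N -> ~~ wall i Q.
    by move=> ilt; rewrite (nwQ (Ordinal ilt)) (negPf (n1 i ilt)).
  by rewrite (cross_walls1 Z n1) (cross_walls1 Q n1) (cross_walls1 Z n2) mulg1.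
apply: filterS nw => Q nwQ.
have [h|h|h] := ltgtP (S Q) i%:R.
- have nZ := near_lt cS (cst _) h; near=> Z.
  rewrite !(cross_wallsE _ (ltn_ord i) wi) h cross_walls1 ?mulg1.
    by rewrite (_ : S Z < i%:R)//; near: Z.
  move=> k klt; rewrite (nwQ (Ordinal klt)); apply/negP => /andP[wk /eqP e].
  by move: h; rewrite e (wall_inj wi wk) ltxx.
- have nZ := near_lt (cst _) cS h; near=> Z.
  have sZ : (S Z < i%:R) = false by apply/negbTE; rewrite -leNgt ltW//; near: Z.
  have sQ : (S Q < i%:R) = false by apply/negbTE; rewrite -leNgt ltW.
  rewrite !(cross_wallsE _ (ltn_ord i) wi) sQ sZ cross_walls1 ?mulg1//.
  move=> k klt; rewrite (nwQ (Ordinal klt)); apply/negP => /andP[wk /eqP e].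
  by move: h; rewrite e (wall_inj wi wk) ltxx.
- near=> Z; have wQ : wall i Q by rewrite nwQ wi h eqxx.
  by rewrite !(cross_wallsE _ (ltn_ord i))// h ltxx mul1g.
Unshelve. all: by end_near. Qed.

(** The number of grid lines among [0, ..., n - 1] that are at most [t], which
    numbers the strip of the grid that contains [t]. *)
Definition lines_le (t : R) : nat :=
  if 0 <= t then minn n (Num.truncn t).+1 else 0%N.

Lemma lines_leP i t : (i < n)%N -> (i < lines_le t)%N = (i%:R <= t).
Proof.
move=> ilt; rewrite /lines_le; case: ifPn => [t0|].
  by rewrite ltn_min ilt ltnS Num.Theory.truncn_ge_nat.
by rewrite -ltNge => t0; rewrite leNgt (lt_le_trans t0).
Qed.

Lemma lines_le_max t : (lines_le t <= n)%N.
Proof. by rewrite /lines_le; case: ifP => // _; exact: geq_minl. Qed.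

Lemma lines_le_eq m t : (m <= n)%N -> (forall i, (i < n)%N -> (i < m)%N = (i%:R <= t)) ->
  lines_le t = m.
Proof.
move=> mn h; apply/eqP; rewrite eqn_leq; apply/andP; split; rewrite leqNgt; apply/negP => lt.
  have mn' : (m < n)%N by exact: leq_trans (lines_le_max t).
  by have := h m mn'; rewrite ltnn -lines_leP// lt.
have ln : (lines_le t < n)%N by exact: leq_trans mn.
by have := h _ ln; rewrite lt -lines_leP// ltnn.
Qed.

(** From [P] to a point close to it, at most one line is crossed, and only
    downwards from a line that contains [P]. *)
Lemma near_lines_le P : \forall Q \near P,
  (lines_le (S Q) = lines_le (S P) /\
     forall i, (i < n)%N -> S P = i%:R -> i%:R <= S Q) \/
  exists i, [/\ (i < n)%N, S P = i%:R, S Q < i%:R & 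
     lines_le (S Q) = i /\ lines_le (S P) = i.+1].
Proof.
have cst (r : R) : continuous (fun _ : E => r) by move=> Q; exact: cvg_cst.
have : \forall Q \near P, forall i : 'I_n,
    (S P < i%:R -> S Q < i%:R) /\ (i%:R < S P -> i%:R < S Q).
  apply: (@filter_forall _ _ (fun (i : 'I_n) Q =>
    (S P < i%:R -> S Q < i%:R) /\ (i%:R < S P -> i%:R < S Q)) (nbhs P)) => i.
  have [h|h|h] := ltgtP (S P) i%:R.
  - by apply: filterS (near_lt cS (cst _) h) => Q hQ; split.
  - by apply: filterS (near_lt (cst _) cS h) => Q hQ; split.
  - by near=> Q; split.
apply: filterS => Q hQ.
have [[i [ilt iE iQ]]|nex] := pselect (exists i, [/\ (i < n)%N, S P = i%:R & S Q < i%:R]).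
  right; exists i; split=> //; split; last first.
    by apply: lines_le_eq => // k klt; rewrite iE ler_nat ltnS.
  apply: lines_le_eq => [|k klt]; first exact: ltnW.
    have [h1 h2] := hQ (Ordinal klt); rewrite /= iE !ltr_nat in h1 h2.
    have [ki|ik|->] := ltngtP k i; last by rewrite leNgt iQ.
      by rewrite ltW// h2.
    by rewrite leNgt h1.
left; split=> [|i ilt iE]; last first.
  by rewrite leNgt; apply/negP => iQ; apply: nex; exists i.
apply: lines_le_eq => [|k klt]; first exact: lines_le_max.
rewrite lines_leP//; have [h1 h2] := hQ (Ordinal klt); rewrite /= in h1 h2.
have [h|h|h] := ltgtP (S P) k%:R.
- by rewrite leNgt h1.
- by rewrite ltW// h2.
- by apply/esym; rewrite leNgt; apply/negP => kQ; apply: nex; exists k.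
Unshelve. all: by end_near. Qed.

End Walls.

(** * A local system on the complement of a grid diagram *)

Section Cover.
Variables (R : realType) (E : topologicalType) (n : nat) (lo hi : nat -> nat).
Variables (S Y H : E -> R).

Lemma wall_lines i P : (i < n)%N -> (lo i < n)%N -> (hi i < n)%N ->
  regular n lo hi S Y H P -> S P = i%:R -> 0 <= H P ->
  wall lo hi S Y H i P = (lo i < lines_le n (Y P) <= hi i)%N.
Proof.
move=> ilt lon hin rP SP HP; rewrite lines_leP// [in RHS]leqNgt lines_leP// -ltNge.
apply/idP/idP => [wi|/andP[h1 h2]].
  by have [h1 h2 _] := rP i ilt wi; rewrite h2 andbT ltW.
by rewrite /wall SP eqxx h1 (ltW h2).
Qed.

Lemma wall_line i j P : (i < n)%N -> (lo i < n)%N -> (hi i < n)%N ->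
  regular n lo hi S Y H P -> S P = i%:R -> 0 <= H P -> Y P = j%:R ->
  wall lo hi S Y H i P = (lo i < j <= hi i)%N.
Proof.
move=> ilt lon hin rP SP HP YP; apply/idP/idP => [wi|/andP[h1 h2]].
  by have [+ + _] := rP i ilt wi; rewrite YP !ltr_nat => -> /ltnW.
by rewrite /wall SP YP eqxx !ler_nat (ltnW h1) h2.
Qed.

End Cover.

Section Grid.
Variables (R : realType) (G : finGroupType) (n : nat).
Variables (lo hi a b : nat -> nat) (rho r : nat -> G).
Variable K : set (space3 R).

Definition abs (P : space3 R) : R := P.1.1.
Definition ord (P : space3 R) : R := P.1.2.
Definition height (P : space3 R) : R := P.2.
Definition depth (P : space3 R) : R := 1 - P.2.

Lemma continuous_abs : continuous abs.
Proof.
move=> P; have c1 : Q.1 @[Q --> P] --> P.1 by exact: cvg_fst.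
exact: cvg_comp c1 cvg_fst.
Qed.

Lemma continuous_ord : continuous ord.
Proof.
move=> P; have c1 : Q.1 @[Q --> P] --> P.1 by exact: cvg_fst.
exact: cvg_comp c1 cvg_snd.
Qed.

Lemma continuous_height : continuous height.
Proof. by move=> P; exact: cvg_snd. Qed.

Lemma continuous_depth : continuous depth.
Proof. by move=> P; apply: cvgB; [exact: cvg_cst|exact: cvg_snd]. Qed.

(** The cell between the grid lines [m - 1] and [m] in one direction, and [l - 1]
    and [l] in the other one, carries the product of the transformations of the
    columns on its left that cross its row: the walls met on the way to it from
    the far left, between the heights of the rows and of the columns. *)
Fixpoint region (m l : nat) : G :=
  if m is m'.+1 then ((if (lo m' < l <= hi m')%N then rho m' else 1) * region m' l)%g
  else 1%g.

Hypothesis bounds : forall i, (i < n)%N ->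
  [/\ (lo i < n)%N, (hi i < n)%N, (a i < n)%N & (b i < n)%N].
Hypothesis closedK : closed K.
Hypothesis column_regular : forall P, ~ K P -> 0 < P.2 ->
  regular n lo hi abs ord depth P.
Hypothesis row_regular : forall P, ~ K P -> P.2 < 1 ->
  regular n a b ord abs height P.
Hypothesis region_row : forall j m, (j < n)%N -> (m <= n)%N ->
  region m j = (region m j.+1 * (if (a j < m <= b j)%N then r j else 1))%g.

Definition cross_columns := cross_walls n lo hi rho abs ord depth.
Definition cross_rows := cross_walls n a b r ord abs height.
Definition transition (P : space3 R) : G :=
  region (lines_le n (abs P)) (lines_le n (ord P)).

(** In the layer between the horizontal and the vertical edges, two local systems
    are available: the one with walls below the columns and the one with walls
    above the rows. The products of the regions compare them; this is
    [region_row] when a horizontal grid line is crossed and the definition of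
    [region] when a vertical one is. *)
Lemma exchange P : ~ K P -> 0 < P.2 < 1 ->
  \forall Q \near P,
    (cross_columns P Q * transition Q = transition P * cross_rows P Q)%g.
Proof.
move=> nK /andP[z0 z1].
have rc := column_regular nK z0; have rr := row_regular nK z1.
have d0 : 0 <= depth P by rewrite /depth subr_ge0 ltW.
have h0 : 0 <= height P by rewrite /height ltW.
have na := near_lines_le n continuous_abs P.
have no := near_lines_le n continuous_ord P.
apply: filterS2 na no => Q ha ho; rewrite /transition.
transitivity (region (lines_le n (abs P)) (lines_le n (ord Q))).
  case: ha => [[-> nl]|[i [ilt iE iQ [-> ->]]]].
    rewrite /cross_columns; have [/existsP[i wi]|/existsPn nw] :=
        boolP [exists i : 'I_n, wall lo hi abs ord depth i P]; last first.
      by rewrite cross_walls1 ?mul1g// => i ilt; exact: (nw (Ordinal ilt)).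
    have iE : abs P = i%:R by case/and4P : wi => /eqP.
    by rewrite (cross_wallsE _ _ (ltn_ord i) wi) ltNge nl// mul1g.
  rewrite /cross_columns /=; have [lon hin _ _] := bounds ilt.
  have -> : (lo i < lines_le n (ord Q) <= hi i)%N = wall lo hi abs ord depth i P.
    case: ho => [[-> _]|[j [jlt jE _ [-> _]]]]; first by rewrite (wall_lines ilt).
    by rewrite (wall_line ilt _ _ rc iE d0 jE).
  case: ifPn => [wi|nwi]; first by rewrite (cross_wallsE _ _ ilt wi) iQ.
  rewrite cross_walls1// => k klt; apply/negP => wk.
  have kE : abs P = k%:R by case/and4P : wk => /eqP.
  by move: kE nwi; rewrite iE => /eqP; rewrite eqr_nat => /eqP ->; rewrite wk.
case: ho => [[-> nl]|[j [jlt jE jQ [-> ->]]]].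
  rewrite /cross_rows; have [/existsP[i wi]|/existsPn nw] :=
      boolP [exists i : 'I_n, wall a b ord abs height i P]; last first.
    by rewrite cross_walls1 ?mulg1// => i ilt; exact: (nw (Ordinal ilt)).
  have iE : ord P = i%:R by case/and4P : wi => /eqP.
  by rewrite (cross_wallsE _ _ (ltn_ord i) wi) ltNge nl// mulg1.
rewrite (region_row jlt (lines_le_max n _)); congr (_ * _)%g.
have [_ _ aj bj] := bounds jlt.
rewrite -(wall_lines jlt aj bj rr jE h0) /cross_rows.
case: ifPn => [wj|nwj]; first by rewrite (cross_wallsE _ _ jlt wj) jQ.
rewrite cross_walls1// => k klt; apply/negP => wk.
have kE : ord P = k%:R by case/and4P : wk => /eqP.
by move: kE nwj; rewrite jE => /eqP; rewrite eqr_nat => /eqP ->; rewrite wk.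
Qed.

(** The upper half space uses the walls below the columns, and the lower one the
    walls above the rows; the regions glue them at height [1 / 2]. *)
Definition grid_transport (P Q : space3 R) : G :=
  if 2^-1 <= P.2 then
    (cross_columns P Q * (if (Q.2 < 2^-1)%R then transition Q else 1))%g
  else cross_rows P Q.

Lemma grid_local_system : local_system (~` K) grid_transport.
Proof.
move=> P nK.
have cst (t : R) : continuous (fun _ : space3 R => t) by move=> Q; exact: cvg_cst.
have half : 0 < (2^-1 : R) < 1 by rewrite invr_gt0 ltr0n/= invf_lt1// ltr1n.
have [half0 half1] := andP half.
have [zP|zP] := ltP P.2 2^-1.
  have h1 := near_lt continuous_height (cst _) zP.
  have h2 := cross_walls_cocycle r continuous_ord continuous_abs continuous_height
    (row_regular nK (lt_trans zP half1)).
  near=> Q; have zQ : height Q < 2^-1 by near: Q.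
  have cQ : \forall Z \near Q, cross_rows P Z = (cross_rows P Q * cross_rows Q Z)%g.
    by near: Q.
  by apply: filterS cQ => Z; rewrite /grid_transport !leNgt zP zQ.
have P0 : 0 < P.2 by exact: lt_le_trans half0 zP.
have h2 := cross_walls_cocycle rho continuous_abs continuous_ord continuous_depth
  (column_regular nK P0).
have h3 : \forall Q \near P, ~ K Q.
  by apply: open_nbhs_nbhs; split=> //; exact: closed_openC.
have h4 := near_lt (cst _) continuous_height P0.
near=> Q; have nKQ : ~ K Q by near: Q.
have Q0 : 0 < height Q by near: Q.
have cQ : \forall Z \near Q,
    cross_columns P Z = (cross_columns P Q * cross_columns Q Z)%g by near: Q.
rewrite /grid_transport zP; have [zQ|zQ] := ltP Q.2 2^-1; last first.
  by apply: filterS cQ => Z ->; rewrite mulg1 mulgA.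
have ex := exchange nKQ (introT andP (conj Q0 (lt_trans zQ half1))).
have h5 := near_lt continuous_height (cst _) zQ.
near=> Z; have -> : Z.2 < 2^-1 by near: Z.
have -> : cross_columns P Z = (cross_columns P Q * cross_columns Q Z)%g by near: Z.
rewrite -!mulgA; congr (_ * _)%g.
by near: Z.
Unshelve. all: by end_near. Qed.

Hypothesis off_grid : forall P, K P -> P.2 <= 1 /\
  ((exists i : nat, P.1.1 = i%:R) /\ P.2 = 1 \/ exists j : nat, P.1.2 = j%:R).

Section Rigid.
Variables (S : Type) (s : space3 R -> S).
Hypothesis rigid : forall x, ~ K x -> \forall y \near x,
  grid_transport x y = 1%g -> s x = s y.

(** Away from the walls, in the upper half space, the transport is [1]. *)
Lemma constant_along (P Q : space3 R) :
  (forall t, t \in `[0, 1] -> let Z := P + t *: (Q - P) in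
     [/\ ~ K Z, 2^-1 < Z.2 & forall i, (i < n)%N -> ~~ wall lo hi abs ord depth i Z]) ->
  s P = s Q.
Proof.
move=> h; have := @locally_constant_interval R S (fun t => s (P + t *: (Q - P))).
move=> /(_ _ 0); rewrite scale0r addr0 scale1r subrKC; apply; last first.
  by rewrite in_itv/= lexx ler01.
move=> t t01; have [nK zZ nw] := h t t01; set Z := P + _ in nK zZ nw.
have ct : (fun u : R => P + u *: (Q - P)) @ t --> Z.
  apply: (@cvgD _ (space3 R) _ _ _ (fun=> P) (fun u => u *: (Q - P))).
    exact: cvg_cst.
  by apply: (@cvgZr_tmp R (space3 R)); exact: cvg_id.
have n1 := rigid nK.
have n2 : \forall y \near Z, 2^-1 < height y.
  by apply: near_lt => //; [move=> y; exact: cvg_cst|exact: continuous_height].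
have n3 : \forall y \near Z, s y = s Z.
  apply: filterS2 n1 n2 => y h1 h2; rewrite h1// /grid_transport (ltW zZ).
  by rewrite ltNge (ltW h2) mulg1 /cross_columns cross_walls1.
have n4 : \forall u \near t, s (P + u *: (Q - P)) = s Z by exact: ct n3.
by apply: filterS n4 => u + _.
Qed.

Lemma half_not_nat (i j : nat) : i%:R + 2^-1 = j%:R :> R -> False.
Proof.
move=> e; have [ij|ij] := leqP j i.
  have : j%:R <= i%:R :> R by rewrite ler_nat.
  by lra.
have : i.+1%:R <= j%:R :> R by rewrite ler_nat.
by rewrite -natr1; lra.
Qed.

Definition top : space3 R := (0, 0, 2).

(** On both sides of the wall below an edge, one can go up to the level above the
    polygon without meeting a wall. *)
Lemma near_column (k : nat) (d : R) : `|d| < 2^-1 -> d != 0 -> 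
  s (k%:R + d, (lo k)%:R + 2^-1, 3 / 4) = s top.
Proof.
move=> d2 d0.
have nint (i j : nat) : i%:R + d = j%:R :> R -> False.
  have /ltr_normlP[d3 d4] := d2; move=> e.
  have [ij|ij|ij] := ltngtP i j.
  - have : i.+1%:R <= j%:R :> R by rewrite ler_nat.
    by rewrite -natr1; lra.
  - have : j.+1%:R <= i%:R :> R by rewrite ler_nat.
    by rewrite -natr1; lra.
  - by move/eqP: d0; apply; move: e; rewrite ij; lra.
transitivity (s (k%:R + d, (lo k)%:R + 2^-1, 2)); apply: constant_along => t.
  rewrite in_itv/= => /andP[t0 t1]; set Z := _ + _.
  have Z11 : Z.1.1 = k%:R + d.
    by rewrite /Z /= subrr /GRing.scale/= mulr0 addr0.
  have Z12 : Z.1.2 = (lo k)%:R + 2^-1.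
    by rewrite /Z /= subrr /GRing.scale/= mulr0 addr0.
  split.
  - move=> /off_grid[_ [[[i e] _]|[j e]]].
      by apply: (nint k i); rewrite -e Z11.
    by apply: (@half_not_nat (lo k) j); rewrite -e Z12.
  - rewrite /Z /= /GRing.scale/=; lra.
  - move=> i _; apply/negP => /and4P[/eqP e _ _ _].
    by apply: (nint k i); rewrite -e /abs Z11.
rewrite in_itv/= => /andP[t0 t1]; set Z := _ + _.
have Z2 : Z.2 = 2 by rewrite /Z /= subrr /GRing.scale/= mulr0 addr0.
split.
- by move=> /off_grid[+ _]; rewrite Z2; lra.
- by rewrite -[ltRHS]/(Z.2) Z2; lra.
- by move=> i _; apply/negP => /and4P[_ _ _]; rewrite /depth Z2; lra.
Qed.

(** A loop that passes under the edge number [k] and returns above the polygon: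
    [x] is a point of the wall, and [s] has the same value on both sides. *)
Lemma through_column k : (k < n)%N -> (lo k < hi k)%N ->
  exists x, [/\ ~ K x,
    (forall P, nbhs x P -> exists y, [/\ P y, grid_transport x y = 1%g & s y = s top]) &
    (forall P, nbhs x P -> exists y, [/\ P y, grid_transport x y = rho k & s y = s top])].
Proof.
move=> klt lohi; pose x : space3 R := (k%:R, (lo k)%:R + 2^-1, 3 / 4).
have wk : wall lo hi abs ord depth k x.
  have : (lo k).+1%:R <= (hi k)%:R :> R by rewrite ler_nat.
  rewrite -natr1 /wall /abs /ord /depth/= eqxx => h.
  by apply/and3P; split; lra.
have half34 : (2^-1 : R) <= 3 / 4 by lra.
have cx : (fun d : R => (k%:R + d, (lo k)%:R + 2^-1, 3 / 4) : space3 R) @ (0 : R) --> x.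
  apply: pair_cvg; last exact: cvg_cst.
  apply: pair_cvg; last exact: cvg_cst.
  rewrite -[X in _ --> X]addr0; apply: cvgD; [exact: cvg_cst|exact: cvg_id].
have small P : nbhs x P -> exists2 e : R, 0 < e < 2^-1 &
    P (k%:R + e, (lo k)%:R + 2^-1, 3 / 4) /\ P (k%:R - e, (lo k)%:R + 2^-1, 3 / 4).
  move=> /cx[e /= e0 he]; exists (Num.min e 2^-1 / 2).
    by rewrite divr_gt0 ?lt_min ?e0//= ltr_pdivrMr// gt_min; apply/orP; right; lra.
  have m0 : 0 < Num.min e 2^-1 by rewrite lt_min e0/=; lra.
  have me : Num.min e 2^-1 <= e by rewrite ge_min lexx.
  by split; apply: he; rewrite /= sub0r ?opprK ?normrN gtr0_norm ?divr_gt0//; lra.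
exists x; split.
- move=> /off_grid[_ [[_]|[j]]]; first by rewrite /=; lra.
  exact: half_not_nat.
- move=> P /small[e /andP[e0 e2] [Pe _]].
  exists (k%:R + e, (lo k)%:R + 2^-1, 3 / 4); split=> //.
    rewrite /grid_transport /= half34 ltNge half34 mulg1 /cross_columns.
    by rewrite (cross_wallsE _ _ klt wk) /abs/= ltNge lerDl ltW.
  by apply: near_column; rewrite ?gtr0_norm// gt_eqF.
- move=> P /small[e /andP[e0 e2] [_ Pe]].
  exists (k%:R - e, (lo k)%:R + 2^-1, 3 / 4); split=> //.
    rewrite /grid_transport /= half34 ltNge half34 mulg1 /cross_columns.
    by rewrite (cross_wallsE _ _ klt wk) /abs/= gtrBl e0.
  by apply: near_column; rewrite ?normrN ?gtr0_norm// oppr_eq0 gt_eqF.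
Qed.

End Rigid.

(** A flat section would give [rho k = 1] along a loop around the edge [k]. A flat
    section of conjugates commutes with every [rho k], hence it is [1]. *)
Lemma grid_not_cyclic : (exists2 k, (k < n)%N & (lo k < hi k)%N && (rho k != 1%g)) ->
  (forall c, (forall k, (k < n)%N -> (lo k < hi k)%N -> (c * rho k = rho k * c)%g) ->
     c = 1%g) ->
  ~ cyclic_monodromy K.
Proof.
move=> [k klt /andP[lhk rk]] cent /(_ G _ grid_local_system)[[s sP]|[s sP s1]].
  have [|x [nK h1 h2]] := @through_column G s _ k klt lhk.
    by move=> x /sP; apply: filterS => y -> ->; rewrite mul1g.
  have [y [e1 t1 st1]] := h1 _ (sP x nK); have [z [e2 t2 st2]] := h2 _ (sP x nK).
  move/eqP: rk; apply; apply: (mulIg (s (top))).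
  by rewrite mul1g -{1}st2 -t2 -e2 e1 t1 mul1g st1.
have rig x : ~ K x -> \forall y \near x, grid_transport x y = 1%g -> s x = s y.
  by move=> /sP; apply: filterS => y -> ->; rewrite mul1g invg1 mulg1.
have tK : ~ K top by move=> /off_grid[+ _]; rewrite /=; lra.
apply: (s1 _ tK); apply: cent => i ilt lhi.
have [x [nK h1 h2]] := through_column rig ilt lhi.
have [y [e1 t1 st1]] := h1 _ (sP x nK); have [z [e2 t2 st2]] := h2 _ (sP x nK).
apply: (mulIg (rho i)^-1%g); rewrite mulgK.
by rewrite -{2}st2 -t2 -e2 e1 t1 mul1g invg1 mulg1 st1.
Qed.

End Grid.

(** * Dihedral colourings of grid diagrams *)

Section Dihedral.
Variable p : nat.
Hypotheses (p1 : (1 < p)%N) (podd : odd p).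

(** The pair [(e, c)] stands for the affine map [x |-> (-1) ^ e x + c] modulo [p],
    with natural numbers in place of residues so that the products are cheap to
    compute. *)
Definition dihedral : Type := (bool * nat)%type.
Definition code_mul (u v : dihedral) : dihedral :=
  (u.1 (+) v.1, ((if v.1 then p - u.2 %% p else u.2) + v.2) %% p)%N.

Definition affine (u : dihedral) (x : 'Z_p) : 'Z_p := (-1) ^+ u.1 * x + u.2%:R.

Lemma affine_inj u : injective (affine u).
Proof. by move=> x y /addIr /(can_inj (signrMK u.1)). Qed.

Definition decode (u : dihedral) : {perm 'Z_p} := perm (@affine_inj u).

Lemma decodeE u x : decode u x = (-1) ^+ u.1 * x + u.2%:R.
Proof. by rewrite permE. Qed.

Lemma natr_Zp_mod k : (k %% p)%N%:R = k%:R :> 'Z_p.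
Proof. by rewrite -[LHS]natr_Zp -[RHS]natr_Zp !val_Zp_nat// modn_mod. Qed.

Lemma decodeM u v : decode (code_mul u v) = (decode u * decode v)%g.
Proof.
apply/permP => x; rewrite permM !decodeE /= natr_Zp_mod natrD.
have -> : (if v.1 then p - u.2 %% p else u.2)%N%:R = (-1) ^+ v.1 * u.2%:R :> 'Z_p.
  case: v.1; last by rewrite mul1r.
  rewrite natrB ?(ltnW (ltn_pmod _ _))//; last exact: ltnW.
  by rewrite natr_Zp_mod pchar_Zp// sub0r mulN1r.
by rewrite signr_addb; ring.
Qed.

Lemma decode1 : decode (false, 0%N) = 1%g.
Proof. by apply/permP => x; rewrite perm1 decodeE mul1r addr0. Qed.

Definition reflection (k : nat) : dihedral := (true, k.*2).

Lemma reflectionE k x : decode (reflection k) x = k%:R *+ 2 - x.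
Proof. by rewrite decodeE /= mulN1r addrC -mul2n mulnC mulrnA. Qed.

Lemma doubleK (x : 'Z_p) : x *+ 2 *+ (p.+1)./2 = x.
Proof.
rewrite -mulrnA mulnC muln2 even_halfK; last by rewrite /= podd.
by rewrite -mulr_natr -natr1 pchar_Zp// add0r mulr1.
Qed.

Lemma two_unit (x : 'Z_p) : exists y, x = y *+ 2.
Proof. by exists (x *+ (p.+1)./2); rewrite -mulrnA mulnC mulrnA doubleK. Qed.

Lemma reflection_fixed k x : decode (reflection k) x = x -> x = k%:R.
Proof.
rewrite reflectionE => /eqP; rewrite subr_eq -mulr2n => /eqP e.
by rewrite -[LHS]doubleK -e doubleK.
Qed.

(** A permutation that commutes with the reflection at [0] fixes its only fixed
    point [0]; the product of the reflections at [0] and [1] is the translation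
    by [2], whose powers carry [0] to all residues as [p] is odd. *)
Lemma reflections_centralizer (c : {perm 'Z_p}) :
  (c * decode (reflection 0) = decode (reflection 0) * c)%g ->
  (c * decode (reflection 1) = decode (reflection 1) * c)%g -> c = 1%g.
Proof.
move=> c0 c1; have fix_ k x : (c * decode (reflection k) = decode (reflection k) * c)%g ->
    c x = x -> c (decode (reflection k) x) = decode (reflection k) x.
  by move=> /permP/(_ x) + cx; rewrite !permM cx.
have f0 : c 0 = 0.
  apply: (@reflection_fixed 0); have /permP/(_ 0) := c0.
  by rewrite !permM => ->; rewrite reflectionE mul0rn subrr.
have step x : c x = x -> c (x + 2%:R) = x + 2%:R.
  move=> cx; have := fix_ 1%N _ c1 (fix_ 0%N _ c0 cx).
  by rewrite !reflectionE mul0rn sub0r opprK addrC.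
apply/permP => x; rewrite perm1; have [y ->] := two_unit x.
rewrite -(natr_Zp y) -mulrnA; elim: (nat_of_ord y) => [//|k IH].
by rewrite mulSn addnC mulrnDr; exact: step.
Qed.

End Dihedral.

Section GridCheck.

Definition grid_vertex (x y z : nat) : vec :=
  (10 * Z.of_nat x, 10 * Z.of_nat y, 10 * Z.of_nat z)%BZ.

Variable p : nat.
(* A column is given by the lower and the upper row of its edge and by the colour
   of this edge, a row by the left and the right column of its edge and by the
   transformation across the wall above this edge. *)
Variables (cols : seq (nat * nat * nat)) (rows : seq (nat * nat * dihedral)).

Definition col i := nth (0, 0, 0)%N cols i.
Definition row j := nth (0, 0, (false, 0))%N rows j.

Fixpoint region_code (m l : nat) : dihedral :=
  if m is m'.+1 then
    let rest := region_code m' l in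
    if (((col m').1.1 < l) && (l <= (col m').1.2))%N
    then code_mul p (reflection (col m').2) rest else rest
  else (false, 0%N).

Definition has_edge (es : seq (vec * vec)) (u v : vec) : bool :=
  ((u, v) \in es) || ((v, u) \in es).

Definition flat_edge (n : nat) (e : vec * vec) : bool :=
  let: (u, v) := e in
  [&& Z.leb u.2 10%BZ, Z.leb v.2 10%BZ &
    (Z.eqb u.1.1 v.1.1 && Z.eqb u.2 10%BZ && Z.eqb v.2 10%BZ &&
      has (fun i => Z.eqb u.1.1 (10 * Z.of_nat i)%BZ) (iota 0 n))
    || (Z.eqb u.1.2 v.1.2 &&
      has (fun i => Z.eqb u.1.2 (10 * Z.of_nat i)%BZ) (iota 0 n))].

(** The edges demanded from the polygon are those that bound the walls: the
    column edges at height [1], the row edges at height [0], and the posts that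
    connect them. Every edge has to satisfy [flat_edge], which keeps the polygon
    off the paths of [near_column]. The condition on the regions is the
    colouring rule: across a row edge all regions change by the same factor. *)
Definition grid_ok (g : seq vec) : bool :=
  let n := size cols in let es := zip g (rot 1 g) in
  [&& size rows == n,
    all (fun i => let: (lo, hi, _) := col i in
      [&& (lo < hi)%N, (hi < n)%N,
        has_edge es (grid_vertex i lo 1) (grid_vertex i hi 1),
        has_edge es (grid_vertex i lo 0) (grid_vertex i lo 1) &
        has_edge es (grid_vertex i hi 0) (grid_vertex i hi 1)]) (iota 0 n),
    all (fun j => let: (a, b, r) := row j in
      [&& (a < b)%N, (b < n)%N,
        has_edge es (grid_vertex a j 0) (grid_vertex b j 0),
        has_edge es (grid_vertex a j 0) (grid_vertex a j 1),
        has_edge es (grid_vertex b j 0) (grid_vertex b j 1) &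
        all (fun m => region_code m j ==
          if (a < m)%N && (m <= b)%N then code_mul p (region_code m j.+1) r
          else region_code m j.+1) (iota 0 n.+1)]) (iota 0 n),
    all (flat_edge n) es,
    has (fun i => (col i).2 == 0%N) (iota 0 n) &
    has (fun i => (col i).2 == 1%N) (iota 0 n)].

Variable R : realType.
Hypotheses (p1 : (1 < p)%N) (podd : odd p).

Lemma scaled k : 10%:R^-1 * real_of_Z R (10 * Z.of_nat k)%BZ = k%:R.
Proof.
rewrite real_of_ZM mulrA.
have -> : real_of_Z R 10%BZ = 10%:R by [].
rewrite mulVf ?pnatr_eq0// mul1r /real_of_Z.
have -> // : int_of_Z (Z.of_nat k) = k%:Z by lia.
Qed.

Lemma grid_vertexE x y z :
  @vertex R (grid_vertex x y z) = (x%:R, y%:R, z%:R).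
Proof. by rewrite /vertex /real_vec /= /GRing.scale/=; congr (_, _, _); exact: scaled. Qed.

Lemma loopP g P : @loop R g P <->
  exists2 e, e \in zip g (rot 1 g) & segment (vertex R e.1) (vertex R e.2) P.
Proof.
have -> : @loop R g =
    segments [seq (vertex R e.1, vertex R e.2) | e <- zip g (rot 1 g)].
  rewrite /loop -map_rot; congr segments.
  by elim: g (rot 1 g) => [|x s IH] [|y t]//=; rewrite IH.
by split=> [[_ /mapP[e eg ->] eP]|[e eg eP]]; [exists e|
  exists (vertex R e.1, vertex R e.2) => //; apply/mapP; exists e].
Qed.

Lemma has_edge_loop g u v P : has_edge (zip g (rot 1 g)) u v ->
  segment (vertex R u) (vertex R v) P -> @loop R g P.
Proof.
move=> /orP[] h; first by move=> hP; apply/loopP; exists (u, v).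
by rewrite segment_sym => hP; apply/loopP; exists (v, u).
Qed.

Lemma between (x y z : R) : x <= z <= y ->
  exists2 t, t \in `[0, 1] & x + t * (y - x) = z.
Proof.
move=> /andP[xz zy]; have [xy|xy] := eqVneq x y.
  by exists 0; rewrite ?in_itv/= ?lexx ?ler01// mul0r; lra.
have d0 : 0 < y - x by rewrite subr_gt0 lt_neqAle xy (le_trans xz).
exists ((z - x) / (y - x)); last by rewrite divfK ?gt_eqF//; ring.
rewrite in_itv/= ler_pdivrMr// mul1r lerD2r zy andbT.
by apply: divr_ge0; lra.
Qed.

Lemma closed_loop g : closed (@loop R g).
Proof. by apply: compact_closed; [exact: norm_hausdorff|exact: compact_segments]. Qed.

Section Checked.
Variable g : seq vec.
Hypothesis ok : grid_ok g.

Local Notation n := (size cols).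
Let lo i := (col i).1.1.
Let hi i := (col i).1.2.
Let left j := (row j).1.1.
Let right j := (row j).1.2.
Let rho i := decode p (reflection (col i).2).
Let r j := decode p (row j).2.

Let K := @loop R g.

Lemma column_edges i : (i < n)%N ->
  [/\ (lo i < hi i)%N, (hi i < n)%N,
    segment (i%:R, (lo i)%:R, 1) (i%:R, (hi i)%:R, 1) `<=` K,
    segment (i%:R, (lo i)%:R, 0) (i%:R, (lo i)%:R, 1) `<=` K &
    segment (i%:R, (hi i)%:R, 0) (i%:R, (hi i)%:R, 1) `<=` K].
Proof.
move=> ilt; have /and5P[_ /allP/(_ i) + _ _ _] := ok.
rewrite mem_iota /= => /(_ ilt); rewrite /lo /hi.
case: (col i) => [[l h] c] /and5P[lh hn e1 e2 e3]; split=> //= P sP.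
- by apply: has_edge_loop e1 _; rewrite !grid_vertexE.
- by apply: has_edge_loop e2 _; rewrite !grid_vertexE.
- by apply: has_edge_loop e3 _; rewrite !grid_vertexE.
Qed.

Lemma row_edges j : (j < n)%N ->
  [/\ (left j < right j)%N, (right j < n)%N,
    segment ((left j)%:R, j%:R, 0) ((right j)%:R, j%:R, 0) `<=` K,
    segment ((left j)%:R, j%:R, 0) ((left j)%:R, j%:R, 1) `<=` K &
    segment ((right j)%:R, j%:R, 0) ((right j)%:R, j%:R, 1) `<=` K].
Proof.
move=> jlt; have /and5P[_ _ /allP/(_ j) + _ _] := ok.
rewrite mem_iota /= => /(_ jlt); rewrite /left /right.
case: (row j) => [[l h] c] /and5P[lh hn e1 e2 /andP[e3 _]]; split=> //= P sP.
- by apply: has_edge_loop e1 _; rewrite !grid_vertexE.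
- by apply: has_edge_loop e2 _; rewrite !grid_vertexE.
- by apply: has_edge_loop e3 _; rewrite !grid_vertexE.
Qed.

Lemma region_codeE m l : decode p (region_code m l) = region lo hi rho m l.
Proof.
elim: m => [|m IH] /=; first exact: decode1.
by rewrite /lo /hi; case: ifP => _; rewrite ?decodeM// IH ?mul1g.
Qed.

Lemma region_rowE j m : (j < n)%N -> (m <= n)%N ->
  region lo hi rho m j =
  (region lo hi rho m j.+1 * (if (left j < m <= right j)%N then r j else 1))%g.
Proof.
move=> jlt mn; have /and5P[_ _ /allP/(_ j) + _ _] := ok.
rewrite mem_iota => /(_ jlt); rewrite /left /right /r.
case: (row j) => [[l h] c] /and5P[_ _ _ _ /andP[_ /allP/(_ m)]].
rewrite mem_iota ltnS => /(_ mn)/eqP e; rewrite -!region_codeE e.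
by case: ifP => _; rewrite ?decodeM// mulg1.
Qed.

Lemma columns_regular P : ~ K P -> 0 < P.2 ->
  regular n lo hi (@abs R) (@ord R) (@depth R) P.
Proof.
case: P => [[x y] z] nK z0 i ilt; rewrite /wall /abs /ord /depth/= in z0 *.
move=> /and4P[/eqP xi l h]; rewrite subr_ge0 => z1.
have [_ _ top post1 post2] := column_edges ilt; split.
- rewrite lt_neqAle l andbT; apply/eqP => e; apply: nK; apply: post1.
  by apply: (@in_segment R _ _ _ z); rewrite /= ?in_itv/= ?(ltW z0)// ?xi -?e; ring.
- rewrite lt_neqAle h andbT; apply/eqP => e; apply: nK; apply: post2.
  by apply: (@in_segment R _ _ _ z); rewrite /= ?in_itv/= ?(ltW z0)// ?xi ?e; ring.
- rewrite subr_gt0 lt_neqAle z1 andbT; apply/eqP => e; apply: nK; apply: top.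
  have [t t01 tE] := between (introT andP (conj l h)).
  by apply: (@in_segment R _ _ _ t) => //=; rewrite ?xi ?e ?tE//; ring.
Qed.

Lemma rows_regular P : ~ K P -> P.2 < 1 ->
  regular n left right (@ord R) (@abs R) (@height R) P.
Proof.
case: P => [[x y] z] nK z1 j jlt; rewrite /wall /abs /ord /height/= in z1 *.
move=> /and4P[/eqP yj l h] z0.
have [_ _ bottom post1 post2] := row_edges jlt; split.
- rewrite lt_neqAle l andbT; apply/eqP => e; apply: nK; apply: post1.
  by apply: (@in_segment R _ _ _ z); rewrite /= ?in_itv/= ?z0 ?(ltW z1)// ?yj -?e; ring.
- rewrite lt_neqAle h andbT; apply/eqP => e; apply: nK; apply: post2.
  by apply: (@in_segment R _ _ _ z); rewrite /= ?in_itv/= ?z0 ?(ltW z1)// ?yj ?e; ring.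
- rewrite lt_neqAle z0 andbT; apply/eqP => e; apply: nK; apply: bottom.
  have [t t01 tE] := between (introT andP (conj l h)).
  by apply: (@in_segment R _ _ _ t) => //=; rewrite ?yj -?e ?tE//; ring.
Qed.

Lemma flat_loop P : K P -> P.2 <= 1 /\
  ((exists i : nat, P.1.1 = i%:R) /\ P.2 = 1 \/ exists j : nat, P.1.2 = j%:R).
Proof.
move=> /loopP[[u v] ein [t t01 <-]]; move: t01; rewrite /= in_itv/= => /andP[t0 t1].
have /and5P[_ _ _ /allP/(_ _ ein)/and3P[u1 v1 uv] _] := ok.
have e0 := @inv10_gt0 R.
have c10 : 10%:R^-1 * real_of_Z R 10%BZ = 1 by exact: (scaled 1).
have le1 x : Z.leb x 10%BZ -> 10%:R^-1 * real_of_Z R x <= 1.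
  by rewrite -(real_of_Z_le R) -(ler_pM2l e0) c10.
have cst (x y : R) : x = y -> x + t * (y - x) = x by move=> ->; rewrite subrr mulr0 addr0.
have eqR x y : Z.eqb x y -> x = y by lia.
split.
  have := le1 _ u1; have := le1 _ v1; rewrite /vertex/= /GRing.scale/=.
  by move: (_ * real_of_Z R u.2) (_ * real_of_Z R v.2) => x y; nra.
move: uv => /orP[/andP[/andP[/andP[/eqR ex /eqR eu] /eqR ev] /hasP[i _ /eqR ei]]|].
  left; split; rewrite /vertex/= /GRing.scale/=.
    by exists i; rewrite ex cst// -ex ei scaled.
  by rewrite eu ev cst.
move=> /andP[/eqR ey /hasP[j _ /eqR ej]]; right; exists j.
by rewrite /vertex/= /GRing.scale/= ey cst// -ey ej scaled.
Qed.

Lemma checked_grid_not_cyclic : ~ cyclic_monodromy K.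
Proof.
have bounds i : (i < n)%N ->
    [/\ (lo i < n)%N, (hi i < n)%N, (left i < n)%N & (right i < n)%N].
  move=> ilt; have [lh hn _ _ _] := column_edges ilt.
  have [ab bn _ _ _] := row_edges ilt.
  by split=> //; [exact: ltn_trans hn|exact: ltn_trans bn].
have /and5P[_ _ _ _ /andP[/hasP[i]]] := ok.
rewrite mem_iota /= => ilt /eqP ci /hasP[k]; rewrite mem_iota /= => klt /eqP ck.
apply: (grid_not_cyclic bounds (@closed_loop g) columns_regular rows_regular
  region_rowE flat_loop).
  have [lh _ _ _ _] := column_edges klt; exists k => //; rewrite lh/=.
  apply/eqP => /permP/(_ 0); rewrite perm1 /rho ck reflectionE subr0 => h.
  have := doubleK p1 podd (1%R : 'Z_p); rewrite h mul0rn => /esym/eqP.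
  by rewrite oner_eq0.
move=> c cc; apply: (reflections_centralizer p1 podd).
  by have [lh _ _ _ _] := column_edges ilt; rewrite -ci; exact: cc.
by have [lh _ _ _ _] := column_edges klt; rewrite -ck; exact: cc.
Qed.

End Checked.

End GridCheck.

(** * Polygons with a single crossing of nine strands *)

Definition pvec : Type := (Z * Z)%type.
Definition psub (u v : pvec) : pvec := (u.1 - v.1, u.2 - v.2)%BZ.
Definition pdot (u v : pvec) : Z := (u.1 * v.1 + u.2 * v.2)%BZ.
Definition pdet (u v : pvec) : Z := (u.1 * v.2 - u.2 * v.1)%BZ.

Section PlanarCheck.
Variable w : seq pvec.

Definition corner (i : nat) : pvec := nth (0, 0)%BZ w i.
Definition edge_dir (i : nat) : pvec := psub (corner (i.+1 %% size w)) (corner i).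

Definition parted (u : pvec) (i j : nat) : bool :=
  let a := pdot u (corner i) in let b := pdot u (corner (i.+1 %% size w)) in
  let c := pdot u (corner j) in let d := pdot u (corner (j.+1 %% size w)) in
  Z.ltb (Z.max a b) (Z.min c d) || Z.ltb (Z.max c d) (Z.min a b).

Definition normal (u : pvec) : pvec := (- u.2, u.1)%BZ.

(** Two even edges, which are diameters, have to cross transversally; two
    consecutive edges must not be parallel; and any other two edges have to be
    separated by a linear form, for which the normals of the two edges are
    sufficient candidates. *)
Definition edges_ok (i j : nat) : bool :=
  if (i == j) || (j < i)%N then true else
  if ~~ odd i && ~~ odd j then ~~ Z.eqb (pdet (edge_dir i) (edge_dir j)) 0%BZ else
  if (j == i.+1) || (i == j.+1 %% size w)%N then
    ~~ Z.eqb (pdet (edge_dir i) (edge_dir j)) 0%BZ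
  else has (fun u => parted u i j)
    [:: (1, 0)%BZ; (0, 1)%BZ; normal (edge_dir i); normal (edge_dir j)].

(** The even edges pass through the origin, between their ends. *)
Definition edge_ok (i : nat) : bool :=
  ~~ Z.eqb (pdot (edge_dir i) (edge_dir i)) 0%BZ &&
  (odd i || Z.eqb (pdet (corner i) (edge_dir i)) 0%BZ &&
            Z.ltb (pdot (corner i) (corner (i.+1 %% size w))) 0%BZ).

Definition star_ok : bool :=
  [&& size w == 18, all edge_ok (iota 0 18) &
      all (fun i => all (edges_ok i) (iota 0 18)) (iota 0 18)].

End PlanarCheck.

(** The polygon with projection [w] whose edge number [2 k] is at height [h_k]; the
    odd edges connect the heights. *)
Definition star (w : seq pvec) (h : seq Z) : seq vec :=
  [seq (corner w i, nth 0%BZ h i./2) | i <- iota 0 (size w)].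

Section Star.
Variables (R : realType) (w : seq pvec) (h : seq Z).
Hypotheses (wok : star_ok w) (hsize : size h = 9%N) (huniq : uniq h).

Let p : seq (space3 R) := map (@vertex R) (star w h).

Let wsize : size w = 18%N. Proof. by have /and3P[/eqP] := wok. Qed.
Let psize : size p = 18%N. Proof. by rewrite !size_map size_iota. Qed.

Let e0 : 0 < (10%:R^-1 : R). Proof. exact: inv10_gt0. Qed.

Definition real_pvec (u : pvec) : plane R := (real_of_Z R u.1, real_of_Z R u.2).

Definition pdotR (u v : plane R) : R := u.1 * v.1 + u.2 * v.2.

Lemma det2_real u v : det2 (real_pvec u) (real_pvec v) = real_of_Z R (pdet u v).
Proof. by rewrite /det2/= -!real_of_ZM -real_of_ZB. Qed.

Lemma pdot_real u v : pdotR (real_pvec u) (real_pvec v) = real_of_Z R (pdot u v).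
Proof. by rewrite /pdotR/= -!real_of_ZM -real_of_ZD. Qed.

Lemma real_psub u v : real_pvec (psub u v) = real_pvec u - real_pvec v.
Proof. by rewrite /real_pvec/= !real_of_ZB. Qed.

Let pE i : (i < 18)%N -> nth 0 p i = @vertex R (corner w i, nth 0%BZ h i./2).
Proof.
move=> i18; have iw : (i < size (star w h))%N by rewrite size_map size_iota wsize.
rewrite /p (nth_map ((0, 0), 0)%BZ)//; congr vertex.
by rewrite (nth_map 0%N) ?size_iota ?wsize// nth_iota ?wsize.
Qed.

Let c i : plane R := 10%:R^-1 *: real_pvec (corner w i).
Let d i : plane R := 10%:R^-1 *: real_pvec (edge_dir w i).

Let nextE i : (i.+1 %% 18 < 18)%N. Proof. by rewrite ltn_mod. Qed.

Let dE i : d i = c (i.+1 %% 18)%N - c i.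
Proof. by rewrite /d /edge_dir real_psub scalerBr wsize. Qed.

Let projE i s : (i < 18)%N -> (polygon_point p (i, s)).1 = c i + s *: d i.
Proof.
move=> i18; rewrite /polygon_point /edge_vector psize /= !pE// dE.
by congr (_, _).
Qed.

Let edgeE i : (i < 18)%N -> (edge_vector p i).1 = d i.
Proof. by move=> i18; rewrite /edge_vector psize /= !pE// dE. Qed.

Let heightE i s : (i < 18)%N -> ~~ odd i ->
  (polygon_point p (i, s)).2 = 10%:R^-1 * real_of_Z R (nth 0%BZ h i./2).
Proof.
move=> i18 io; rewrite /polygon_point /edge_vector psize /= !pE//=.
have -> : ((i.+1 %% 18)./2 = i./2)%N.
  have i17 : (i.+1 < 18)%N.
    by rewrite ltn_neqAle i18 andbT; apply: contraNneq io => -[->].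
  by rewrite modn_small//= uphalf_half (negPf io).
by rewrite subrr scaler0 addr0.
Qed.

Let edgeP i : (i < 18)%N -> edge_ok w i.
Proof. by move=> i18; have /and3P[_ /allP + _] := wok; apply; rewrite mem_iota. Qed.

Let edgesP i j : (i < 18)%N -> (j < 18)%N -> edges_ok w i j.
Proof.
move=> i18 j18; have /and3P[_ _ /allP/(_ i)] := wok.
by rewrite mem_iota => /(_ i18)/allP/(_ j); rewrite mem_iota; apply.
Qed.

Let d_neq0 i : (i < 18)%N -> d i != 0.
Proof.
move=> i18; have /andP[+ _] := edgeP i18.
rewrite -(real_of_Z_eq0 R) -pdot_real; apply: contraNneq => /eqP.
rewrite /d scaler_eq0 gt_eqF//= => /eqP ->.
by rewrite /pdotR/= mul0r addr0.
Qed.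

Let det2_c u v : det2 (10%:R^-1 *: real_pvec u) (10%:R^-1 *: real_pvec v) =
  10%:R^-1 ^+ 2 * real_of_Z R (pdet u v).
Proof. by rewrite -det2_real /det2/= /GRing.scale/=; ring. Qed.

Let det2_neq0 i j : ~~ Z.eqb (pdet (edge_dir w i) (edge_dir w j)) 0%BZ ->
  det2 (d i) (d j) != 0.
Proof.
move=> h0; rewrite /d det2_c; apply: mulf_neq0.
  by rewrite expf_neq0// gt_eqF.
by rewrite real_of_Z_eq0.
Qed.

Let even_neq0 i j : (i < 18)%N -> (j < 18)%N -> ~~ odd i -> ~~ odd j -> i != j ->
  det2 (d i) (d j) != 0.
Proof.
wlog ij : i j / (i < j)%N => [H|] i18 j18 io jo nij.
  have [ij|ij] := ltnP i j; first exact: H.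
  rewrite det2C oppr_eq0; apply: H => //; last by rewrite eq_sym.
  by rewrite ltn_neqAle eq_sym nij.
have := edgesP i18 j18; rewrite /edges_ok (negPf nij)/= ltnNge (ltnW ij)/= io jo/=.
exact: det2_neq0.
Qed.

Let zero_param i : (i < 18)%N -> ~~ odd i -> exists2 s, 0 < s < 1 & c i = - s *: d i.
Proof.
move=> i18 io; have /andP[dd] := edgeP i18.
rewrite (negPf io)/= => /andP[dt0 dt1].
have cd0 : det2 (c i) (d i) = 0.
  by rewrite /c /d det2_c; move: dt0; rewrite -(real_of_Z_eq0 R) => /eqP ->; rewrite mulr0.
have cc0 : pdotR (c i) (c i + d i) < 0.
  rewrite dE addrC subrK /c.
  have -> u v : pdotR (10%:R^-1 *: real_pvec u) (10%:R^-1 *: real_pvec v) =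
      10%:R^-1 ^+ 2 * real_of_Z R (pdot u v).
    by rewrite -pdot_real /pdotR/= /GRing.scale/=; ring.
  by rewrite pmulr_rlt0 ?exprn_gt0// -[0]/(real_of_Z R 0%BZ) real_of_Z_lt -wsize.
have [|x cx] := det2_eq0_colinear (d_neq0 i18) (y := c i).
  by rewrite det2C cd0 oppr0.
exists (- x); last by rewrite opprK.
have cdE : x *: d i + d i = (x + 1) *: d i by rewrite scalerDl scale1r.
move: cc0; rewrite cx cdE.
have -> a b (u : plane R) : pdotR (a *: u) (b *: u) = a * b * pdotR u u.
  by rewrite /pdotR/= /GRing.scale/=; ring.
have dd0 : 0 <= pdotR (d i) (d i).
  by rewrite /pdotR -!expr2 addr_ge0// sqr_ge0.
move=> h1; have : x * (x + 1) < 0.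
  by rewrite ltNge; apply: contraTN h1 => h1; rewrite -leNgt mulr_ge0.
by move=> h2; apply/andP; split; nra.
Qed.

(** Points of the projection on two different edges coincide only at the origin,
    on two diameters. *)
Let coincide i j s t : (i < 18)%N -> (j < 18)%N -> i != j ->
  0 <= s < 1 -> 0 <= t < 1 -> c i + s *: d i = c j + t *: d j ->
  [/\ ~~ odd i, ~~ odd j & c i + s *: d i = 0].
Proof.
wlog ij : i j s t / (i < j)%N => [H|] i18 j18 nij s01 t01 e.
  have [ij|ij] := ltnP i j; first exact: (H i j s t).
  have ji : (j < i)%N by rewrite ltn_neqAle eq_sym nij.
  have nji : j != i by rewrite eq_sym.
  have [h1 h2 h3] := H j i t s ji j18 i18 nji t01 s01 (esym e).
  by split=> //; rewrite e.
have := edgesP i18 j18; rewrite /edges_ok [has]lock (negPf nij)/= ltnNge (ltnW ij)/=.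
have [/andP[io jo]|_] := boolP (~~ odd i && ~~ odd j).
  move=> h0; split=> //; have [s0 _ cs] := zero_param i18 io; have [t0 _ ct] := zero_param j18 jo.
  have := congr1 (fun z => det2 z (d j)) e; rewrite cs ct -!scalerDl.
  have dl a u v : det2 (a *: u) v = a * det2 u v :> R.
    by rewrite /det2/= /GRing.scale/=; ring.
  have dxx u : det2 u u = 0 :> R by rewrite /det2; ring.
  rewrite (dl _ (d i)) (dl _ (d j)) dxx mulr0 => /eqP; rewrite mulf_eq0 (negPf (det2_neq0 h0)) orbF.
  by move=> /eqP ->; rewrite scale0r.
have dl a u v : det2 (a *: u) v = a * det2 u v :> R.
  by rewrite /det2/= /GRing.scale/=; ring.
have dr a u v : det2 u (a *: v) = a * det2 u v :> R.
  by rewrite /det2/= /GRing.scale/=; ring.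
have dxx u : det2 u u = 0 :> R by rewrite /det2; ring.
have [/orP[/eqP ji|/eqP ji]|_] := boolP ((j == i.+1) || _).
- move=> h0; have cj : c j = c i + d i by rewrite dE ji modn_small -?ji// addrC subrK.
  have e' : (s - 1) *: d i = t *: d j.
    apply: (@addrI _ (c i + d i)); rewrite -{2}cj -e scalerBl scale1r.
    by rewrite -addrA (addrC (d i)) subrK.
  have := congr1 (fun z => det2 z (d j)) e'; rewrite (dl _ (d i)) (dl _ (d j)) dxx mulr0 => /eqP.
  rewrite mulf_eq0 (negPf (det2_neq0 h0)) orbF subr_eq0 => /eqP s1.
  by move: s01; rewrite s1 ltxx andbF.
- move=> h0; have ci : c i = c j + d j by rewrite dE -wsize -ji addrC subrK.
  have e' : (t - 1) *: d j = s *: d i.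
    apply: (@addrI _ (c j + d j)); rewrite -{2}ci e scalerBl scale1r.
    by rewrite -addrA (addrC (d j)) subrK.
  have := congr1 (fun z => det2 (d i) z) e'; rewrite (dr _ _ (d j)) (dr _ _ (d i)) dxx mulr0 => /eqP.
  rewrite mulf_eq0 (negPf (det2_neq0 h0)) orbF subr_eq0 => /eqP s1.
  by move: t01; rewrite s1 ltxx andbF.
rewrite -lock => /hasP[u _ pu]; exfalso.
have pl k r : pdotR (real_pvec u) (c k + r *: d k) = 10%:R^-1 *
    ((1 - r) * real_of_Z R (pdot u (corner w k)) +
     r * real_of_Z R (pdot u (corner w (k.+1 %% 18)))).
  rewrite dE /c -!pdot_real /pdotR/= /GRing.scale/=; ring.
have := congr1 (pdotR (real_pvec u)) e; rewrite !pl => /(mulfI (lt0r_neq0 e0)).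
move: pu; rewrite /parted wsize.
move: (pdot u (corner w i)) (pdot u (corner w (i.+1 %% 18)))
  (pdot u (corner w j)) (pdot u (corner w (j.+1 %% 18))) => x1 x2 x3 x4.
have conv_lt (y1 y2 y3 y4 : R) : y1 < y3 -> y1 < y4 -> y2 < y3 -> y2 < y4 ->
    (1 - s) * y1 + s * y2 < (1 - t) * y3 + t * y4.
  move: s01 t01 => /andP[s0 s1] /andP[t0 t1] ? ? ? ?.
  have m1 : (1 - s) * y1 + s * y2 <= Num.max y1 y2.
    by have [?|?] := leP y1 y2; nra.
  have m2 : Num.min y3 y4 <= (1 - t) * y3 + t * y4.
    by have [?|?] := leP y3 y4; nra.
  apply: le_lt_trans m1 _; apply: lt_le_trans m2.
  by rewrite gt_max !lt_min; apply/andP; split; apply/andP.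
case/orP => hlt e1.
  have : (1 - s) * real_of_Z R x1 + s * real_of_Z R x2 <
      (1 - t) * real_of_Z R x3 + t * real_of_Z R x4.
    by apply: conv_lt; rewrite real_of_Z_lt; lia.
  by rewrite e1 ltxx.
have : (1 - s) * - real_of_Z R x1 + s * - real_of_Z R x2 <
    (1 - t) * - real_of_Z R x3 + t * - real_of_Z R x4.
  by apply: conv_lt; rewrite ltrN2 real_of_Z_lt; lia.
by rewrite !mulrN -!opprD e1 ltxx.
Qed.

Let params_lt q : params p q -> (q.1 < 18)%N /\ 0 <= q.2 < 1.
Proof. by rewrite /params/= psize. Qed.

Let meet q q' : params p q -> params p q' -> q <> q' ->
  (polygon_point p q).1 = (polygon_point p q').1 ->
  [/\ q.1 != q'.1, ~~ odd q.1, ~~ odd q'.1 & (polygon_point p q).1 = 0].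
Proof.
case: q q' => [i s] [j t] /params_lt[i18 s01] /params_lt[j18 t01] nq.
rewrite (projE _ i18) (projE _ j18) => e; have [ij|nij] := eqVneq i j; last first.
  by have [h1 h2 h3] := coincide i18 j18 nij s01 t01 e.
exfalso; apply: nq; rewrite ij; congr (_, _); move: e; rewrite ij => /addrI/eqP.
rewrite -subr_eq0 -scalerBl scaler_eq0 (negPf (d_neq0 j18)) orbF subr_eq0.
by move/eqP.
Qed.

Let height_inj i j : (i < 18)%N -> (j < 18)%N -> ~~ odd i -> ~~ odd j ->
  nth 0%BZ h i./2 = nth 0%BZ h j./2 -> i = j.
Proof.
move=> i18 j18 io jo /eqP; rewrite nth_uniq ?hsize//; lia.
Qed.

(** The only double point of the projection is the origin, which lies on the nine
    diameters; their heights are distinct, so the polygon is simple. *)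
Lemma star_projection : n_crossing_projection 9 p /\ multiple_points p #= `I_1.
Proof.
have simp : simple_polygon p.
  split; first by rewrite psize.
  move=> q q' /set_mem pq /set_mem pq' e; apply: contrapT => nq.
  have [nij io jo _] := meet pq pq' nq (congr1 fst e).
  have [i18 _] := params_lt pq; have [j18 _] := params_lt pq'.
  move: e nij io jo i18 j18; case: q q' {pq pq' nq} => [i s] [j t] e /= nij io jo i18 j18.
  have := congr1 snd e; rewrite !heightE// => /(mulfI (lt0r_neq0 e0))/intr_inj.
  move=> /(can_inj int_of_ZK)/height_inj ij; move/eqP: nij; apply; exact: ij.
have /choice[z zP] : forall k : nat, exists s : R, (k < 9)%N ->
    0 < s < 1 /\ c k.*2 = - s *: d k.*2.
  move=> k; have [k9|k9] := ltnP k 9; last by exists 0.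
  have k18 : (k.*2 < 18)%N by lia.
  have [|s s01 cs] := @zero_param k.*2 k18; first by rewrite odd_double.
  by exists s.
have strand0 k : (k < 9)%N -> strands p 0 (k.*2, z k).
  move=> k9; have [/andP[z0 z1] ck] := zP k k9.
  have k18 : (k.*2 < 18)%N by lia.
  split; first by split; rewrite /= ?psize// z1 ltW.
  by rewrite projE// ck -scalerDl addNr scale0r.
have strandsE : strands p 0 = (fun k : nat => (k.*2, z k)) @` `I_9.
  apply/seteqP; split=> [q [pq q0]|_ [k /= k9 <-]]; last exact: strand0.
  have [i18 q01] := params_lt pq.
  have [k [k9 qk]] : exists k, (k < 9)%N /\ q <> (k.*2, z k).
    have [e|ne] := pselect (q = (0%N.*2, z 0%N)); [exists 1%N|exists 0%N]; split=> //.
    by rewrite e => -[].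
  have [sk ek] := strand0 k k9.
  have [_ io _ _] := meet pq sk qk (etrans q0 (esym ek)).
  have h9 : (q.1./2 < 9)%N by lia.
  exists q.1./2 => //; apply: contrapT => nq.
  have [sk' ek'] := strand0 _ h9.
  have [+ _ _ _] := meet sk' pq nq (etrans ek' (esym q0)).
  by move=> /eqP; apply=> /=; lia.
have multE : multiple_points p = [set 0].
  apply/seteqP; split=> [x [q [q' [[pq qx] [pq' qx'] nq]]]|_ ->].
    by have [_ _ _ <-] := meet pq pq' nq (etrans qx (esym qx')).
  exists (0%N.*2, z 0%N), (1%N.*2, z 1%N); split; [exact: strand0|exact: strand0|].
  by case.
split; last first.
  have -> : multiple_points p = (fun _ : nat => 0 : plane R) @` `I_1.
    rewrite multE; apply/seteqP; split=> [_ ->|_ [k _ <-]//].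
    by exists 0%N.
  by apply: inj_card_eq => i j /set_mem/= + /set_mem/=; case: i; case: j.
split=> // x; rewrite multE => ->; rewrite /n_crossing strandsE; split.
- by apply: inj_card_eq => i j _ _ [/double_inj].
- by move=> _ [k /= k9 <-] /=; have [/andP[]] := zP k k9.
- move=> _ _ [k /= k9 <-] [l /= l9 <-] /= nkl.
  have k18 : (k.*2 < 18)%N by lia.
  have l18 : (l.*2 < 18)%N by lia.
  change (det2 (edge_vector p k.*2).1 (edge_vector p l.*2).1 != 0).
  rewrite (edgeE k18) (edgeE l18); apply: even_neq0; rewrite ?odd_double//.
  by apply/eqP => /double_inj kl; apply: nkl; rewrite kl.
Qed.

End Star.

(** * Certificates on a closed braid *)

Definition lattice_vec (x y : nat) (z : int) : vec :=
  (10 * Z.of_nat x, 10 * Z.of_nat y, 10 * Z_of_int z)%BZ.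

(** The recursions that define a closed braid, with integral coordinates, so that
    the list of vertices can be evaluated. *)
Fixpoint strand_vecs (k j : nat) (w : seq int) : seq vec * nat :=
  if w is g :: w' then
    let i := absz g in
    let: (j', mid) :=
      if j == i then (i.+1, [:: lattice_vec k.*2.+1 i.*2.+1 (- sgz g)])
      else if j == i.+1 then (i, [:: lattice_vec k.*2.+1 i.*2.+1 (sgz g)])
      else (j, [::]) in
    let: (v, e) := strand_vecs k.+1 j' w' in
    (lattice_vec k.*2 j.*2 0 :: mid ++ v, e)
  else ([:: lattice_vec k.*2 j.*2 0], j).

Fixpoint closure_vecs (n j : nat) (w : seq int) : seq vec :=
  if n is n'.+1 then
    let: (v, e) := strand_vecs 0 j w in
    v ++ lattice_vec (size w) e.*2 (-1) :: closure_vecs n' e w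
  else [::].

Definition braid_vecs (b : braid) : seq vec := closure_vecs b.1 1 b.2.

Section ClosedBraid.
Variable R : realType.

Lemma scaled_int z : 10%:R^-1 * real_of_Z R (10 * Z_of_int z)%BZ = z%:~R.
Proof.
rewrite real_of_ZM mulrA.
have -> : real_of_Z R 10%BZ = 10%:R by [].
rewrite mulVf ?pnatr_eq0// mul1r /real_of_Z.
by have -> : int_of_Z (Z_of_int z) = z by lia.
Qed.

Lemma lattice_vecE x y z : lattice_point R x y z = vertex R (lattice_vec x y z).
Proof.
rewrite /vertex /real_vec /= /GRing.scale/=.
by congr (_, _, _); [exact/esym/scaled|exact/esym/scaled|exact/esym/scaled_int].
Qed.

Lemma strand_vecsE k j w : braid_strand R k j w =
  ([seq vertex R v | v <- (strand_vecs k j w).1], (strand_vecs k j w).2).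
Proof.
elim: w k j => [|g w IH] k j /=; first by rewrite lattice_vecE.
case: ifP => _; [|case: ifP => _]; rewrite IH;
  by case: strand_vecs => v e /=; rewrite !lattice_vecE.
Qed.

Lemma closure_vecsE n j w : closed_braid_vertices R n j w =
  [seq vertex R v | v <- closure_vecs n j w].
Proof.
elim: n j => [//|n IH] j /=; rewrite strand_vecsE.
by case: strand_vecs => v e /=; rewrite map_cat /= IH lattice_vecE.
Qed.

Lemma closed_braid_loop (b : braid) : (0 < b.1)%N -> @closed_braid R b = @loop R (braid_vecs b).
Proof.
move=> b0; rewrite /closed_braid closure_vecsE polygon_loop//.
case: b b0 => [[//|n] w] _; rewrite /braid_vecs /=.
by case: strand_vecs => v e; rewrite size_cat addnS.
Qed.

Definition vflip (v : vec) : vec := (v.1, - v.2)%BZ.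

Lemma vertex_flip v : vertex R (vflip v) = flip (vertex R v).
Proof.
by rewrite /vertex /real_vec /= real_of_ZN /flip; congr (_, _); exact: mulrN.
Qed.

Lemma segment_flip (a b P : space3 R) : segment a b P -> segment (flip a) (flip b) (flip P).
Proof.
move=> [t t01 <-]; apply: (@in_segment _ _ _ _ t t01) => //=.
by rewrite /GRing.scale/=; ring.
Qed.

Lemma loop_flip q : @loop R (map vflip q) = (@flip R) @` @loop R q.
Proof.
have sub p P : @loop R p P -> @loop R (map vflip p) (flip P).
  move=> /loopP[[u v] uv uvP]; apply/loopP; exists (vflip u, vflip v).
    rewrite -map_rot; move: uv; move: (rot 1 p).
    elim: p => [|x s IH] [|y t]//=; rewrite !inE => /predU1P[[-> ->]|/IH ->].
      by rewrite eqxx.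
    by rewrite orbT.
  by rewrite /= !vertex_flip; exact: segment_flip.
apply/seteqP; split=> P; last by move=> [Q qQ <-]; exact: sub.
move=> /sub; rewrite -map_comp => h; exists (flip P); last exact: flipK.
by move: h; congr (@loop R _ _); apply: map_id_in => -[[x y] z] _; rewrite /vflip/= Z.opp_involutive.
Qed.

Lemma star_flip w h : star w (map Z.opp h) = map vflip (star w h).
Proof.
rewrite /star -map_comp; apply: eq_map => i; rewrite /vflip /=; congr (_, _).
have [ih|ih] := ltnP i./2 (size h); first by rewrite (nth_map 0%BZ).
by rewrite !nth_default ?size_map.
Qed.

End ClosedBraid.

(** The plane projection and the heights are read off the polygon. *)
Definition is_star (q : seq vec) : bool :=
  let w := [seq v.1 | v <- q] in
  let h := [seq (nth (0, 0, 0)%BZ q i.*2).2 | i <- iota 0 9] in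
  [&& star_ok w, uniq h & q == star w h].

(** The moves may end with a list of vertices whose first edge is not a diameter,
    hence the rotation by one. *)
Definition reaches_star (b : braid) (ms : seq move) : bool :=
  if run ms (braid_vecs b) is Some q then is_star q || is_star (rot 1 q) else false.

Definition reaches_grid (p : nat) (cols : seq (nat * nat * nat))
    (rows : seq (nat * nat * dihedral)) (b : braid) (ms : seq move) : bool :=
  if run ms (braid_vecs b) is Some q then grid_ok p cols rows q else false.

Section Certificates.
Variables (R : realType) (b : braid).
Hypothesis b0 : (0 < b.1)%N.

Lemma star_crossing (K : set (space3 R)) w h : star_ok w -> size h = 9%N -> uniq h ->
  ambient_isotopic K (@loop R (star w h)) -> has_n_crossing_projection 9 K 1.
Proof.
move=> wok h9 hu iso; have [proj mult] := @star_projection R w h wok h9 hu.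
exists [seq vertex R v | v <- star w h]; split=> //; rewrite polygon_loop//.
by case/and3P : wok => /eqP w18 _ _; rewrite /star size_map size_iota w18.
Qed.

(** For a mirror image, the whole isotopy is reflected, and the reflected star is
    the star with opposite heights. *)
Lemma reaches_star_crossing ms K : reaches_star b ms -> knot_type b K ->
  has_n_crossing_projection 9 (K : set (space3 R)) 1.
Proof.
rewrite /reaches_star; case E: run => [q|//] qstar.
have [w [h [wok h9 hu qE]]] : exists w h, [/\ star_ok w, size h = 9%N, uniq h &
    @loop R q = loop (star w h)].
  have star_eq q' : is_star q' -> exists w h, [/\ star_ok w, size h = 9%N, uniq h &
      q' = star w h].
    by move=> /and3P[wok hu /eqP qE]; do 2!eexists; split; [exact: wok|..|exact: qE].
  case/orP : qstar => /star_eq[w [h [wok h9 hu qE]]]; exists w, h; split=> //.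
    by rewrite -qE.
  by rewrite -qE loop_rot.
have iso := run_isotopy R E; rewrite -closed_braid_loop// qE in iso.
move=> [bK|bK].
  exact: star_crossing wok h9 hu (ambient_isotopic_trans (ambient_isotopic_sym bK) iso).
apply: (star_crossing (h := map Z.opp h) wok); first by rewrite size_map.
  by rewrite map_inj_uniq// => x y; lia.
apply: ambient_isotopic_trans (ambient_isotopic_sym bK) _.
rewrite star_flip loop_flip.
exact: ambient_isotopic_homeo (homeomorphism_flip R) iso.
Qed.

Lemma cyclic_monodromy_isotopic (K K' : set (space3 R)) :
  ambient_isotopic K K' -> cyclic_monodromy K' -> cyclic_monodromy K.
Proof.
move=> [H [_ Hh _ <-]]; apply: cyclic_monodromy_homeo; apply: Hh; exact: unit1.
Qed.

Lemma reaches_grid_crossing p cols rows ms K : (1 < p)%N -> odd p ->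
  reaches_grid p cols rows b ms -> knot_type b K ->
  ~ has_n_crossing_projection 9 (K : set (space3 R)) 0.
Proof.
move=> p1 podd; rewrite /reaches_grid; case E: run => [q|//] qgrid bK.
move=> [v [[simple _] iso]]; rewrite II0 card_eq0 => /eqP nomult.
have cyc : cyclic_monodromy K.
  exact: cyclic_monodromy_isotopic iso (cyclic_monodromy_no_crossing simple nomult).
apply: (@checked_grid_not_cyclic p cols rows R p1 podd q qgrid).
have iso' := ambient_isotopic_sym (run_isotopy R E).
apply: cyclic_monodromy_isotopic iso' _; rewrite -closed_braid_loop//.
case: bK => [bK|bK]; first exact: cyclic_monodromy_isotopic bK cyc.
exact: cyclic_monodromy_homeo (homeomorphism_flip R) (cyclic_monodromy_isotopic bK cyc).
Qed.

Lemma crossing_number_one p cols rows ms ms' K : (1 < p)%N -> odd p ->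
  reaches_star b ms -> reaches_grid p cols rows b ms' -> knot_type b K ->
  crossing_number 9 (K : set (space3 R)) 1.
Proof.
move=> p1 podd hs hg bK; split; first exact: reaches_star_crossing hs bK.
by case=> // /(reaches_grid_crossing p1 podd hg bK).
Qed.

End Certificates.

(** * The six knots *)

(** For each knot, the moves to a star and to a grid, the columns and rows of the
    grid with its colouring, and the two computations that validate them. The
    modulus of the colouring is a prime factor of the determinant of the knot. *)
Definition to_star_8_5 : seq move :=
  [:: MovR 30 (9, 74, 35); MovR 8 (-24, -16, 12); Del 2; Ins 31 (-12, -3, 7);
      Del 45; Del 23; Ins 36 (-6, -12, 12); Del 34; Del 1;
      MovR 16 (-2, 10, 28); Del 18; Del 28; Del 14; Del 38; Del 1; Del 28;
      Del 12; Ins 31 (-46, 7, 88); Del 33; Del 4; Del 0; Ins 13 (6, -12, 0);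
      MovR 9 (-2, -10, 16); Del 11; Del 26; MovR 5 (10, 3, 31); Del 21;
      Del 18; Del 19; Ins 27 (2, -10, 28); Del 2; Del 14; Del 21;
      Ins 11 (8, 6, 4); Del 25; Del 26; Ins 0 (10, -4, 20); Del 2; Del 26;
      Del 16; MovR 24 (-48, 60, 24); Ins 24 (3, 15, 16); Ins 11 (8, -6, 8);
      Del 26; Ins 17 (15, 6, 32); Del 21; Del 14; Del 9; Del 9; Del 4;
      MovR 16 (-10, -4, 32); Del 14; Ins 18 (4, 8, 12); MovR 20 (-12, -9, 4);
      Ins 6 (-4, 8, 0); Del 1; MovR 7 (-10, 0, 24); MovR 4 (-40, 30, 8);
      Del 9; MovR 15 (-15, 6, 20); Del 15; MovR 0 (50, 0, 24); Del 12; Del 8]%BZ.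

Definition to_grid_8_5 : seq move :=
  [:: Del 7; Del 18; MovR 21 (-24, 19, 33); Del 21; Del 36; Del 2;
      Ins 8 (99, 85, -34); Ins 33 (60, 30, 10); Del 14; Del 22; Del 16; Del 0;
      MovR 26 (-25, 32, 48); Del 28; Del 11; Del 32; Del 5;
      Ins 8 (50, -2, -20); Del 35; Del 2; Del 2; MovR 11 (94, 61, 5); Del 3;
      Del 7; Del 22; MovR 0 (76, 50, -27); Ins 16 (80, 17, 67); Del 5; Del 27;
      Del 28; Del 19; Del 0; Del 13; MovR 20 (42, 31, 9); Del 24;
      MovR 17 (30, 30, 10); Del 11; Del 0; MovR 5 (17, 27, -14); Del 7; Del 7;
      Del 5; Del 14; MovR 17 (90, 60, 0); Ins 1 (90, 80, 10); Del 7; Del 0;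
      Ins 11 (70, 80, 10); Ins 6 (80, 70, 10); Del 5; MovR 12 (80, 70, 0);
      Del 2; Del 11; Ins 15 (90, 80, 0); Ins 10 (30, 50, 10);
      Ins 13 (0, 70, 0); Ins 12 (20, 60, 0); Ins 15 (30, 50, 0);
      Ins 14 (0, 20, 10); Del 9; Ins 0 (10, 10, 10); Ins 12 (40, 0, 10);
      MovR 1 (40, 20, 0); Ins 2 (0, 70, 10); Ins 21 (70, 0, 0);
      MovR 23 (42, 39, 20); MovR 16 (50, 10, 0); Del 1; Ins 18 (80, 90, 0);
      Ins 2 (60, 30, 0); Ins 4 (10, 50, 10); MovR 11 (70, 0, 10);
      MovR 9 (80, 90, 10); Ins 2 (60, 90, 0); Ins 15 (70, 80, 0);
      Ins 17 (30, 30, 0); Ins 6 (10, 10, 0); MovR 2 (50, 10, 10);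
      Ins 1 (50, 40, 0); Ins 27 (10, 50, 0); Ins 27 (60, 90, 10);
      Ins 14 (20, 40, 10); Ins 13 (0, 20, 0); MovR 24 (20, 60, 10); Del 7;
      Ins 27 (20, 40, 0); Ins 12 (40, 20, 10); Ins 24 (50, 40, 10);
      Ins 13 (40, 0, 0); Ins 33 (90, 60, 10)]%BZ.

Definition columns_8_5 : seq (nat * nat * nat) :=
  [:: (2, 7, 2); (1, 5, 2); (4, 6, 0); (3, 5, 1); (0, 2, 2); (1, 4, 2); (3,
      9, 0); (0, 8, 2); (7, 9, 0); (6, 8, 1)].

Definition rows_8_5 : seq (nat * nat * dihedral) :=
  [:: (4, 7, (true, 1)); (1, 5, (true, 1)); (0, 4, (true, 1)); (3, 6, (true,
      2)); (2, 5, (true, 0)); (1, 3, (true, 1)); (2, 9, (true, 2)); (0, 8,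
      (true, 1)); (7, 9, (true, 2)); (6, 8, (true, 0))].

Lemma star_8_5 : reaches_star braid_8_5 to_star_8_5.
Proof. by vm_compute. Qed.

Lemma grid_8_5 :
  reaches_grid 3 columns_8_5 rows_8_5 braid_8_5 to_grid_8_5.
Proof. by vm_compute. Qed.

Definition to_star_8_17 : seq move :=
  [:: Del 8; MovR 14 (177, 163, 71); MovR 4 (-31, 59, -25); Del 35;
      Ins 27 (7, -10, -85); Del 6; MovR 13 (99, -99, -80); Del 8; Del 0;
      Del 16; Ins 25 (-6, -12, -24); Del 17; Del 39; Del 27;
      MovR 28 (36, 2, 8); Del 20; Del 10; Del 1; Ins 15 (6, -12, -4); Del 2;
      Del 3; Del 0; Del 9; Del 20; Del 26; MovR 18 (15, 6, -12);
      MovR 27 (-2, -10, 0); Ins 5 (-10, 0, -20); Del 10;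
      Ins 21 (-10, -4, -12); Del 11; Del 24; Del 17; Del 6; Del 21; Del 9;
      Del 9; Del 11; Ins 11 (-54, 87, -43); MovR 23 (8, -6, -16); Del 10;
      Del 11; MovR 3 (-15, 6, -28); Del 10; Del 10; MovR 9 (2, -10, -32);
      Ins 13 (10, -4, -28); MovR 5 (4, 8, -24); Ins 19 (-12, -9, -8); Del 1;
      Del 7; Ins 9 (-40, 30, -16); Del 1; Del 5; Del 13; Del 11;
      MovR 12 (8, 6, -8); Ins 8 (3, 15, 0); Ins 16 (-2, 10, -32); Del 2;
      MovR 16 (-4, 8, -4); MovR 9 (50, 0, -20); Del 15]%BZ.

Definition to_grid_8_17 : seq move :=
  [:: Del 21; MovR 25 (-6, 92, 51); Del 8; Del 7; Del 31; Del 28; Del 23;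
      MovR 21 (13, -99, -58); Del 28; Del 26; Del 24; MovR 25 (63, 96, -32);
      Del 4; Del 17; MovR 30 (-8, -3, -5); Del 30; Del 0; Del 12;
      Ins 20 (44, 75, -20); Del 1; MovR 2 (-1, 66, -44); Del 1; Del 28;
      Del 23; MovR 17 (75, -27, -29); Del 15; Del 12; Ins 0 (-14, 25, -40);
      MovR 27 (23, 63, 54); Del 16; Del 6; Ins 24 (19, -22, 12); Del 2;
      Del 18; Ins 5 (14, 6, -10); Del 6; Ins 19 (20, 40, 10); Del 20;
      MovR 0 (30, 50, 0); Ins 3 (90, 0, 0); MovR 19 (-18, 70, 45); Del 1;
      MovR 10 (40, 70, 10); Ins 1 (60, 70, 10); Del 11; Ins 13 (40, 40, 0);
      MovR 17 (30, 30, 10); Ins 7 (20, 80, 10); Ins 19 (30, 30, 0);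
      MovR 8 (90, 80, 10); Ins 13 (50, 60, 10); Ins 23 (60, 20, 0);
      Ins 26 (20, 40, 0); Ins 5 (60, 20, 10); Del 14; Ins 1 (0, 30, 0);
      Ins 10 (90, 80, 0); Ins 17 (50, 10, 0); Ins 23 (40, 40, 10);
      Ins 9 (57, -92, 5); Ins 22 (20, 80, 0); MovR 22 (80, 90, 10);
      Ins 12 (90, 0, 10); Ins 35 (70, 50, 10); Del 1; Ins 25 (50, 10, 10);
      Ins 31 (10, 20, 0); Ins 37 (40, 70, 0); Del 23; Ins 27 (10, 60, 0);
      Del 39; MovR 18 (70, 0, 10); Ins 29 (80, 10, 0); Del 36; Del 37;
      MovR 7 (80, 10, 10); Del 4; Del 37; Ins 7 (70, 0, 0); Del 20; Del 36;
      MovR 0 (10, 20, 10); MovR 2 (50, 60, 0); Ins 13 (70, 50, 0); Del 6;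
      Ins 25 (80, 90, 0); Del 35; Ins 2 (0, 90, 0); Ins 5 (30, 50, 10);
      Del 14; Ins 19 (0, 90, 10); Ins 28 (10, 60, 10); Ins 34 (60, 70, 0);
      MovR 18 (0, 30, 10)]%BZ.

Definition columns_8_17 : seq (nat * nat * nat) :=
  [:: (3, 9, 0); (2, 6, 8); (4, 8, 36); (3, 5, 16); (4, 7, 33); (1, 6, 2);
      (2, 7, 33); (0, 5, 1); (1, 9, 0); (0, 8, 1)].

Definition rows_8_17 : seq (nat * nat * dihedral) :=
  [:: (7, 9, (true, 2)); (5, 8, (true, 4)); (1, 6, (true, 16)); (0, 3,
      (true, 0)); (2, 4, (true, 3)); (3, 7, (true, 6)); (1, 5, (true, 21));
      (4, 6, (true, 33)); (2, 9, (true, 2)); (0, 8, (true, 0))].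

Lemma star_8_17 : reaches_star braid_8_17 to_star_8_17.
Proof. by vm_compute. Qed.

Lemma grid_8_17 :
  reaches_grid 37 columns_8_17 rows_8_17 braid_8_17 to_grid_8_17.
Proof. by vm_compute. Qed.

Definition to_star_8_18 : seq move :=
  [:: Del 32; Del 33; Del 24; Del 19; Del 6; MovR 35 (8, -6, 20); Del 10;
      Del 2; Del 16; Ins 17 (-6, -12, 0); Del 36; Del 3; Del 2; Del 23;
      Del 23; Ins 15 (8, 6, 32); Del 18; Del 23; Ins 26 (-15, 6, 4); Del 32;
      MovR 19 (-2, -10, 24); Ins 16 (-12, -9, 32); MovR 8 (6, -12, 28);
      Del 12; MovR 10 (-40, 30, 20); MovR 22 (15, 6, 16); Ins 13 (10, -4, 4);
      Del 5; Del 18; Del 24; Ins 28 (-2, 10, 12); MovR 5 (4, -4, 6); Del 8;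
      Ins 24 (2, -10, 12); Del 27; Del 2; MovR 7 (1, -5, 6); Del 4; Del 8;
      Del 27; MovR 5 (-4, 8, 28); Del 3; Del 2; Del 22; MovR 18 (6, -1, 1);
      Ins 9 (3, 15, 24); Del 19; Del 20; Del 16; Del 19; Del 1; Del 16;
      MovR 9 (4, 8, 0); Del 10; Ins 0 (-10, 0, 8); Ins 0 (-10, -4, 16);
      Del 15; MovR 6 (50, 0, 8); Del 1]%BZ.

Definition to_grid_8_18 : seq move :=
  [:: Del 16; Del 44; Del 29; Del 11; Del 9; Del 28; Del 21;
      MovR 34 (-14, -31, -68); Del 22; Del 34; Del 1; Ins 35 (42, 66, -69);
      Del 35; MovR 4 (56, 26, 67); Ins 17 (0, 60, 0); Del 12; Del 31; Del 7;
      Ins 25 (74, 23, -57); Ins 9 (-7, -14, 1); Del 14; Del 9;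
      MovR 27 (41, -1, 51); Ins 22 (75, 43, 3); Del 23; Del 30; Del 9; Del 16;
      Del 16; Del 27; Ins 16 (20, 70, 10); Del 27; Del 1; Ins 6 (0, 0, 10);
      MovR 22 (-22, 49, -18); Del 21; Del 5; Ins 2 (90, 90, 10);
      Ins 21 (30, 80, 0); Ins 10 (50, 70, 10); Ins 20 (10, 50, 10);
      Ins 10 (20, 90, 10); Ins 0 (20, 90, 0); Del 30; Del 18;
      Ins 28 (40, 60, 10); Del 14; Del 18; Del 0; Ins 14 (60, 40, 0); Del 9;
      MovR 6 (40, 10, 10); MovR 20 (50, 30, 10); Del 21; Del 8;
      Ins 18 (9, 1, 10); Del 14; Ins 26 (0, 60, 10); Ins 25 (-13, -47, -29);
      Ins 27 (50, 70, 0); MovR 24 (60, 20, 0); Ins 9 (50, 30, 0); Del 21;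
      Ins 3 (90, 90, 0); Del 26; Ins 2 (60, 20, 10); MovR 17 (40, 60, 0);
      Del 26; Del 11; Ins 2 (10, 80, 0); MovR 3 (30, 20, 10);
      Ins 13 (70, 30, 0); Del 10; Ins 10 (60, 40, 10); Del 20;
      Ins 0 (40, 10, 0); MovR 23 (70, 0, 10); MovR 9 (80, 10, 0);
      Ins 8 (30, 20, 0); MovR 25 (80, 50, 10); MovR 1 (10, 50, 0);
      Ins 11 (90, 40, 0); Ins 6 (20, 70, 0); Ins 19 (10, 80, 10);
      Ins 32 (80, 10, 10); Ins 26 (70, 30, 10); Ins 13 (80, 50, 0);
      Ins 14 (90, 40, 10); MovR 31 (30, 80, 10); Ins 22 (70, 0, 0);
      MovR 1 (0, 0, 0)]%BZ.

Definition columns_8_18 : seq (nat * nat * nat) :=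
  [:: (0, 6, 0); (5, 8, 1); (7, 9, 1); (2, 8, 1); (1, 6, 0); (3, 7, 1); (2,
      4, 2); (0, 3, 0); (1, 5, 0); (4, 9, 1)].

Definition rows_8_18 : seq (nat * nat * dihedral) :=
  [:: (0, 7, (true, 0)); (4, 8, (true, 0)); (3, 6, (true, 1)); (5, 7, (true,
      0)); (6, 9, (true, 2)); (1, 8, (true, 1)); (0, 4, (true, 0)); (2, 5,
      (true, 2)); (1, 3, (true, 2)); (2, 9, (true, 2))].

Lemma star_8_18 : reaches_star braid_8_18 to_star_8_18.
Proof. by vm_compute. Qed.

Lemma grid_8_18 :
  reaches_grid 3 columns_8_18 rows_8_18 braid_8_18 to_grid_8_18.
Proof. by vm_compute. Qed.

Definition to_star_4_1_sum_4_1 : seq move :=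
  [:: Del 26; Del 31; Del 10; Del 60; Del 18; MovR 54 (-11, -12, 7); Del 35;
      Del 42; Del 51; Del 9; Del 32; MovR 5 (-4, 8, -16); Del 36; Del 3;
      Ins 16 (6, -12, -16); Del 21; Del 41; Del 35; MovR 30 (96, 34, -75);
      Ins 21 (-48, -19, -18); Ins 45 (4, 15, 0); Del 35; Del 52; Del 28;
      Ins 41 (2, -9, -3); Del 35; Ins 17 (-10, 0, -28); Del 14; Del 2; Del 26;
      Del 41; Del 16; Ins 17 (28, 23, 4); Del 15; Del 12; Ins 1 (-10, -4, -4);
      Del 42; MovR 2 (50, 0, -28); Del 35; Del 16; Del 8; Del 0; Del 9;
      Del 31; Del 6; Del 28; Del 3; Del 0; Del 29; Del 10; Del 19;
      MovR 22 (57, 37, 1); Del 10; MovR 18 (42, -96, -48); Del 3; Del 1;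
      Ins 11 (3, 15, 0); Del 7; Ins 0 (-2, 10, -32); Del 5;
      MovR 7 (13, 21, -23); Del 1; Del 3; Ins 16 (4, 8, -8); Del 4;
      Ins 1 (-15, 2, -28); Del 18; Del 15; Del 20; Del 16; Del 16; Del 20;
      Del 3; MovR 16 (-12, -9, -20); Ins 1 (-15, 6, -24);
      MovR 11 (-2, -10, 0); MovR 14 (8, -6, -12); MovR 1 (-40, 30, -12);
      Del 9; Del 0; MovR 0 (2, -10, -32); MovR 6 (8, 6, -20); Del 8;
      MovR 16 (10, -4, -24); MovR 14 (-6, -12, -8); Del 9; Del 0; Del 12;
      Ins 8 (15, 6, -4)]%BZ.

Definition to_grid_4_1_sum_4_1 : seq move :=
  [:: Del 46; Del 25; MovR 25 (102, 101, 97); Del 48; Del 40; Del 19; Del 55;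
      Del 44; Ins 56 (24, 12, -48); Del 54; Del 58; MovR 29 (13, -3, 33);
      Ins 1 (28, 53, -5); Del 1; Del 38; Del 12; Del 32; Ins 5 (138, 67, -48);
      Del 34; Del 18; Del 9; Del 11; Del 51; Del 45; Del 0; Del 22;
      MovR 27 (-19, 46, 9); Del 3; Del 4; Del 22; Del 6; Del 11; Del 19;
      MovR 5 (88, 86, -27); MovR 35 (99, -95, 98); Del 38; Del 0; Del 33;
      Del 23; Del 4; Del 28; Del 7; Del 0; Del 32; MovR 18 (369, 108, -342);
      Ins 18 (30, 80, 0); Del 31; MovR 28 (50, 10, 10); Ins 3 (20, 60, 0);
      Ins 25 (70, 20, 10); Del 25; Del 10; Ins 19 (10, 90, 10); Del 1; Del 27;
      Del 1; Ins 22 (80, 10, 10); Ins 2 (20, 30, 0); Ins 31 (80, 10, 0);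
      Del 32; Del 30; Ins 3 (50, 10, 0); Del 27; Del 17; Del 6; Del 3;
      Ins 16 (40, 60, 10); Del 16; Del 21; Ins 21 (40, 0, 0); Del 2; Del 11;
      MovR 15 (0, 0, 0); Del 24; Del 24; Ins 8 (10, 50, 0); Del 6;
      Ins 21 (60, 40, 0); Ins 25 (10, 50, 10); Ins 20 (40, 0, 10);
      Ins 3 (0, 80, 10); Ins 24 (20, 30, 10); Del 18; MovR 27 (90, 40, 0);
      Ins 27 (60, 90, 0); MovR 14 (80, 30, 0); MovR 11 (30, 50, 10);
      Ins 9 (90, 20, 0); Ins 27 (10, 90, 0); Ins 2 (60, 40, 10);
      Ins 8 (70, 70, 10); Del 3; MovR 28 (70, 20, 0); MovR 4 (50, 70, 0);
      Ins 13 (0, 0, 10); Ins 11 (60, 90, 10); Ins 28 (30, 80, 10); Del 14;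
      Ins 19 (0, 80, 0); Del 20; Ins 31 (90, 20, 10); Ins 14 (40, 60, 0);
      MovR 12 (30, 50, 0); Ins 24 (20, 60, 10); Del 23; Ins 6 (70, 70, 0);
      Ins 6 (80, 30, 10); Ins 28 (90, 40, 10); Ins 8 (50, 70, 10); Del 19]%BZ.

Definition columns_4_1_sum_4_1 : seq (nat * nat * nat) :=
  [:: (0, 8, 0); (5, 9, 2); (3, 6, 3); (5, 8, 4); (0, 6, 0); (1, 7, 0); (4,
      9, 2); (2, 7, 4); (1, 3, 0); (2, 4, 1)].

Definition rows_4_1_sum_4_1 : seq (nat * nat * dihedral) :=
  [:: (0, 4, (true, 0)); (5, 8, (true, 0)); (7, 9, (true, 2)); (2, 8, (true,
      4)); (6, 9, (true, 2)); (1, 3, (true, 1)); (2, 4, (true, 3)); (5, 7,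
      (true, 3)); (0, 3, (true, 0)); (1, 6, (true, 4))].

Lemma star_4_1_sum_4_1 : reaches_star (connected_sum braid_4_1 braid_4_1) to_star_4_1_sum_4_1.
Proof. by vm_compute. Qed.

Lemma grid_4_1_sum_4_1 :
  reaches_grid 5 columns_4_1_sum_4_1 rows_4_1_sum_4_1 (connected_sum braid_4_1 braid_4_1) to_grid_4_1_sum_4_1.
Proof. by vm_compute. Qed.

Definition to_star_9_47 : seq move :=
  [:: Del 49; Del 5; Del 11; Del 58; Del 42; Del 3; Del 25;
      MovR 11 (-15, 6, 20); Del 46; Del 20; Del 28; Del 36; Del 18; Del 25;
      Del 29; Del 7; Del 8; Del 38; Del 32; Del 37; Del 28; Del 31; Del 7;
      MovR 20 (-40, 30, 8); Del 32; MovR 27 (-2, -9, 14); Del 29;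
      Ins 9 (-19, -4, 36); MovR 30 (17, -1, 20); Del 11; Del 22;
      Ins 16 (17, 23, -14); Ins 37 (6, -12, 0); Del 1; Del 27; Del 29; Del 18;
      Del 26; Del 16; Del 25; Del 0; Ins 13 (8, 1, 17); Ins 19 (3, 15, 24);
      Del 30; MovR 11 (50, 0, 12); Del 6; Ins 7 (8, 6, 4); Del 17; Del 4;
      Del 20; Ins 27 (-2, 10, 16); Del 22; Ins 7 (-4, 8, 0); Del 9;
      MovR 25 (29, 19, 42); MovR 15 (-12, -9, 4); Del 13; Ins 8 (8, -6, 8);
      Ins 25 (-10, 0, 12); Del 27; Del 0; Del 8; Del 3; MovR 15 (-10, -4, 28);
      MovR 23 (-2, -10, 24); Del 11; Del 8; MovR 16 (10, -4, 20); Del 20;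
      Del 4; Del 6; MovR 18 (4, 8, 32); Del 2; Del 19; MovR 6 (15, 6, 28);
      Ins 17 (2, -10, 16); MovR 16 (-6, -12, 32); Del 14; Del 16]%BZ.

Definition to_grid_9_47 : seq move :=
  [:: Del 39; Ins 36 (-44, 23, -40); Del 39; Del 26; Del 20; Del 9; Del 26;
      Del 50; Del 49; Del 3; Del 21; Del 50; Del 11; Del 36; Del 35; Del 34;
      Del 22; MovR 23 (-27, 86, 22); Del 29; Del 30; Del 36; Del 12; Del 32;
      Del 35; Ins 5 (34, -29, 14); MovR 34 (50, 0, 10); Del 18; Del 28;
      Del 23; Del 20; Del 17; Ins 28 (70, 70, 10); Del 19; Del 21; Del 29;
      Del 11; Del 18; Del 9; Del 6; MovR 22 (29, -43, 22); Del 7; Del 3;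
      Del 7; Del 25; Del 24; Del 11; Del 20; Del 19; Del 16;
      MovR 5 (-1, 11, -12); Ins 5 (1, -3, 22); Ins 16 (-18, 77, 30); Del 1;
      MovR 13 (20, 30, 0); Del 21; MovR 18 (30, 50, 10); Ins 15 (10, 60, 0);
      Ins 19 (40, 40, 0); Ins 16 (2, 18, -36); Del 12; Del 6;
      Ins 16 (31, -50, 22); Del 1; Ins 8 (0, 20, 0); MovR 16 (10, 10, 10);
      Del 5; MovR 8 (20, 80, 10); Del 8; Ins 13 (60, 50, 10); Del 16;
      Ins 15 (40, 70, 10); Del 12; Ins 2 (60, 80, 10); Del 14;
      Ins 18 (40, 40, 10); MovR 5 (50, 60, 0); Del 15; MovR 12 (30, 50, 0);
      Ins 14 (80, 10, 0); Ins 0 (80, 40, 0); Del 14; Ins 18 (30, 20, 10);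
      MovR 17 (10, 10, 0); Del 17; Ins 21 (70, 30, 0); Del 1;
      Ins 20 (60, 80, 0); Ins 13 (10, 60, 10); Ins 5 (0, 0, 10);
      Ins 25 (50, 0, 0); MovR 15 (40, 70, 0); MovR 19 (60, 50, 0);
      Ins 4 (20, 80, 0); Ins 16 (50, 60, 10); Ins 23 (80, 40, 10);
      Ins 13 (30, 20, 0); Ins 19 (80, 10, 10); MovR 10 (0, 0, 0);
      Ins 2 (0, 20, 10); Ins 12 (20, 30, 10); Ins 4 (70, 70, 0);
      Ins 34 (70, 30, 10)]%BZ.

Definition columns_9_47 : seq (nat * nat * nat) :=
  [:: (0, 2, 1); (1, 6, 1); (3, 8, 0); (2, 5, 1); (4, 7, 0); (0, 6, 1); (5,
      8, 0); (3, 7, 0); (1, 4, 1)].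

Definition rows_9_47 : seq (nat * nat * dihedral) :=
  [:: (0, 5, (true, 2)); (1, 8, (true, 2)); (0, 3, (true, 2)); (2, 7, (true,
      1)); (4, 8, (true, 2)); (3, 6, (true, 0)); (1, 5, (true, 2)); (4, 7,
      (true, 0)); (2, 6, (true, 0))].

Lemma star_9_47 : reaches_star braid_9_47 to_star_9_47.
Proof. by vm_compute. Qed.

Lemma grid_9_47 :
  reaches_grid 3 columns_9_47 rows_9_47 braid_9_47 to_grid_9_47.
Proof. by vm_compute. Qed.

Definition to_star_9_49 : seq move :=
  [:: Del 32; Del 43; Del 19; Del 38; Del 56; Ins 29 (27, 32, 3); Del 68;
      MovR 27 (-64, 38, 38); Del 48; Del 47; Del 5; Del 8; Del 2; Del 18;
      Del 24; Del 28; Del 5; Del 16; Del 14; Del 9; Del 45; Del 16; Del 39;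
      Del 14; Ins 2 (-15, 6, 12); Del 44; Del 13; Del 50; Del 48; Del 31;
      Del 15; Del 42; Ins 8 (-12, -9, 28); MovR 39 (-10, -4, 20); Del 5;
      Del 12; Del 17; Ins 12 (-10, 0, 0); Del 36; MovR 26 (-6, -12, 8); Del 6;
      Del 17; Del 1; Ins 19 (6, -12, 24); Del 15; Del 37; Del 29; Del 26;
      Del 34; Del 0; Del 6; Del 14; Del 32; Del 25; MovR 16 (-2, -10, 16);
      Del 25; Ins 22 (10, -4, 12); Del 29; Del 28; MovR 5 (50, 0, 0);
      Ins 1 (35, -5, 25); Del 23; Del 12; MovR 7 (-4, 8, 24);
      MovR 13 (15, 6, 20); Ins 25 (5, 26, 11); Del 2; Del 6; Del 7; Del 14;
      Del 23; Del 9; Ins 6 (4, 8, 8); Del 8; MovR 16 (8, 6, 28); Del 14;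
      Del 14; Del 10; Del 17; Del 14; Del 0; MovR 8 (3, 15, 16); Del 15;
      Ins 8 (-40, 30, 32); MovR 10 (-2, 10, 4); MovR 10 (8, -6, 32); Del 12;
      Ins 16 (2, -10, 4); Del 1]%BZ.

Definition to_grid_9_49 : seq move :=
  [:: Del 48; Del 47; Del 65; MovR 39 (34, 73, -25); Del 69; Del 22; Del 39;
      Del 32; Del 30; Del 32; Del 56; Del 24; Ins 24 (60, 80, 10); Del 3;
      MovR 48 (-6, 11, -35); Del 9; Del 28; MovR 27 (30, 31, -1); Del 55;
      Del 32; Del 43; Del 38; Del 6; Del 23; Del 34; Del 4; Del 5; Del 44;
      Del 7; Del 27; MovR 44 (-98, 89, -48); Del 10; Del 39; Del 11; Del 19;
      Del 8; Del 42; Del 20; Del 29; Del 15; Del 7; Del 17; Ins 0 (-8, 4, 19);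
      Ins 30 (20, 20, 0); Del 30; Del 25; Del 23; Del 27; Ins 17 (0, 70, 0);
      Del 2; Del 28; Del 24; Ins 9 (65, 41, 7); MovR 34 (20, 60, 10); Del 12;
      Del 1; MovR 7 (60, 80, 0); Del 9; Del 5; Ins 6 (0, 10, 0);
      Ins 1 (30, 10, 0); Ins 4 (80, 50, 0); Ins 28 (40, 70, 0); Del 5; Del 0;
      Ins 0 (30, 50, 0); Del 19; Del 4; Del 11; Ins 5 (10, 80, 10); Del 11;
      MovR 18 (50, 40, 10); Ins 18 (-9, -33, 19); MovR 15 (10, 40, 0); Del 12;
      MovR 3 (40, 30, 10); Ins 30 (20, 60, 0); Del 4; Del 15;
      MovR 21 (30, 50, 10); Del 9; Del 25; Ins 21 (0, 10, 10); Del 6;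
      Ins 22 (0, 70, 10); Ins 9 (50, 40, 0); MovR 18 (40, 70, 10); Del 17;
      Del 0; Ins 25 (10, 40, 10); Del 7; Ins 4 (40, 30, 0);
      MovR 14 (50, 0, 10); Ins 26 (30, 10, 10); MovR 14 (60, 20, 10);
      Ins 5 (70, 30, 0); Ins 22 (10, 80, 0); Del 3; Del 10; Ins 11 (80, 0, 0);
      Del 19; Del 21; Ins 4 (70, 60, 0); Ins 28 (20, 20, 10);
      Ins 19 (80, 0, 10); MovR 17 (70, 30, 10); Ins 15 (80, 50, 10);
      Ins 18 (70, 60, 10); Ins 29 (60, 20, 0); Ins 25 (50, 0, 0)]%BZ.

Definition columns_9_49 : seq (nat * nat * nat) :=
  [:: (1, 7, 3); (4, 8, 0); (2, 6, 4); (1, 5, 3); (3, 7, 2); (0, 4, 1); (2,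
      8, 0); (3, 6, 0); (0, 5, 1)].

Definition rows_9_49 : seq (nat * nat * dihedral) :=
  [:: (5, 8, (true, 2)); (0, 3, (true, 1)); (2, 6, (true, 4)); (4, 7, (true,
      4)); (1, 5, (true, 2)); (3, 8, (true, 2)); (2, 7, (true, 0)); (0, 4,
      (true, 1)); (1, 6, (true, 0))].

Lemma star_9_49 : reaches_star braid_9_49 to_star_9_49.
Proof. by vm_compute. Qed.

Lemma grid_9_49 :
  reaches_grid 5 columns_9_49 rows_9_49 braid_9_49 to_grid_9_49.
Proof. by vm_compute. Qed.

Theorem mainTheorem5 (R : realType) (K : set (space3 R)) :
  knot_8_5 K \/ knot_8_17 K \/ knot_8_18 K \/ knot_4_1_sum_4_1 K \/
  knot_9_47 K \/ knot_9_49 K ->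
  crossing_number 9 K 1.
Proof.
move=> [|[|[|[|[|]]]]] knotK.
- exact: (crossing_number_one (b := braid_8_5) _ _ _ star_8_5 grid_8_5 knotK).
- exact: (crossing_number_one (b := braid_8_17) _ _ _ star_8_17 grid_8_17 knotK).
- exact: (crossing_number_one (b := braid_8_18) _ _ _ star_8_18 grid_8_18 knotK).
- exact: (crossing_number_one (b := connected_sum braid_4_1 braid_4_1) _ _ _
    star_4_1_sum_4_1 grid_4_1_sum_4_1 knotK).
- exact: (crossing_number_one (b := braid_9_47) _ _ _ star_9_47 grid_9_47 knotK).
- exact: (crossing_number_one (b := braid_9_49) _ _ _ star_9_49 grid_9_49 knotK).
Qed.
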